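(* Let $\beta\ge 1$ and let $V$ be a polynomial of degree $2n$ with $\inf_{x\in\mathbb{R}}V''(x)\ge\alpha$ for some $\alpha>0$. Let $\rho_0$ be a compactly supported probability measure on $\mathbb{R}$ whose Stieltjes transform $U_0$, restricted to $\Pi_+$, extends to a continuous function $\bar\Pi_+\to\mathbb{C}$. Let $(\rho_t)_{t\ge0}$ be the solution of the Mc Kean-Vlasov equation with initial condition $\rho_0$, and let $U_t$ be the Stieltjes transform of $\rho_t$. Then, for every $t\ge 0$, $U_t\big|_{\Pi_+}$ extends to a continuous function on $\bar\Pi_+$. In particular, for every $t\ge 0$, $\rho_t$ has a density $x\mapsto\rho_t(x)$ which is a continuous function.
   Context: Notation: $\Pi_+=\{z\in\mathbb{C}\mid \mathrm{Im}\,z>0\}$ and $\bar\Pi_+=\Pi_+\cup\mathbb{R}$. The Mc Kean-Vlasov equation is $$\frac{\partial\rho_t(x)}{\partial t}=\frac{\partial}{\partial x}\Big(\Big(V'(x)-\frac{\beta}{2}\,\mathrm{p.v.}\!\int\frac{\rho_t(y)}{x-y}\,dy\Big)\rho_t(x)\Big),$$ understood in the weak (distribution) sense. Under the assumptions on $V$ it is known to have a unique solution in $C([0,T],\mathcal{P}(\mathbb{R}))$ for every $T>0$ ($\mathcal{P}(\mathbb{R})$: probability measures on $\mathbb{R}$ with the weak topology), obtained as the weak limit as $N\to\infty$ of the empirical measures $\frac1N\sum_{i=1}^N\delta_{\lambda^i_t}$ of the system $d\lambda_t^i=\frac{1}{\sqrt N}dW_t^i-V'(\lambda_t^i)dt+\frac{\beta}{2N}\sum_{j\ne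 i}\frac{dt}{\lambda_t^i-\lambda_t^j}$, $i=1,\dots,N$, driven by independent standard Brownian motions. For each $T>0$ there is $R=R(T)$ such that $\mathrm{supp}(\rho_t)\subset[-R,R]$ for $0\le t\le T$. The Stieltjes transform of $\rho_t$ is $U_t(z)=\int\frac{\rho_t(dx)}{x-z}$, $z\in\mathbb{C}\setminus\mathbb{R}$. It satisfies $$\frac{\partial U_t(z)}{\partial t}=\frac{\partial}{\partial z}\Big(\frac{\beta}{4}U_t(z)^2+V'(z)U_t(z)+T_t(z)\Big),\qquad T_t(z)=\int\frac{V'(x)-V'(z)}{x-z}\,\rho_t(dx).$$ *)

(* Defs.v *)
From HB Require Import structures.
From mathcomp Require Import all_boot all_order all_algebra.
From mathcomp Require Import complex.
From mathcomp Require Import all_classical all_reals all_analysis.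

Set Implicit Arguments.
Unset Strict Implicit.
Unset Printing Implicit Defensive.
Import Order.TTheory GRing.Theory Num.Theory.
Import numFieldNormedType.Exports.

Local Open Scope classical_set_scope.
Local Open Scope ring_scope.
Local Open Scope complex_scope.

Definition upper_half_plane (R : realType) : set R[i] :=
  [set z | 0 < complex.Im z].

Definition closed_upper_half_plane (R : realType) : set R[i] :=
  [set z | 0 <= complex.Im z].

Arguments upper_half_plane R : clear implicits.
Arguments closed_upper_half_plane R : clear implicits.

(* The complex integral is taken componentwise; for z off the real axis both
   integrands are bounded and continuous. *)
Definition stieltjes (R : realType) (mu : probability (measurableTypeR R) R)
    (z : R[i]) : R[i] :=
  (\int[mu]_x complex.Re (x%:C - z)^-1) +i*
  (\int[mu]_x complex.Im (x%:C - z)^-1).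

(* R[i]^o is R[i] with the topology of its norm. *)
Definition extends_continuously (R : realType) (U : R[i] -> R[i]) : Prop :=
  exists g : R[i]^o -> R[i]^o,
    {within (closed_upper_half_plane R : set R[i]^o), continuous g} /\
    (forall z, upper_half_plane R z -> g z = U z).

Definition compactly_supported (R : realType)
    (mu : probability (measurableTypeR R) R) : Prop :=
  exists K : set R, compact K /\ mu (~` K) = 0%E.

Definition weakly_continuous (R : realType)
    (rho : R -> probability (measurableTypeR R) R) : Prop :=
  forall f : R -> R, continuous f -> bounded_fun f ->
    {within `[0, +oo[, continuous (fun t => \int[rho t]_x f x)}.

Definition test_function (R : realType) (f : R -> R) : Prop :=
  (forall (k : nat) (x : R), derivable (derive1n k f) x 1) /\
  compact (closure [set x | f x != 0]).

Definition difference_quotient (R : realType) (g : R -> R) (x y : R) : R :=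
  if x == y then derive1 g x else (g x - g y) / (x - y).

(* Testing the equation against f and integrating by parts leaves
   beta / 2 times the integral of p.v. f'(x) / (x - y) against
   rho_s(dx) rho_s(dy). As the principal value of a general measure is not a
   function, this term is read, as usual, after symmetrizing in (x, y): the
   kernel becomes half the difference quotient of f', continuous with value
   f''(x) on the diagonal. *)
Definition mckean_vlasov_solution (R : realType) (beta : R) (V : {poly R})
    (rho0 : probability (measurableTypeR R) R)
    (rho : R -> probability (measurableTypeR R) R) : Prop :=
  [/\ weakly_continuous rho,
      forall A : set (measurableTypeR R), measurable A -> rho 0 A = rho0 A
    & forall (f : R -> R) (t : R), test_function f -> 0 <= t ->
        \int[rho t]_x f x = \int[rho 0]_x f x +
          \int[lebesgue_measure]_(s in `[0, t])
            (beta / 4%:R *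
               (\int[rho s]_x \int[rho s]_y difference_quotient (derive1 f) x y)
             - \int[rho s]_x (derive1 f x * (deriv V).[x]))].

Definition has_continuous_density (R : realType)
    (mu : probability (measurableTypeR R) R) : Prop :=
  exists p : R -> R,
    [/\ continuous p, forall x, 0 <= p x
      & forall A : set (measurableTypeR R), measurable A ->
          mu A = (\int[lebesgue_measure]_(x in A) (p x)%:E)%E].

(* Main.v *)
(* The moments of [rho t] stay bounded on bounded time intervals, so the weak
   equation extends to the Cauchy kernels and U satisfies a Burgers equation with
   transport velocity k U + V', where k = beta / 2, up to a bounded source.  Follow
   a characteristic backwards from a point of the upper half-plane at time t > 0;
   it moves away from the real axis with speed about k Im U.  Writing Im U = y N,
   with y the height and N = \int rho(dx) / |x - z|^2, a comparison argument gives
   k s N <= 1 + O(s) after the time s, so |U|^2 <= N = O(1/s), while U varies little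
   along the characteristic; hence U is bounded near the real axis for t > 0.

   Let now D and E be the differences of the positions and of the values along the
   characteristics issued from two nearby points z1 and z2, and suppose that
   E(0) = e is much larger than |z1 - z2|.  After a small time s one has
   D ~ k s E, while E = D I where I is the integral of 1 / ((x - w1)(x - w2)).
   Thus k s I ~ 1: the Cauchy kernels at w1 and w2, whose squared norms are at most
   about 1 / (k s), nearly saturate the Cauchy-Schwarz inequality.  This forces w1
   and w2 to be close compared with s, which bounds e ~ |D| / (k s).  Hence U is
   uniformly continuous on bounded parts of the half-plane and extends to its
   closure; the density then comes from Stieltjes inversion. *)

From HB Require Import structures.
Require Import Defs.
From mathcomp Require Import all_boot all_order all_algebra.
From mathcomp Require Import complex ring lra.
From mathcomp Require Import all_classical all_reals all_analysis measurable_realfun.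
Set Implicit Arguments.
Unset Strict Implicit.
Unset Printing Implicit Defensive.
Import Order.TTheory GRing.Theory Num.Theory.
Import numFieldNormedType.Exports.
Local Open Scope classical_set_scope.
Local Open Scope ring_scope.

(** * Calculus and ordinary differential equations *)

Section Calculus.
Variable R : realType.
Implicit Types (f df : R -> R) (a b K : R).

(** Only compactly supported test functions are available, so the moments must be propagated before
    the weak equation can be tested against Cauchy kernels; space integrals are then controlled by
    polynomial growth ([tame]), not by a support. Time runs backwards because Im U >= 0 then pushes
    characteristics upwards: they live for a time S that does not depend on how low they start. The
    source is V''(z) U plus a polynomial in z whose coefficients are moments; since V is real, its
    imaginary part is at most a multiple of Im U + Im z, which the comparison of k s Im U with Im z
    can absorb. With n the distance of the two points, e the difference of the two values and S any
    small flow time, the outcome is e^2 <= G (H S + 8 n / (k S e)). One chooses S in terms of the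
    wanted precision, and then n in terms of S. *)

Lemma near_continuous f (x e : R) : {for x, continuous f} -> 0 < e ->
  \forall y \near x, `|f x - f y| < e.
Proof. by move=> cf e0; exact: (@cvgr_dist_lt _ _ _ _ _ f _ cf). Qed.

Lemma continuous_addr f df : continuous f -> continuous df -> continuous (fun x => f x + df x).
Proof. by move=> cf cg x; apply: continuousD; [exact: cf|exact: cg]. Qed.

Lemma continuous_subr f df : continuous f -> continuous df -> continuous (fun x => f x - df x).
Proof. by move=> cf cg x; apply: continuousB; [exact: cf|exact: cg]. Qed.

Lemma continuous_mulr f df : continuous f -> continuous df -> continuous (fun x => f x * df x).
Proof. by move=> cf cg x; apply: continuousM; [exact: cf|exact: cg]. Qed.

Lemma is_derive_continuous f (x d : R) : is_derive x 1 f d -> {for x, continuous f}.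
Proof. by move=> h; apply/differentiable_continuous/derivable1_diffP; exact: ex_derive. Qed.

Lemma within_continuous_is_derive f df a b :
  (forall x, a <= x <= b -> is_derive x 1 f (df x)) ->
  {within `[a, b], continuous f}.
Proof.
move=> fd; apply: derivable_within_continuous => x; rewrite in_itv /= => xab.
exact: (@ex_derive _ _ _ _ _ _ _ (fd x xab)).
Qed.

Lemma is_derive_MVT f df a b : a <= b ->
  (forall x, a <= x <= b -> is_derive x 1 f (df x)) ->
  exists2 c, a <= c <= b & f b - f a = df c * (b - a).
Proof.
move=> ab fd.
have fd' x : x \in `]a, b[ -> is_derive x 1 f (df x).
  by rewrite in_itv /= => /andP[/ltW ax /ltW xb]; apply: fd; apply/andP.
have [c] := MVT_segment ab fd' (within_continuous_is_derive fd).
by rewrite in_itv /=; exists c.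
Qed.

Lemma is_derive_ge0_le f df a b : a <= b ->
  (forall x, a <= x <= b -> is_derive x 1 f (df x)) ->
  (forall x, a <= x <= b -> 0 <= df x) -> f a <= f b.
Proof.
move=> ab fd d0; rewrite -subr_ge0.
have [c cab ->] := is_derive_MVT ab fd.
by rewrite mulr_ge0 ?d0 // subr_ge0.
Qed.

Lemma is_derive_norm_le f df a b K : a <= b ->
  (forall x, a <= x <= b -> is_derive x 1 f (df x)) ->
  (forall x, a <= x <= b -> `|df x| <= K) -> `|f b - f a| <= K * (b - a).
Proof.
move=> ab fd d0.
have [c cab ->] := is_derive_MVT ab fd.
rewrite normrM [`|b - a|]ger0_norm ?subr_ge0 //.
by rewrite ler_wpM2r ?d0 // subr_ge0.
Qed.

Lemma is_derive_dominated f df g dg a b : a <= b ->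
  (forall x, a <= x <= b -> is_derive x 1 f (df x)) ->
  (forall x, a <= x <= b -> is_derive x 1 g (dg x)) ->
  (forall x, a <= x <= b -> `|df x| <= dg x) -> `|f b - f a| <= g b - g a.
Proof.
move=> ab fd gd dfg.
have h1 : (g \- f) a <= (g \- f) b.
  apply: (@is_derive_ge0_le (g \- f) (dg \- df)) => //= x xab.
    by apply: is_deriveB; [exact: gd|exact: fd].
  by have := dfg _ xab; rewrite ler_norml /= => /andP[]; lra.
have h2 : (g \+ f) a <= (g \+ f) b.
  apply: (@is_derive_ge0_le (g \+ f) (dg \+ df)) => //= x xab.
    by apply: is_deriveD; [exact: gd|exact: fd].
  have := dfg _ xab; rewrite ler_norml /= => /andP[]; lra.
by rewrite ler_norml /= in h1 h2 *; apply/andP; split; lra.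
Qed.

Lemma geometric_cauchy_cvgn (u : R^nat) A :
  (forall k, `|u k.+1 - u k| <= A * 2^-1 ^+ k) ->
  forall k, `|limn u - u k| <= A * 2 * 2^-1 ^+ k.
Proof.
move=> hu.
have A0 : 0 <= A by have := le_trans (normr_ge0 _) (hu 0%N); rewrite expr0 mulr1.
have bnd k m : `|u (k + m)%N - u k| <= A * 2 * (2^-1 ^+ k - 2^-1 ^+ (k + m)%N).
  elim: m => [|m IH]; first by rewrite addn0 !subrr normr0 mulr0.
  rewrite addnS (_ : _ - _ = (u (k + m).+1 - u (k + m)%N) + (u (k + m)%N - u k)); last by ring.
  apply: (le_trans (ler_normD _ _)); apply: (le_trans (lerD (hu _) IH)).
  by rewrite exprS; set p := 2^-1 ^+ _; set q := 2^-1 ^+ k; rewrite le_eqVlt; apply/orP; left; apply/eqP; field.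
have p0 k : 0 <= 2^-1 ^+ k :> R by apply: exprn_ge0; rewrite invr_ge0.
have bnd' k m : (k <= m)%N -> `|u m - u k| <= A * 2 * 2^-1 ^+ k.
  move=> km; rewrite -(subnKC km); apply: (le_trans (bnd _ _)).
  by rewrite ler_wpM2l ?mulr_ge0 // lerBlDr lerDl.
have cu : cvgn u.
  apply/cauchy_cvgP/cauchyP => e e0.
  have /cvgrPdist_lt /(_ _ e0) [N _ hN] : (A * 2 * 2^-1 ^+ k) @[k --> \oo] --> (0 : R).
    rewrite -[X in _ --> X](mulr0 (A * 2)); apply: cvgM; first exact: cvg_cst.
    by apply: cvg_expr; rewrite ger0_norm ?invr_ge0 // invf_lt1 // ltr1n.
  exists (u N); exists N => // m /= Nm; rewrite /ball /= distrC.
  apply: (le_lt_trans (bnd' _ _ Nm)).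
  have := hN N (leqnn N); rewrite sub0r normrN ger0_norm // !mulr_ge0 //.
move=> k; rewrite distrC.
have : (fun m => `|u k - u m|) @ \oo --> `|u k - limn u|.
  by apply: cvg_norm; apply: cvgB => //; exact: cvg_cst.
move=> hc; rewrite -(cvg_lim (@norm_hausdorff _ _) hc); apply: limr_le.
  by apply/cvg_ex; eexists; exact: hc.
by exists k => // m /= km; rewrite distrC bnd'.
Qed.

End Calculus.

(** * Picard iteration for planar systems on a fixed time interval *)

Section Picard.
Variable R : realType.
Implicit Types (f g X Y : R -> R) (F : R -> R -> R -> R).

Lemma segment_bounded f (a b : R) : a <= b -> {within `[a, b], continuous f} ->
  exists2 A : R, 0 <= A & forall x, a <= x <= b -> `|f x| <= A.
Proof.
move=> ab cf.
have [c _ hc] := EVT_max ab cf; have [d _ hd] := EVT_min ab cf.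
exists (`|f c| + `|f d|); first by rewrite addr_ge0.
move=> x xab; have xab' : x \in `[a, b] by rewrite in_itv.
have := hc _ xab'; have := hd _ xab'.
have := ler_norm (f c); have := ler_norm (- f d); rewrite normrN.
have := normr_ge0 (f c); have := normr_ge0 (f d).
by rewrite (ler_norml (f x)) => *; apply/andP; split; lra.
Qed.

(** Integration starts at -1 so that 0 is an interior point and the derivative there is two-sided;
    the subtracted constant makes the value at 0 vanish. *)
Definition primitive g (s : R) : R :=
  \int[@lebesgue_measure R]_(r in `[-1, s]) g r - \int[@lebesgue_measure R]_(r in `[-1, 0]) g r.

Lemma primitive0 g : primitive g 0 = 0.
Proof. by rewrite /primitive subrr. Qed.

Lemma is_derive_primitive g (s : R) : continuous g -> 0 <= s ->
  is_derive s 1 (primitive g) (g s).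
Proof.
move=> cg s0.
have ig : (@lebesgue_measure R).-integrable `[-1, s + 1] (EFin \o g).
  by apply: continuous_compact_integrable; [exact: segment_compact|exact: continuous_subspaceT].
have s1 : -1 < s by apply: lt_le_trans s0; rewrite ltrN10.
have ss1 : s < s + 1 by rewrite ltrDl.
have [dg eg] := continuous_FTC1_closed ss1 ig s1 (cg s).
rewrite -[g s]subr0.
apply: (@is_deriveB _ _ _ _ (cst (\int[@lebesgue_measure R]_(r in `[-1, 0]) g r))).
by apply: DeriveDef; [exact: dg | rewrite -derive1E eg].
Qed.

(** Composing with this 1-Lipschitz retraction onto [a, b] turns functions that are controlled only
    on a segment into functions continuous on the whole line. *)
Definition clamp (a b x : R) := Num.min (Num.max x a) b.

Lemma clamp_id (a b x : R) : a <= x <= b -> clamp a b x = x.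
Proof. by move=> /andP[ax xb]; rewrite /clamp max_l // min_l. Qed.

Lemma clamp_in (a b x : R) : a <= b -> a <= clamp a b x <= b.
Proof.
by move=> ab; rewrite /clamp le_min ab ge_min lexx orbT le_max lexx orbT.
Qed.

Lemma clamp_lip (a b x y : R) : `|clamp a b x - clamp a b y| <= `|x - y|.
Proof.
have hmin u v : `|Num.min u b - Num.min v b| <= `|u - v|.
  have h1 := ler_norm (u - v); have h2 := ler_norm (v - u).
  move: h1 h2; rewrite (distrC v); set N := `|u - v| => h1 h2; rewrite ler_norml.
  by case: (leP u b) => ?; case: (leP v b) => ?; apply/andP; split; lra.
have hmax u v : `|Num.max u a - Num.max v a| <= `|u - v|.
  have h1 := ler_norm (u - v); have h2 := ler_norm (v - u).
  move: h1 h2; rewrite (distrC v); set N := `|u - v| => h1 h2; rewrite ler_norml.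
  by case: (leP u a) => ?; case: (leP v a) => ?; apply/andP; split; lra.
exact: (le_trans (hmin _ _)).
Qed.

Lemma clamp_continuous (a b : R) : continuous (clamp a b).
Proof.
move=> x; apply/cvgrPdist_lt => e e0; near=> y.
apply: (le_lt_trans (clamp_lip _ _ _ _)); near: y.
exact: (@near_continuous _ id).
Unshelve. all: by end_near.
Qed.

Definition lip_field L F := forall s x y x' y',
  `|F s x y - F s x' y'| <= L * (`|x - x'| + `|y - y'|).

Lemma lip_field_comp L F X Y c : 0 < L -> lip_field L F ->
  (forall x y, continuous (fun s => F s x y)) ->
  continuous X -> continuous Y -> continuous c ->
  continuous (fun s => F (c s) (X s) (Y s)).
Proof.
move=> L0 lF cF cX cY cc s; apply/cvgrPdist_lt => e e0; near=> r.
rewrite (_ : _ - _ = (F (c s) (X s) (Y s) - F (c r) (X s) (Y s))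
                   + (F (c r) (X s) (Y s) - F (c r) (X r) (Y r))); last by ring.
have h1 : `|X s - X r| < e / 4 / L by near: r; apply: (near_continuous (cX s)); rewrite !divr_gt0.
have h2 : `|Y s - Y r| < e / 4 / L by near: r; apply: (near_continuous (cY s)); rewrite !divr_gt0.
have h3 : `|F (c s) (X s) (Y s) - F (c r) (X s) (Y s)| < e / 2.
  near: r; apply: (@near_continuous _ (fun r => F (c r) (X s) (Y s))); last by rewrite divr_gt0.
  by apply: (@continuous_comp _ _ _ c (fun t => F t (X s) (Y s))); [exact: cc|exact: cF].
apply: (le_lt_trans (ler_normD _ _)).
have h4 := lF (c r) (X s) (Y s) (X r) (Y r).
have h5 : L * (`|X s - X r| + `|Y s - Y r|) < e / 2.
  rewrite -ltr_pdivlMl // mulrC; apply: (lt_le_trans (ltrD h1 h2)).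
  by rewrite le_eqVlt; apply/orP; left; apply/eqP; field; rewrite gt_eqF.
lra.
Unshelve. all: by end_near.
Qed.

Lemma uniform_limit_continuousR (u : nat -> R -> R) (v : R -> R) A :
  (forall k, continuous (u k)) ->
  (forall k s, `|v s - u k s| <= A * 2^-1 ^+ k) -> continuous v.
Proof.
move=> cu huv s; apply/cvgrPdist_lt => e e0.
have [k hk] : exists k, A * 2^-1 ^+ k < e / 4.
  have /cvgrPdist_lt /(_ (e / 4)) : (A * 2^-1 ^+ k) @[k --> \oo] --> (0 : R).
    rewrite -[X in _ --> X](mulr0 A); apply: cvgM; first exact: cvg_cst.
    by apply: cvg_expr; rewrite ger0_norm ?invr_ge0 // invf_lt1 // ltr1n.
  case; first by rewrite divr_gt0.
  move=> N _ hN; exists N; have := hN N (leqnn N).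
  by rewrite sub0r normrN; apply: le_lt_trans; rewrite ler_norm.
near=> r.
have h : `|u k s - u k r| < e / 4.
  by near: r; apply: (near_continuous (cu k s)); rewrite divr_gt0.
have h1 := huv k s; have h2 := huv k r.
rewrite (_ : _ - _ = (v s - u k s) + (u k s - u k r) - (v r - u k r)); last by ring.
apply: (le_lt_trans (ler_normB _ _)); have := ler_normD (v s - u k s) (u k s - u k r).
lra.
Unshelve. all: by end_near.
Qed.

Lemma comp_clamp_continuous (a b : R) X dX : a <= b ->
  (forall s, a <= s <= b -> is_derive s 1 X (dX s)) -> continuous (X \o clamp a b).
Proof.
move=> ab hX s; apply: continuous_comp; first exact: clamp_continuous.
have := hX _ (clamp_in s ab) => h.
by apply/differentiable_continuous/derivable1_diffP; exact: ex_derive.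
Qed.

End Picard.

Section PicardLindelof.
Variable R : realType.
Variables (F G : R -> R -> R -> R) (L S x0 y0 : R).
Hypotheses (L0 : 0 < L) (S0 : 0 <= S).
Hypotheses (lF : lip_field L F) (lG : lip_field L G).
Hypotheses (cF : forall x y, continuous (fun s => F s x y))
  (cG : forall x y, continuous (fun s => G s x y)).

Let c := clamp 0 S.

(** Time is read through the clamp [c], so the integrands are continuous on all of R even though the
    curves are controlled on [0, S] only. *)
Definition picard_step (Z : (R -> R) * (R -> R)) : (R -> R) * (R -> R) :=
  (fun s => x0 + primitive (fun r => F (c r) (Z.1 (c r)) (Z.2 (c r))) s,
   fun s => y0 + primitive (fun r => G (c r) (Z.1 (c r)) (Z.2 (c r))) s).

Definition picard_iter k := iter k picard_step (cst x0, cst y0).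

Definition clamp_cts (Z : (R -> R) * (R -> R)) :=
  continuous (Z.1 \o c) /\ continuous (Z.2 \o c).

Lemma picard_field_cts Z : clamp_cts Z ->
  continuous (fun r => F (c r) (Z.1 (c r)) (Z.2 (c r))) /\
  continuous (fun r => G (c r) (Z.1 (c r)) (Z.2 (c r))).
Proof.
by move=> [c1 c2]; split; [apply: (@lip_field_comp _ L F (Z.1 \o c) (Z.2 \o c))|
  apply: (@lip_field_comp _ L G (Z.1 \o c) (Z.2 \o c))] => //; exact: clamp_continuous.
Qed.

Lemma picard_step_derive Z s : clamp_cts Z -> 0 <= s <= S ->
  is_derive s 1 (picard_step Z).1 (F s (Z.1 s) (Z.2 s)) /\
  is_derive s 1 (picard_step Z).2 (G s (Z.1 s) (Z.2 s)).
Proof.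
move=> /picard_field_cts [c1 c2] sS; have s0 : 0 <= s by case/andP: sS.
have h1 := is_derive_primitive c1 s0; have h2 := is_derive_primitive c2 s0.
rewrite /c (clamp_id sS) in h1 h2.
split; rewrite -[X in is_derive _ _ _ X]add0r.
  exact: (@is_deriveD _ _ _ (cst x0) _ _ _ _ _ _ h1).
exact: (@is_deriveD _ _ _ (cst y0) _ _ _ _ _ _ h2).
Qed.

Lemma picard_step_cts Z : clamp_cts Z -> clamp_cts (picard_step Z).
Proof.
move=> cZ; split; apply: comp_clamp_continuous => // s sS.
  by have [] := picard_step_derive cZ sS; eauto.
by have [] := picard_step_derive cZ sS; eauto.
Qed.

(** The gain is measured by any primitive [b] of L a: an exponential one gives the contraction, an
    affine one serves to pass to the limit. *)
Lemma picard_step_dist Z Z' (a b : R -> R) : clamp_cts Z -> clamp_cts Z' ->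
  (forall s, 0 <= s <= S -> `|Z'.1 s - Z.1 s| + `|Z'.2 s - Z.2 s| <= a s) ->
  (forall s, 0 <= s <= S -> is_derive s 1 b (L * a s)) ->
  forall s, 0 <= s <= S ->
    `|(picard_step Z').1 s - (picard_step Z).1 s| <= b s - b 0 /\
    `|(picard_step Z').2 s - (picard_step Z).2 s| <= b s - b 0.
Proof.
move=> cZ cZ' ha hb s /andP[s0 sS].
have sub r : 0 <= r <= s -> 0 <= r <= S by move=> /andP[-> rs]; exact: le_trans sS.
have e0 W : (picard_step W).1 0 = x0 /\ (picard_step W).2 0 = y0.
  by rewrite /picard_step /= !primitive0 !addr0.
have [eZ1 eZ2] := e0 Z; have [eZ'1 eZ'2] := e0 Z'.
split.
  have := @is_derive_dominated _ ((picard_step Z').1 - (picard_step Z).1)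
    (fun s => F s (Z'.1 s) (Z'.2 s) - F s (Z.1 s) (Z.2 s)) b (fun s => L * a s) 0 s s0.
  rewrite !fctE eZ1 eZ'1 subrr subr0; apply.
  - move=> r /sub rS; apply: is_deriveB.
      by have [] := picard_step_derive cZ' rS.
    by have [] := picard_step_derive cZ rS.
  - by move=> r /sub; exact: hb.
  - move=> r /sub rS; apply: (le_trans (lF _ _ _ _ _)).
    by rewrite ler_pM2l // ha.
have := @is_derive_dominated _ ((picard_step Z').2 - (picard_step Z).2)
  (fun s => G s (Z'.1 s) (Z'.2 s) - G s (Z.1 s) (Z.2 s)) b (fun s => L * a s) 0 s s0.
rewrite !fctE eZ2 eZ'2 subrr subr0; apply.
- move=> r /sub rS; apply: is_deriveB.
    by have [] := picard_step_derive cZ' rS.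
  by have [] := picard_step_derive cZ rS.
- by move=> r /sub; exact: hb.
- move=> r /sub rS; apply: (le_trans (lG _ _ _ _ _)).
  by rewrite ler_pM2l // ha.
Qed.

Lemma picard_iter_cts k : clamp_cts (picard_iter k).
Proof.
elim: k => [|k IH]; last exact: picard_step_cts.
by split => s; apply: cst_continuous.
Qed.

(** Integrating L exp(4 L s) gains a factor 1/4, and the two components together lose a factor 2. In
    this weight the step is a contraction of ratio 1/2 on the whole of [0, S], whatever the length
    S. *)
Lemma picard_iter_dist : exists2 A : R, 0 <= A & forall k (s : R), 0 <= s <= S ->
  `|(picard_iter k.+1).1 s - (picard_iter k).1 s| +
  `|(picard_iter k.+1).2 s - (picard_iter k).2 s| <= A * 2^-1 ^+ k * expR (4 * L * s).
Proof.
have cts1 : {within `[0, S], continuous (picard_iter 1).1} /\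
            {within `[0, S], continuous (picard_iter 1).2}.
  split.
    apply: (@within_continuous_is_derive _ _ (fun s => F s x0 y0)) => s sS.
    by have [] := picard_step_derive (picard_iter_cts 0) sS.
  apply: (@within_continuous_is_derive _ _ (fun s => G s x0 y0)) => s sS.
  by have [] := picard_step_derive (picard_iter_cts 0) sS.
have [A A0 hA] := segment_bounded S0 cts1.1.
have [B B0 hB] := segment_bounded S0 cts1.2.
exists (A + `|x0| + (B + `|y0|)); first by rewrite !addr_ge0.
set C := A + _ + _; have C0 : 0 <= C by rewrite !addr_ge0.
elim => [|k IH] s sS.
  apply: (@le_trans _ _ C).
    rewrite /C; apply: lerD; apply: (le_trans (ler_normB _ _)); rewrite lerD2r.
      exact: hA.
    exact: hB.
  rewrite expr0 mulr1 ler_peMr // -expR0 ler_expR !mulr_ge0 //; first exact: ltW.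
  by case/andP: sS.
pose b (s : R) : R := C * 2^-1 ^+ k / 4 * expR (4 * L * s).
have hb (r : R) : is_derive r 1 b (L * (C * 2^-1 ^+ k * expR (4 * L * r))).
  apply: is_derive_eq; rewrite /GRing.scale /=; by field.
have [h1 h2] := picard_step_dist (picard_iter_cts k) (picard_iter_cts k.+1) IH (fun r _ => hb r) sS.
apply: (le_trans (lerD h1 h2)).
have b0 : 0 <= b 0 by rewrite /b mulr_ge0 ?expR_ge0 // !mulr_ge0 ?exprn_ge0 ?invr_ge0.
apply: (@le_trans _ _ (b s + b s)); first lra.
rewrite /b exprS le_eqVlt; apply/orP; left; apply/eqP; by field.
Qed.

(* The field is only used at times in [0, S], but the solution is differentiable
   (two-sidedly) at the endpoints too. *)
Lemma picard_lindelof : exists X Y : R -> R, [/\ X 0 = x0, Y 0 = y0 &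
  forall s, 0 <= s <= S ->
    is_derive s 1 X (F s (X s) (Y s)) /\ is_derive s 1 Y (G s (X s) (Y s))].
Proof.
have [A A0 hA] := picard_iter_dist.
pose B := A * expR (4 * L * S).
pose X (s : R) : R := limn (fun k => (picard_iter k).1 s).
pose Y (s : R) : R := limn (fun k => (picard_iter k).2 s).
have hB k (s : R) : 0 <= s <= S ->
  `|(picard_iter k.+1).1 s - (picard_iter k).1 s| +
  `|(picard_iter k.+1).2 s - (picard_iter k).2 s| <= B * 2^-1 ^+ k.
  move=> sS; apply: (le_trans (hA k s sS)); rewrite /B -!mulrA ler_wpM2l // mulrC.
  rewrite ler_wpM2r ?exprn_ge0 ?invr_ge0 // ler_expR ler_pM2l //.
  by rewrite ler_pM2l //; case/andP: sS.
have hX k (s : R) : 0 <= s <= S -> `|X s - (picard_iter k).1 s| <= B * 2 * 2^-1 ^+ k.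
  move=> sS; apply: (geometric_cauchy_cvgn (u := fun k => (picard_iter k).1 s)) => m.
  by apply: le_trans (hB m s sS); rewrite lerDl.
have hY k (s : R) : 0 <= s <= S -> `|Y s - (picard_iter k).2 s| <= B * 2 * 2^-1 ^+ k.
  move=> sS; apply: (geometric_cauchy_cvgn (u := fun k => (picard_iter k).2 s)) => m.
  by apply: le_trans (hB m s sS); rewrite lerDr.
have cXY : clamp_cts (X, Y).
  split; apply: (@uniform_limit_continuousR _ (fun k => _ \o c) _ (B * 2)).
  - by move=> k; case: (picard_iter_cts k) => + _; apply.
  - by move=> k s; apply: hX; apply: clamp_in.
  - by move=> k; case: (picard_iter_cts k) => _; apply.
  - by move=> k s; apply: hY; apply: clamp_in.
have fixXY (s : R) : 0 <= s <= S -> (picard_step (X, Y)).1 s = X s /\ (picard_step (X, Y)).2 s = Y s.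
  move=> sS.
  have D k : `|(picard_step (X, Y)).1 s - (picard_iter k.+1).1 s| <= 4 * B * L * S * 2^-1 ^+ k /\
             `|(picard_step (X, Y)).2 s - (picard_iter k.+1).2 s| <= 4 * B * L * S * 2^-1 ^+ k.
    pose b (s : R) : R := L * (4 * B * 2^-1 ^+ k) * s.
    have hb (r : R) : is_derive r 1 b (L * (4 * B * 2^-1 ^+ k)).
      by apply: is_derive_eq; rewrite /GRing.scale /= mulr1.
    have hd (r : R) : 0 <= r <= S -> `|X r - (picard_iter k).1 r| + `|Y r - (picard_iter k).2 r|
       <= 4 * B * 2^-1 ^+ k.
      by move=> rS; have := hX k r rS; have := hY k r rS; lra.
    have [h1 h2] := picard_step_dist (picard_iter_cts k) cXY hd (fun r _ => hb r) sS.
    have le : b s - b 0 <= 4 * B * L * S * 2^-1 ^+ k.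
      rewrite /b mulr0 subr0 (_ : 4 * B * L * S * 2^-1 ^+ k = L * (4 * B * 2^-1 ^+ k) * S); last by ring.
      rewrite ler_wpM2l //; last by case/andP: sS.
      by rewrite !mulr_ge0 ?exprn_ge0 ?invr_ge0 ?expR_ge0 // ltW.
    by split; [exact: le_trans h1 le|exact: le_trans h2 le].
  have z (u v : R) (w : nat -> R) M : (forall k, `|u - w k.+1| <= M * 2^-1 ^+ k) ->
      (forall k, `|v - w k| <= B * 2 * 2^-1 ^+ k) -> u = v.
    move=> hu hv; apply/eqP; rewrite -subr_eq0 -normr_le0.
    have lim0 : ((M + B) * 2^-1 ^+ k) @[k --> \oo] --> (0 : R).
      rewrite -[X in _ --> X](mulr0 (M + B)); apply: cvgM; first exact: cvg_cst.
      by apply: cvg_expr; rewrite ger0_norm ?invr_ge0 // invf_lt1 // ltr1n.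
    rewrite -(cvg_lim (@norm_hausdorff _ _) lim0); apply: limr_ge.
      by apply/cvg_ex; eexists; exact: lim0.
    near=> k.
    have := hu k; have := hv k.+1; rewrite exprS => h1 h2.
    rewrite (_ : u - v = (u - w k.+1) - (v - w k.+1)); last by ring.
    apply: (le_trans (ler_normB _ _)); apply: (le_trans (lerD h2 h1)).
    by rewrite le_eqVlt; apply/orP; left; apply/eqP; by field.
  split.
    by apply: (z _ _ (fun k => (picard_iter k).1 s)) => k; [exact: (D k).1|exact: hX].
  by apply: (z _ _ (fun k => (picard_iter k).2 s)) => k; [exact: (D k).2|exact: hY].
(* The limit is a fixed point on [0, S] only. Its image under one more step agrees with it there and
   is differentiable from both sides at 0 and S. *)
exists (picard_step (X, Y)).1, (picard_step (X, Y)).2; split.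
- by rewrite /= primitive0 addr0.
- by rewrite /= primitive0 addr0.
- move=> s sS; have [-> ->] := fixXY s sS.
  exact: (picard_step_derive cXY sS).
Unshelve. all: by end_near.
Qed.

End PicardLindelof.

(** * Smooth test functions *)

Section Smooth.
Variable R : realType.
Implicit Types (f g : R -> R) (p q : {poly R}) (a b x : R).

(* Derivatives of [exp (-1/x)], extended by 0 to the negative half-line. *)
Definition bump p x : R := if 0 < x then p.[x^-1] * expR (- x^-1) else 0.

(** For a monomial this is t^(n+1) <= (n+1)! exp t at t = 1/x. A bound linear in |x| is enough
    because it holds for every p: applied to 'X * p it controls the difference quotient at 0. *)
Lemma bump_le p : exists2 C : R, 0 <= C & forall x, `|bump p x| <= C * `|x|.
Proof.
elim/poly_ind: p => [|p c [C C0 hC]].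
  by exists 0 => // x; rewrite /bump horner0 mul0r if_same normr0 mul0r.
have hX : forall n, exists2 C : R, 0 <= C & forall x, `|bump 'X^n x| <= C * `|x|.
  move=> n; exists (n.+1)`!%:R => // x; rewrite /bump; case: ltrP => x0; last first.
    by rewrite normr0 mulr_ge0.
  have i0 : 0 < x^-1 by rewrite invr_gt0.
  have fg0 : 0 < (n.+1)`!%:R :> R by rewrite ltr0n fact_gt0.
  have h : x^-1 ^+ n.+1 <= (n.+1)`!%:R * expR x^-1.
    have h := expR_ge1Dxn n (ltW i0).
    rewrite -ler_pdivrMl // mulrC; apply: le_trans h; lra.
  have x0' := ltW x0.
  rewrite hornerXn expRN !ger0_norm ?mulr_ge0 ?exprn_ge0 ?invr_ge0 ?expR_ge0 //.
  rewrite ler_pdivrMr ?expR_gt0 // mulrAC -ler_pdivrMr //.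
  by rewrite -exprSr.
have hall : forall q, exists2 C : R, 0 <= C & forall x, `|bump q x| <= C * `|x|.
  move=> q; suff [D D0 hD] : exists2 C : R, 0 <= C & forall x,
      `|bump (\sum_(i < size q) q`_i *: 'X^i) x| <= C * `|x|.
    by exists D => //; move: hD; rewrite -poly_def coefK.
  elim/big_ind: _ => [|u v [Cu Cu0 hu] [Cv Cv0 hv]|i _].
  - by exists 0 => // x; rewrite /bump horner0 mul0r if_same normr0 mul0r.
  - exists (Cu + Cv); first by rewrite addr_ge0.
    move=> x; rewrite mulrDl; apply: le_trans (lerD (hu x) (hv x)).
    rewrite /bump; case: ifP => _; last by rewrite normr0 addr0.
    by rewrite hornerD mulrDl ler_normD.
  - have [D D0 hD] := hX i; exists (`|q`_i| * D); first by rewrite mulr_ge0.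
    move=> x; have := hD x; rewrite /bump; case: ifP => _ h.
      by rewrite hornerZ -mulrA normrM -mulrA ler_wpM2l.
    by rewrite normr0 !mulr_ge0.
exact: hall.
Qed.

(** The family is closed under differentiation, hence consists of smooth functions. At 0 the
    quotient [bump p h] / h is [bump ('X * p) h], which tends to 0 by the linear bound. *)
Lemma is_derive_bump p x : is_derive x 1 (bump p) (bump ('X^2 * (p - p^`())) x).
Proof.
case: (ltrgtP x 0) => x0.
- have e : \near x, cst 0 x = bump p x.
    near=> y; have y0 : y < 0 by near: y; exact: lt_nbhsl.
    by rewrite /bump ltNge (ltW y0).
  by rewrite /bump ltNge (ltW x0) /=; apply: (near_eq_is_derive e); exact: is_derive_cst.
- have e : \near x, p.[x^-1] * expR (- x^-1) = bump p x.
    near=> y; have y0 : 0 < y by near: y; exact: lt_nbhsr.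
    by rewrite /bump y0.
  rewrite /bump x0; apply: (near_eq_is_derive e).
  have hV : is_derive x 1 (fun y : R => y^-1) (- x ^- 2).
    apply: DeriveDef; first exact/derivableV/derivable_id/lt0r_neq0.
    by rewrite deriveV ?lt0r_neq0 // derive_id /GRing.scale /= mulr1.
  have hp : is_derive x 1 (horner p \o (fun y : R => y^-1)) (p^`().[x^-1] * (- x ^- 2)).
    exact: is_derive1_comp.
  have he : is_derive x 1 (expR \o (fun y : R => - y^-1)) (expR (- x^-1) * (- (- x ^- 2))).
    by apply: is_derive1_comp.
  apply: (is_derive_eq (is_deriveM hp he)).
  rewrite /GRing.scale /= hornerM hornerXn hornerD hornerN; by field; rewrite gt_eqF.
- rewrite x0 /bump ltxx; have [C C0 hC] := bump_le ('X * p).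
  suff h : h^-1 *: ((bump p \o shift 0) (h *: 1) - bump p 0) @[h --> 0^'] --> (0 : R).
    by apply: DeriveDef; [apply/cvg_ex; exists 0|exact/cvg_lim].
  apply/cvgrPdist_lt => e e0; near=> h.
  have h0 : h != 0 by near: h; exact: nbhs_dnbhs_neq.
  rewrite sub0r normrN /= {2}/bump ltxx subr0 addr0 /GRing.scale /= mulr1.
  have -> : h^-1 * bump p h = bump ('X * p) h.
    by rewrite /bump; case: ifP => _; [rewrite hornerM hornerX mulrA|rewrite mulr0].
  apply: (le_lt_trans (hC h)).
  have hh : `|h| < e / (C + 1).
    by near: h; apply: dnbhs0_lt; rewrite divr_gt0 // ltr_wpDl.
  apply: (@le_lt_trans _ _ ((C + 1) * `|h|)); first by rewrite ler_wpM2r // lerDl.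
  by rewrite -ltr_pdivlMl ?ltr_wpDl // mulrC.
Unshelve. all: by end_near.
Qed.
End Smooth.

Section Elementary.
Variable R : realType.
Implicit Types (f g : R -> R) (p q : {poly R}) (a b x : R).

(** Real and imaginary parts of 1 / (x - (a + i b)); the second is pi times the Poisson kernel at
    height b. *)
Definition cauchy_re a b x : R := (x - a) / ((x - a) ^+ 2 + b ^+ 2).
Definition cauchy_im a b x : R := b / ((x - a) ^+ 2 + b ^+ 2).

Lemma sqr_add_gt0 x b : b != 0 -> 0 < x ^+ 2 + b ^+ 2.
Proof. by move=> b0; rewrite ltr_wpDl ?sqr_ge0 // lt0r sqrf_eq0 b0 sqr_ge0. Qed.

Lemma is_derive_invf f x df : f x != 0 -> is_derive x 1 f df ->
  is_derive x 1 (fun y => (f y)^-1) (- df / f x ^+ 2).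
Proof.
move=> f0 dfx; have [d1 d2] := dfx.
apply: DeriveDef; first exact: derivableV.
by rewrite deriveV // d2 /GRing.scale /=; field.
Qed.

Lemma is_derive_cauchy a b x : b != 0 ->
  is_derive x 1 (cauchy_re a b) (cauchy_im a b x ^+ 2 - cauchy_re a b x ^+ 2) /\
  is_derive x 1 (cauchy_im a b) (- 2 * cauchy_re a b x * cauchy_im a b x).
Proof.
move=> b0; have n0 y : (y - a) ^+ 2 + b ^+ 2 != 0 by apply: lt0r_neq0; exact: sqr_add_gt0.
have dn : is_derive x 1 (fun y => (y - a) ^+ 2 + b ^+ 2) (2 * (x - a)).
  by apply: is_derive_eq; rewrite /GRing.scale /=; ring.
have dV := @is_derive_invf (fun y => (y - a) ^+ 2 + b ^+ 2) x _ (n0 x) dn.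
split.
  have dl : is_derive x 1 (fun y => y - a) 1 by apply: is_derive_eq; rewrite subr0.
  apply: (is_derive_eq (is_deriveM dl dV)).
  by rewrite /GRing.scale /cauchy_im /cauchy_re /=; field.
apply: (is_derive_eq (is_deriveM (is_derive_cst b x 1) dV)).
by rewrite /GRing.scale /cauchy_im /cauchy_re /=; field.
Qed.

(** A class closed under differentiation and containing all test functions that occur, so that
    smoothness of every order follows from the existence of one derivative inside the class. *)
Inductive elementary : (R -> R) -> Prop :=
| elementary_poly p : elementary (horner p)
| elementary_bump p q : elementary (fun x => bump p q.[x])
| elementary_re a b : b != 0 -> elementary (cauchy_re a b)
| elementary_im a b : b != 0 -> elementary (cauchy_im a b)
| elementary_add f g : elementary f -> elementary g -> elementary (fun x => f x + g x)
| elementary_mul f g : elementary f -> elementary g -> elementary (fun x => f x * g x).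

Lemma elementary_eq f g : f =1 g -> elementary f -> elementary g.
Proof. by move=> /funext <-. Qed.

Lemma elementary_derive f : elementary f ->
  exists2 g, elementary g & forall x, is_derive x 1 f (g x).
Proof.
elim=> {f} [p|p q|a b b0|a b b0|f g _ [f' ef hf] _ [g' eg hg]|f g ef0 [f' ef hf] eg0 [g' eg hg]].
- by exists (horner p^`()); [exact: elementary_poly|move=> x; exact: is_derive_poly].
- exists (fun x => bump ('X^2 * (p - p^`())) q.[x] * q^`().[x]).
    by apply: elementary_mul; [exact: elementary_bump|exact: elementary_poly].
  move=> x; apply: (@is_derive1_comp _ (bump p) (horner q)); exact: is_derive_bump.
- exists (fun x => cauchy_im a b x * cauchy_im a b x
     + (-1)%:P.[x] * (cauchy_re a b x * cauchy_re a b x)).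
    have := (elementary_im a b0, elementary_re a b0) => -[eI eR].
    apply: elementary_add; first exact: (elementary_mul eI eI).
    apply: elementary_mul; first exact: elementary_poly.
    exact: (elementary_mul eR eR).
  by move=> x; apply: (is_derive_eq (is_derive_cauchy _ _ b0).1); rewrite hornerC; ring.
- exists (fun x => (-2)%:P.[x] * (cauchy_re a b x * cauchy_im a b x)).
    apply: elementary_mul; first exact: elementary_poly.
    exact: elementary_mul (elementary_re a b0) (elementary_im a b0).
  by move=> x; apply: (is_derive_eq (is_derive_cauchy _ _ b0).2); rewrite hornerC; ring.
- by exists (fun x => f' x + g' x); [exact: elementary_add|move=> x; exact: is_deriveD].
- exists (fun x => f x * g' x + g x * f' x).
    by apply: elementary_add; apply: elementary_mul.
  by move=> x; exact: is_deriveM.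
Qed.

Lemma elementary_smooth f k x : elementary f -> derivable (derive1n k f) x 1.
Proof.
elim: k f => [|k IH] f /elementary_derive [g eg hg].
  exact: (@ex_derive _ _ _ _ _ _ _ (hg x)).
rewrite derive1Sn (_ : derive1 f = g); first exact: IH.
by apply/funext => y; rewrite derive1E; have [] := hg y.
Qed.

Lemma elementary_test f (B : R) : elementary f ->
  (forall x, B < `|x| -> f x = 0) -> test_function f.
Proof.
move=> ef f0; split; first by move=> k x; exact: elementary_smooth.
apply: (@subclosed_compact _ _ `[(- B), B]); [exact: closed_closure|exact: segment_compact|].
rewrite closureEbigcap => y /= hy; apply: (hy [set` `[(- B), B]]); split; first exact: itv_closed.
move=> x /= fx; rewrite in_itv /= -ler_norml leNgt; apply/negP => /f0 /eqP.
by rewrite (negbTE fx).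
Qed.

End Elementary.

Section Cutoff.
Variable R : realType.
Implicit Types (p q : {poly R}) (x r : R).

Lemma bump_bounded p : exists2 C : R, 0 <= C & forall r, r <= 1 -> `|bump p r| <= C.
Proof.
have c : {within `[0, 1], continuous (bump p)}.
  by apply: (@within_continuous_is_derive _ _ _ _ _ (fun x _ => is_derive_bump p x)).
have [C C0 hC] := segment_bounded ler01 c.
exists C => // r r1; have [r0|r0] := lerP 0 r; first by rewrite hC // r0.
by rewrite /bump ltNge (ltW r0) normr0.
Qed.

(* [cutoff] is 1 at 0, vanishes on [1, +oo[, and lies below the line 1 - r. *)
Definition cutoff r : R := expR 1 * bump 1 (1 - r).
Definition cutoff1 r : R := - expR 1 * bump 'X^2 (1 - r).
Definition cutoff2 r : R := expR 1 * bump ('X^2 * ('X^2 - 'X^2^`())) (1 - r).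

Lemma is_derive_cutoff r : is_derive r 1 cutoff (cutoff1 r).
Proof.
have d : is_derive r 1 (fun r : R => 1 - r) (-1) by apply: is_derive_eq; rewrite /GRing.scale /=; ring.
have h := @is_derive1_comp _ (bump 1) (fun r => 1 - r) r _ _ (is_derive_bump 1 (1 - r)) d.
apply: (is_derive_eq (is_deriveM (is_derive_cst (expR 1) r 1) h)).
by rewrite /GRing.scale /cutoff1 /= derivC subr0 mulr1; ring.
Qed.

Lemma is_derive_cutoff1 r : is_derive r 1 cutoff1 (cutoff2 r).
Proof.
have d : is_derive r 1 (fun r : R => 1 - r) (-1) by apply: is_derive_eq; rewrite /GRing.scale /=; ring.
have h := @is_derive1_comp _ (bump 'X^2) (fun r => 1 - r) r _ _ (is_derive_bump 'X^2 (1 - r)) d.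
apply: (is_derive_eq (is_deriveM (is_derive_cst (- expR 1) r 1) h)).
by rewrite /GRing.scale /cutoff2 /=; ring.
Qed.

Lemma cutoff0 r : 1 <= r -> [/\ cutoff r = 0, cutoff1 r = 0 & cutoff2 r = 0].
Proof.
by move=> r1; rewrite /cutoff /cutoff1 /cutoff2 /bump ltNge subr_le0 r1 /= !mulr0.
Qed.

Lemma cutoff_ge0 r : 0 <= cutoff r.
Proof.
by rewrite /cutoff /bump; case: ifP => _; rewrite ?mulr0 // hornerC mul1r mulr_ge0 ?expR_ge0.
Qed.

(** For r < 1 the function is exp(- r / (1 - r)), and exp u >= 1 + u at u = r / (1 - r) gives 1 - r.
    Consequently L - L [cutoff] (w / L) dominates min(w, L) for w >= 0 and L > 0. *)
Lemma cutoff_le r : 0 <= r -> cutoff r <= Num.max (1 - r) 0.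
Proof.
move=> r0; rewrite le_max; case: (ltrP r 1) => r1; last first.
  by case: (cutoff0 r1) => -> _ _; rewrite lexx orbT.
have s0 : 0 < 1 - r by rewrite subr_gt0.
rewrite /cutoff /bump s0 hornerC mul1r -expRD; apply/orP; left.
have -> : 1 - (1 - r)^-1 = - (r / (1 - r)) by field; exact: lt0r_neq0.
rewrite expRN -[leRHS]invrK lef_pV2 ?posrE ?expR_gt0 ?invr_gt0 //.
apply: le_trans (expR_ge1Dx _); rewrite le_eqVlt; apply/orP; left; apply/eqP.
by field; exact: lt0r_neq0.
Qed.

(** The sign of [cutoff1] lets the confinement act in the right direction. The bound on [cutoff2]
    times r absorbs one factor r produced by the square of the inner derivative when r is a power of
    the weight divided by L. *)
Lemma cutoff_bounds : exists2 C : R, 0 <= C & forall r, 0 <= r ->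
  [/\ 1 - cutoff r <= C * r, - C <= cutoff1 r <= 0, `|cutoff2 r| <= C & `|cutoff2 r| * r <= C].
Proof.
have [C1 C10 h1] := bump_bounded 'X^2.
have [C2 C20 h2] := bump_bounded ('X^2 * ('X^2 - 'X^2^`())).
have e0 : 0 <= expR 1 :> R by exact: expR_ge0.
have r1 r : 0 <= r -> 1 - r <= 1 by move=> ?; rewrite gerBl.
have b1 r : 0 <= r -> `|cutoff1 r| <= expR 1 * C1.
  by move=> r0; rewrite normrM normrN (ger0_norm e0) ler_wpM2l // h1 // r1.
have b2 r : 0 <= r -> `|cutoff2 r| <= expR 1 * C2.
  by move=> r0; rewrite normrM (ger0_norm e0) ler_wpM2l // h2 // r1.
have le1 : expR 1 * C1 <= expR 1 * (C1 + C2) by rewrite ler_wpM2l // lerDl.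
have le2 : expR 1 * C2 <= expR 1 * (C1 + C2) by rewrite ler_wpM2l // lerDr.
exists (expR 1 * (C1 + C2)); first by rewrite mulr_ge0 // addr_ge0.
move=> r r0; split.
- have z : cutoff 0 = 1.
    by rewrite /cutoff /bump subr0 ltr01 hornerC mul1r invr1 -expRD subrr expR0.
  have := is_derive_norm_le r0 (fun x _ => is_derive_cutoff x) (K := expR 1 * C1).
  rewrite z subr0 => h.
  have {h} : `|cutoff r - 1| <= expR 1 * C1 * r.
    by apply: h => x /andP[x0 _]; exact: b1.
  rewrite ler_norml => /andP[h _].
  have : expR 1 * C1 * r <= expR 1 * (C1 + C2) * r by rewrite ler_wpM2r.
  lra.
- apply/andP; split.
    by have := b1 r r0; rewrite ler_norml => /andP[h _]; lra.
  rewrite /cutoff1 mulNr oppr_le0 mulr_ge0 // /bump; case: ifP => // _.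
  by rewrite hornerXn mulr_ge0 ?sqr_ge0 ?expR_ge0.
- by apply: le_trans le2; exact: b2.
- have [l1|g1] := lerP 1 r.
    by case: (cutoff0 l1) => _ _ ->; rewrite normr0 mul0r mulr_ge0 // addr_ge0.
  apply: le_trans le2; apply: le_trans (b2 r r0).
  by rewrite ler_piMr // ltW.
Qed.

End Cutoff.

(** * Integrals of functions of polynomial growth *)

Section Sandwich.
Local Open Scope ereal_scope.
Context d (T : measurableType d) (R : realType) (mu : {measure set T -> \bar R}).

(** The integral of a nonnegative function is a supremum over the simple functions below it, so it
    is monotone without any measurability. *)
Lemma le_integral_nonmeasurable (D : set T) (f g : T -> \bar R) :
  (forall x, D x -> f x <= g x) -> \int[mu]_(x in D) f x <= \int[mu]_(x in D) g x.
Proof.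
move=> fg; have fg' x : (f \_ D) x <= (g \_ D) x.
  by rewrite !patchE; case: ifPn => // /set_mem; exact: fg.
rewrite /integral; apply: leeB; apply: le_ereal_sup => /= _ [h hf <-]; exists h => // x;
  apply: (le_trans (hf x)).
- by apply: (@funepos_le _ _ setT) => [y _|]; [exact: fg'|rewrite in_setT].
- by apply: (@funeneg_le _ _ setT) => [y _|]; [exact: fg'|rewrite in_setT].
Qed.

(** [fine] sends both infinities to 0, so monotonicity of real integrals can fail in general; the
    two integrable bounds force the middle integral to be finite. *)
Lemma Rintegral_sandwich (D : set T) (h f g : T -> R) : measurable D ->
  mu.-integrable D (EFin \o h) -> mu.-integrable D (EFin \o g) ->
  (forall x, D x -> (h x <= f x <= g x)%R) ->
  (\int[mu]_(x in D) h x <= \int[mu]_(x in D) f x <= \int[mu]_(x in D) g x)%R.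
Proof.
move=> mD ih ig hfg; rewrite /Rintegral.
have fh := integrable_fin_num mD ih; have fg := integrable_fin_num mD ig.
have lhf : \int[mu]_(x in D) (h x)%:E <= \int[mu]_(x in D) (f x)%:E.
  by apply: le_integral_nonmeasurable => x /hfg /andP[]; rewrite lee_fin.
have lfg : \int[mu]_(x in D) (f x)%:E <= \int[mu]_(x in D) (g x)%:E.
  by apply: le_integral_nonmeasurable => x /hfg /andP[_]; rewrite lee_fin.
have ff : \int[mu]_(x in D) (f x)%:E \is a fin_num.
  rewrite fin_numE; apply/andP; split; apply/eqP => e.
    by move: lhf fh; rewrite e leeNy_eq => /eqP ->.
  by move: lfg fg; rewrite e leye_eq => /eqP ->.
by rewrite !fine_le.
Qed.

End Sandwich.

Section Growth.
Variable R : realType.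
Implicit Types (f g h : R -> R) (q : {poly R}) (x : R).

Definition wt x : R := 1 + x ^+ 2.

Lemma wt_ge1 x : 1 <= wt x.
Proof. by rewrite /wt lerDl sqr_ge0. Qed.

Lemma wt_gt0 x : 0 < wt x.
Proof. exact: lt_le_trans ltr01 (wt_ge1 x). Qed.

Lemma wt_ge0 x : 0 <= wt x. Proof. exact/ltW/wt_gt0. Qed.

Lemma wtX_ge0 x k : 0 <= wt x ^+ k. Proof. exact/exprn_ge0/wt_ge0. Qed.

Lemma wtX_ge1 x k : 1 <= wt x ^+ k. Proof. exact/exprn_ege1/wt_ge1. Qed.

Lemma wtX_mono x k l : (k <= l)%N -> wt x ^+ k <= wt x ^+ l.
Proof. by move=> kl; apply: ler_weXn2l => //; exact: wt_ge1. Qed.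

Lemma wt_continuous k : continuous (fun x => wt x ^+ k).
Proof.
have -> : (fun x => wt x ^+ k) = horner ((1 + 'X^2) ^+ k).
  by apply/funext => x; rewrite horner_exp hornerD hornerXn hornerC.
exact: continuous_horner.
Qed.

Lemma pow_le_wt x i j : (i <= 2 * j)%N -> `|x| ^+ i <= wt x ^+ j.
Proof.
move=> ij; have [x1|x1] := lerP `|x| 1.
  by apply: le_trans (wtX_ge1 _ _); rewrite exprn_ile1.
apply: (@le_trans _ _ (`|x| ^+ (2 * j))); first by rewrite ler_weXn2l // ltW.
rewrite exprM real_normK ?num_real // lerXn2r ?nnegrE ?sqr_ge0 ?wt_ge0 //.
by rewrite /wt lerDr.
Qed.

Lemma poly_growth q j : (size q <= (2 * j).+1)%N ->
  exists2 C : R, 0 <= C & forall x, `|q.[x]| <= C * wt x ^+ j.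
Proof.
move=> sq; exists (\sum_(i < size q) `|q`_i|); first by apply: sumr_ge0.
move=> x; rewrite horner_coef; apply: (le_trans (ler_norm_sum _ _ _)).
rewrite mulr_suml; apply: ler_sum => i _; rewrite normrM normrX ler_wpM2l // pow_le_wt //.
by rewrite -ltnS; exact: leq_trans (ltn_ord i) sq.
Qed.

(** Continuity supplies measurability and the growth bound supplies integrability against any
    measure with all moments; the class is closed under sums and products. *)
Definition tame h := continuous h /\
  exists C k, 0 <= C /\ forall x, `|h x| <= C * wt x ^+ k.

Lemma tame_bounded h (C : R) : continuous h -> (forall x, `|h x| <= C) -> tame h.
Proof.
move=> ch hC; split=> //; exists C, 0%N; split; last by move=> x; rewrite expr0 mulr1.
exact: le_trans (hC 0).
Qed.

Lemma tame_poly q : tame (horner q).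
Proof.
split; first exact: continuous_horner.
have [|C C0 hC] := @poly_growth q (size q); first by rewrite mul2n -addnn -addnS leq_addr.
by exists C, (size q).
Qed.

Lemma tame_wt k : tame (fun x => wt x ^+ k).
Proof.
split; first exact: wt_continuous.
by exists 1, k; split=> // x; rewrite mul1r ger0_norm // wtX_ge0.
Qed.

Lemma tame_cst (c : R) : tame (fun=> c).
Proof. by apply: (tame_bounded (C := `|c|)) => // x; exact: cst_continuous. Qed.

Lemma tameD f g : tame f -> tame g -> tame (fun x => f x + g x).
Proof.
move=> [cf [C [k [C0 hC]]]] [cg [D [l [D0 hD]]]]; split.
  by move=> x; apply: continuousD; [exact: cf|exact: cg].
exists (C + D), (k + l)%N; split; first exact: addr_ge0.
move=> x; apply: (le_trans (ler_normD _ _)); rewrite mulrDl; apply: lerD.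
  by apply: (le_trans (hC x)); rewrite ler_wpM2l // wtX_mono // leq_addr.
by apply: (le_trans (hD x)); rewrite ler_wpM2l // wtX_mono // leq_addl.
Qed.

Lemma tameM f g : tame f -> tame g -> tame (fun x => f x * g x).
Proof.
move=> [cf [C [k [C0 hC]]]] [cg [D [l [D0 hD]]]]; split.
  by move=> x; apply: continuousM; [exact: cf|exact: cg].
exists (C * D), (k + l)%N; split; first exact: mulr_ge0.
by move=> x; rewrite normrM exprD mulrACA ler_pM.
Qed.

Lemma tameZ (c : R) f : tame f -> tame (fun x => c * f x).
Proof. exact/tameM/tame_cst. Qed.

Lemma tameN f : tame f -> tame (fun x => - f x).
Proof.
move=> /(tameZ (-1)); rewrite (_ : (fun x => _) = (fun x => - f x)) //.
by apply/funext => x; rewrite mulN1r.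
Qed.

Lemma tameB f g : tame f -> tame g -> tame (fun x => f x - g x).
Proof. by move=> tf tg; apply: tameD => //; exact: tameN. Qed.

Lemma tame_norm f : tame f -> tame (fun x => `|f x|).
Proof.
move=> [cf [C [k [C0 hC]]]]; split.
  by move=> x; apply: continuous_comp; [exact: cf|exact: norm_continuous].
by exists C, k; split=> // x; rewrite normr_id.
Qed.

End Growth.

Section TameIntegral.
Variables (R : realType) (mu : probability (measurableTypeR R) R).
Implicit Types (f g h : R -> R).

Definition has_moments := forall k,
  mu.-integrable setT (EFin \o (fun x : R => wt x ^+ k)).

Hypothesis mom : has_moments.

Lemma tame_integrable h : tame h -> mu.-integrable setT (EFin \o h).
Proof.
move=> [ch [C [k [C0 hC]]]].
have i := @integrableZl _ _ _ mu setT measurableT C _ (mom k).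
apply: le_integrable i => //.
  by apply/measurable_EFinP; exact: continuous_measurable_fun.
move=> x _ /=; rewrite lee_fin; apply: (le_trans (hC x)); exact: ler_norm.
Qed.

Lemma tame_intD f g : tame f -> tame g ->
  \int[mu]_x (f x + g x) = \int[mu]_x f x + \int[mu]_x g x.
Proof. by move=> tf tg; rewrite RintegralD //; exact: tame_integrable. Qed.

Lemma tame_intB f g : tame f -> tame g ->
  \int[mu]_x (f x - g x) = \int[mu]_x f x - \int[mu]_x g x.
Proof. by move=> tf tg; rewrite RintegralB //; exact: tame_integrable. Qed.

Lemma tame_intZ (c : R) f : tame f -> \int[mu]_x (c * f x) = c * \int[mu]_x f x.
Proof. by move=> tf; rewrite RintegralZl //; exact: tame_integrable. Qed.

Lemma tame_intN f : tame f -> \int[mu]_x (- f x) = - \int[mu]_x f x.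
Proof.
by move=> tf; under eq_Rintegral do rewrite -mulN1r; rewrite tame_intZ // mulN1r.
Qed.

Lemma tame_int_cst (c : R) : \int[mu]_x c = c.
Proof. by rewrite Rintegral_cst // [X in fine X](probability_setT mu) mulr1. Qed.

Lemma tame_int_le f g : tame f -> tame g -> (forall x, f x <= g x) ->
  \int[mu]_x f x <= \int[mu]_x g x.
Proof. by move=> tf tg fg; apply: le_Rintegral => //; exact: tame_integrable. Qed.

Lemma tame_int_norm f g : tame f -> tame g -> (forall x, `|f x| <= g x) ->
  `|\int[mu]_x f x| <= \int[mu]_x g x.
Proof.
move=> tf tg fg; rewrite ler_norml -tame_intN //; apply/andP; split; apply: tame_int_le => //.
- exact: tameN.
- by move=> x; have := fg x; rewrite ler_norml => /andP[].
- by move=> x; have := fg x; rewrite ler_norml => /andP[].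
Qed.

End TameIntegral.

Section MomentTools.
Variable R : realType.
Implicit Types (f g dg h : R -> R) (x y c : R).

Lemma compactly_supported_moments (mu : probability (measurableTypeR R) R) :
  compactly_supported mu -> has_moments mu.
Proof.
move=> [K [cK muK]] k.
have mK : measurable (K : set (measurableTypeR R)) by exact: compact_measurable.
have mw : measurable_fun setT (fun x : measurableTypeR R => wt x ^+ k).
  exact: (continuous_measurable_fun (@wt_continuous R k)).
have mE : measurable_fun [set: measurableTypeR R] (EFin \o (fun x => wt x ^+ k)).
  exact/measurable_EFinP.
apply: (negligible_integrable (measurableC mK) measurableT mE muK).2.
rewrite setTD setCK; apply: measurable_bounded_integrable => //.
- exact: le_lt_trans (probability_le1 mu mK) (ltry _).
- by apply: measurable_funTS.
have /compact_bounded [M [_ mrt]] : compact ((fun x => wt x ^+ k) @` K).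
  apply: continuous_compact => //; apply: continuous_subspaceT; exact: wt_continuous.
by exists M; split; rewrite ?num_real // => A MA x Kx; apply: (mrt A MA); exists x.
Qed.

Lemma eq_prob_integral (mu nu : probability (measurableTypeR R) R) h :
  (forall A : set (measurableTypeR R), measurable A -> mu A = nu A) ->
  \int[mu]_x h x = \int[nu]_x h x.
Proof.
by move=> e; rewrite /Rintegral; congr fine; apply: eq_measure_integral => A mA _; exact: e.
Qed.

Lemma eq_prob_moments (mu nu : probability (measurableTypeR R) R) :
  (forall A : set (measurableTypeR R), measurable A -> mu A = nu A) ->
  has_moments nu -> has_moments mu.
Proof.
move=> e hnu k; have /integrableP [m f] := hnu k; apply/integrableP; split => //.
by rewrite (eq_measure_integral nu) // => A mA _; exact: e.
Qed.

Lemma truncated_integral_bound (mu : probability (measurableTypeR R) R) h (C : R) :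
  continuous h -> (forall x, 0 <= h x) ->
  (forall n : nat, \int[mu]_x Num.min (h x) n%:R <= C) ->
  mu.-integrable setT (EFin \o h) /\ \int[mu]_x h x <= C.
Proof.
move=> ch h0 hC.
pose g (n : nat) (x : measurableTypeR R) : \bar R := (Num.min (h x) n%:R)%:E.
have mh : measurable_fun [set: measurableTypeR R] h by exact: (continuous_measurable_fun ch).
have mg n : measurable_fun [set: measurableTypeR R] (fun x => Num.min (h x) n%:R).
  by apply: measurable_minr => //; exact: measurable_cst.
have g0 n x : (0 <= g n x)%E by rewrite lee_fin le_min h0 ler0n.
have gb n : ((\int[mu]_x g n x)%E <= C%:E)%E.
  have ig : mu.-integrable setT (g n).
    apply: measurable_bounded_integrable => //; first exact: le_lt_trans (probability_le1 mu measurableT) (ltry _).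
    exists n%:R; split; rewrite ?num_real // => B nB x _ /=.
    rewrite ger0_norm ?le_min ?h0 ?ler0n // ge_min; apply/orP; right; exact: ltW.
  rewrite -(fineK (integrable_fin_num measurableT ig)) lee_fin; exact: hC.
have lg x : limn (g ^~ x) = (h x)%:E.
  apply/cvg_lim => //; apply: cvg_near_cst.
  exists (Num.truncn (h x)).+1 => // n /= hn; rewrite /g min_l //.
  apply: (le_trans (ltW (truncnS_gt (h x)))); by rewrite ler_nat.
have e : (\int[mu]_x (h x)%:E)%E = limn (fun n => (\int[mu]_x g n x)%E).
  rewrite -(@monotone_convergence _ _ _ mu setT measurableT g).
  - by apply: eq_integral => x _; rewrite lg.
  - by move=> n; exact/measurable_EFinP.
  - by move=> n x _; exact: g0.
  - move=> x _ n m nm; rewrite lee_fin le_min ge_min lexx ge_min /=.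
    by rewrite ler_nat nm orbT.
have hb : ((\int[mu]_x (h x)%:E)%E <= C%:E)%E.
  rewrite e; suff cvg : cvgn (fun n => (\int[mu]_x g n x)%E).
    by apply: (lime_le cvg); apply: nearW => n; exact: gb.
  suff mono : nondecreasing_seq (fun n => (\int[mu]_x g n x)%E).
    exact: (ereal_nondecreasing_is_cvgn mono).
  move=> n m nm; apply: ge0_le_integral => //.
  - exact/measurable_EFinP.
  - exact/measurable_EFinP.
  - move=> x _; rewrite lee_fin le_min ge_min lexx ge_min /=.
    by rewrite ler_nat nm orbT.
have ih : mu.-integrable setT (EFin \o h).
  apply/integrableP; split; first exact/measurable_EFinP.
  under eq_integral => x _ do rewrite /= ger0_norm //.
  exact: le_lt_trans hb (ltry _).
split=> //; rewrite -lee_fin /Rintegral fineK //; exact: integrable_fin_num.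
Qed.

Lemma wt_between (x y c : R) k : Num.min x y <= c <= Num.max x y ->
  wt c ^+ k <= wt x ^+ k + wt y ^+ k.
Proof.
move=> hc; have h : wt c <= wt x \/ wt c <= wt y.
  rewrite /wt !lerD2l; case: (lerP 0 c) => c0.
    suff : c <= x \/ c <= y.
      by case=> ?; [left|right]; rewrite lerXn2r ?nnegrE // (le_trans c0).
    by move: hc; rewrite le_max => /andP[_ /orP].
  suff : x <= c \/ y <= c.
    case=> ?; [left|right]; rewrite -sqrrN -[leRHS]sqrrN lerXn2r ?nnegrE ?oppr_ge0 ?lerN2 //;
      by [exact: ltW|apply: le_trans (ltW c0)].
  by move: hc; rewrite ge_min => /andP[/orP].
have := wtX_ge0 x k; have := wtX_ge0 y k.
case: h => h; have := lerXn2r k (wt_ge0 c) (wt_ge0 _) h; lra.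
Qed.

Lemma difference_quotient_MVT g dg x y : (forall c, is_derive c 1 g (dg c)) ->
  exists2 c, Num.min x y <= c <= Num.max x y & difference_quotient g x y = dg c.
Proof.
move=> hg; rewrite /difference_quotient; have [->|xy] := eqVneq x y.
  by exists y; [rewrite minxx maxxx lexx|rewrite derive1E; have [] := hg y].
have cas (u v : R) : u < v -> exists2 c, u <= c <= v & (g v - g u) / (v - u) = dg c.
  move=> uv; have [c cuv e] := is_derive_MVT (ltW uv) (fun c _ => hg c).
  by exists c => //; rewrite e mulfK // subr_eq0 gt_eqF.
move: xy; rewrite neq_lt => /orP[] xy; have [c h e] := cas _ _ xy; exists c => //.
- by rewrite (min_l (ltW xy)) (max_r (ltW xy)).
- by rewrite -e -[_ - g y]opprB -[x - y]opprB invrN mulrNN.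
- by rewrite (min_r (ltW xy)) (max_l (ltW xy)).
Qed.

Lemma difference_quotient_bound g dg (C : R) k x y : 0 <= C ->
  (forall c, is_derive c 1 g (dg c)) -> (forall c, `|dg c| <= C * wt c ^+ k) ->
  `|difference_quotient g x y| <= C * (wt x ^+ k + wt y ^+ k).
Proof.
move=> C0 hg hC; have [c hc ->] := difference_quotient_MVT x y hg.
by apply: (le_trans (hC c)); rewrite ler_wpM2l // wt_between.
Qed.

(* [D'] is only known to lie between two integrable functions; the integral is
   still monotone in that situation. *)
Lemma difference_quotient_integral_bound (mu : probability (measurableTypeR R) R)
    (D D' : R -> R -> R) (C : R) k :
  mu.-integrable setT (EFin \o (fun x : R => wt x ^+ k)) ->
  0 <= C ->
  (forall x, mu.-integrable setT (EFin \o D x)) ->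
  mu.-integrable setT (EFin \o (fun x => \int[mu]_y D x y)) ->
  (forall x y, `|D' x y - D x y| <= C * (wt x ^+ k + wt y ^+ k)) ->
  `|\int[mu]_x \int[mu]_y D' x y - \int[mu]_x \int[mu]_y D x y|
    <= 2 * C * \int[mu]_x wt x ^+ k.
Proof.
move=> iw C0 iD iDD hD; set m := \int[mu]_x wt x ^+ k.
have icst c : mu.-integrable setT (EFin \o (fun _ : R => c)).
  exact: finite_measure_integrable_cst.
(* One-variable estimate used twice: for the inner integral with a = C [wt x ^+ k], then for the
   outer one with a = C m. *)
have gen (f f' : R -> R) (a b : R) : mu.-integrable setT (EFin \o f) ->
    (forall x, `|f' x - f x| <= a + b * wt x ^+ k) ->
    `|\int[mu]_x f' x - \int[mu]_x f x| <= a + b * m.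
  move=> jf hf.
  have iab : mu.-integrable setT (EFin \o (fun x : R => a + b * wt x ^+ k)).
    exact: (integrableD measurableT (icst a) (integrableZl measurableT b iw)).
  have eab : \int[mu]_x (a + b * wt x ^+ k) = a + b * m.
    rewrite RintegralD //.
      by rewrite (tame_int_cst mu a) RintegralZl.
    exact: (integrableZl measurableT b iw).
  pose w x := a + b * wt x ^+ k.
  have hw x : [set: measurableTypeR R] x -> f x - w x <= f' x <= f x + w x.
    by have := hf x; rewrite ler_norml /w => /andP[? ?] _; apply/andP; split; lra.
  have := Rintegral_sandwich measurableT (integrableB measurableT jf iab)
    (integrableD measurableT jf iab) hw.
  rewrite (RintegralB measurableT jf iab) (RintegralD measurableT jf iab) eab.
  by rewrite ler_norml => /andP[? ?]; apply/andP; split; lra.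
have := @gen (fun x => \int[mu]_y D x y) (fun x => \int[mu]_y D' x y) (C * m) C iDD.
rewrite (_ : C * m + C * m = 2 * C * m); last by ring.
apply=> x; rewrite [leRHS]addrC; apply: gen => // y.
by rewrite -mulrDr.
Qed.

End MomentTools.

(** * Cutoffs along the level sets of the weight *)

Section WeightCutoff.
Variable R : realType.
Implicit Types (x L : R) (j : nat).

(** For large L, L - L [wcut j L] is a bounded substitute for the power j + 1 of the weight, and L
    [wcut j L] is a compactly supported test function. *)
Definition wcut j L x : R := cutoff (wt x ^+ j.+1 / L).
Definition wcut1 j L x : R :=
  cutoff1 (wt x ^+ j.+1 / L) * ((2 * j.+1%:R) * x * wt x ^+ j / L).
(** For j = 0 the predecessor [j.-1] is 0 again, but the factor [j%:R] removes the term. *)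
Definition wcut2 j L x : R :=
  cutoff2 (wt x ^+ j.+1 / L) * ((2 * j.+1%:R) * x * wt x ^+ j / L) ^+ 2
  + cutoff1 (wt x ^+ j.+1 / L)
    * ((2 * j.+1%:R) * (wt x ^+ j + 2 * j%:R * x ^+ 2 * wt x ^+ j.-1) / L).

Lemma is_derive_wt x : is_derive x 1 (@wt R) (2 * x).
Proof. by apply: is_derive_eq; rewrite /GRing.scale /=; ring. Qed.

Lemma is_derive_wtX x j : is_derive x 1 (fun x : R => wt x ^+ j) (2 * j%:R * x * wt x ^+ j.-1).
Proof.
have -> : (fun x : R => wt x ^+ j) = horner 'X^j \o @wt R.
  by apply/funext => y /=; rewrite hornerXn.
apply: (is_derive_eq (is_derive1_comp (is_derive_poly _ _) (is_derive_wt x))).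
by rewrite derivXn hornerMn hornerXn -mulr_natl; ring.
Qed.

Lemma is_derive_wcut j L x : is_derive x 1 (wcut j L) (wcut1 j L x).
Proof.
have h : is_derive x 1 (fun x : R => wt x ^+ j.+1 / L) ((2 * j.+1%:R) * x * wt x ^+ j / L).
  apply: (is_derive_eq (is_deriveM (is_derive_wtX x j.+1) (is_derive_cst L^-1 x 1))).
  by rewrite /GRing.scale /=; ring.
exact: (@is_derive1_comp _ _ (fun x : R => wt x ^+ j.+1 / L) x _ _ (is_derive_cutoff _) h).
Qed.

Lemma is_derive_wcut1 j L x : is_derive x 1 (wcut1 j L) (wcut2 j L x).
Proof.
have h : is_derive x 1 (fun x : R => wt x ^+ j.+1 / L) ((2 * j.+1%:R) * x * wt x ^+ j / L).
  apply: (is_derive_eq (is_deriveM (is_derive_wtX x j.+1) (is_derive_cst L^-1 x 1))).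
  by rewrite /GRing.scale /=; ring.
have h1 := @is_derive1_comp _ _ (fun x : R => wt x ^+ j.+1 / L) x _ _ (is_derive_cutoff1 _) h.
have h2 : is_derive x 1 (fun x : R => (2 * j.+1%:R) * x * wt x ^+ j / L)
    ((2 * j.+1%:R) * (wt x ^+ j + 2 * j%:R * x ^+ 2 * wt x ^+ j.-1) / L).
  have i1 : is_derive x 1 (fun x : R => (2 * j.+1%:R) * x) (2 * j.+1%:R).
    by apply: is_derive_eq; rewrite /GRing.scale /=; ring.
  apply: (is_derive_eq (is_deriveM (is_deriveM i1 (is_derive_wtX x j)) (is_derive_cst L^-1 x 1))).
  by rewrite /GRing.scale /=; ring.
apply: (is_derive_eq (is_deriveM h1 h2)).
by rewrite /GRing.scale /wcut2 /=; ring.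
Qed.

Lemma wcut_support j L x : 0 < L -> L + 1 < `|x| -> wcut j L x = 0 /\ wcut1 j L x = 0.
Proof.
move=> L0 hx; suff h : 1 <= wt x ^+ j.+1 / L.
  by have [e1 e2 _] := cutoff0 h; rewrite /wcut /wcut1 e1 e2 mul0r.
rewrite ler_pdivlMr // mul1r; apply: (@le_trans _ _ (wt x)).
  rewrite /wt -real_normK ?num_real // expr2.
  have : 1 * `|x| <= `|x| * `|x| by rewrite ler_wpM2r //; lra.
  by lra.
by rewrite -[leLHS]expr1; apply: wtX_mono.
Qed.

Lemma wcut_ge0 j L x : 0 <= wcut j L x. Proof. exact: cutoff_ge0. Qed.

Lemma wcut_min j L x : 0 < L -> Num.min (wt x ^+ j.+1) L <= L - L * wcut j L x.
Proof.
move=> L0; have r0 : 0 <= wt x ^+ j.+1 / L by rewrite divr_ge0 ?wtX_ge0 // ltW.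
have := cutoff_le r0; rewrite /wcut le_max => /orP[h|h].
  rewrite ge_min; apply/orP; left.
  rewrite -[leLHS](divfK (lt0r_neq0 L0)) mulrC -[X in _ <= X - _]mulr1 -mulrBr ler_pM2l //; lra.
rewrite ge_min; apply/orP; right.
by have : L * cutoff (wt x ^+ j.+1 / L) <= 0; [rewrite pmulr_rle0|lra].
Qed.

(** Two items close the induction on moments. The second derivative costs the power j of the weight
    and not j + 1, so the interaction is controlled by the previous moment. The last item writes L
    [wcut1] as a nonpositive multiple of the weight times x, so that its product with V' is bounded
    above by the confinement. All constants are uniform in L. *)
Lemma wcut_bounds j : exists2 C : R, 0 <= C & forall L x, 1 <= L ->
  [/\ L - L * wcut j L x <= C * wt x ^+ j.+1,
      1 - wcut j L x <= C * wt x ^+ j.+1 / L,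
      `|wcut1 j L x| <= C * wt x ^+ j.+1 / L,
      (`|wcut2 j L x| <= C * wt x ^+ j / L) &
      exists2 c : R, 0 <= c <= C & L * wcut1 j L x = - c * wt x ^+ j * x].
Proof.
have [C C0 hC] := cutoff_bounds R.
pose a : R := 2 * j.+1%:R; have a0 : 0 <= a by rewrite mulr_ge0.
have a1 : 1 <= a by rewrite /a -natrM ler1n.
have jj : 0 <= 2 * j%:R :> R by rewrite mulr_ge0.
exists (C * (a ^+ 2 + a * (1 + 2 * j%:R))); first by rewrite !(mulr_ge0, addr_ge0) ?sqr_ge0.
move=> L x L1; have L0 : 0 < L by exact: lt_le_trans L1.
set D := C * _; set w := wt x ^+ j.+1; set v := wt x ^+ j.
have w0 : 0 <= w by exact: wtX_ge0.
have v0 : 0 <= v by exact: wtX_ge0.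
have r0 : 0 <= w / L by rewrite divr_ge0 // ltW.
have [h1 h2 h3 h4] := hC _ r0.
have wv : w = wt x * v by rewrite /w exprS.
have aa : a <= a ^+ 2 by rewrite expr2 ler_peMr.
have p0 : 0 <= a * (2 * j%:R) by rewrite mulr_ge0.
have CD : C <= D by rewrite /D ler_peMr //; lra.
have CaD : C * a <= D by rewrite /D ler_wpM2l //; lra.
have c1 : `|cutoff1 (w / L)| <= C.
  by move: h2 => /andP[? ?]; rewrite ler_norml; apply/andP; split; lra.
have iL : 0 <= L^-1 by rewrite invr_ge0 ltW.
have xw : `|x| <= wt x by have := @pow_le_wt R x 1 1 isT; rewrite !expr1.
have e2 : 1 - wcut j L x <= D * w / L.
  apply: (le_trans h1); rewrite -mulrA ler_wpM2r //.
split => //.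
- have -> : L - L * wcut j L x = L * (1 - wcut j L x) by ring.
  by rewrite -ler_pdivlMl // mulrC.
- rewrite /wcut1 normrM -/a -/w -/v.
  have -> : `|a * x * v / L| = a * `|x| * v / L.
    by rewrite 3!normrM (ger0_norm a0) (ger0_norm v0) (ger0_norm iL).
  apply: (@le_trans _ _ (C * (a * wt x * v / L))).
    apply: ler_pM => //; first by rewrite !mulr_ge0.
    by rewrite ler_wpM2r // ler_wpM2r // ler_wpM2l.
  rewrite (_ : C * _ = (C * a) * (wt x * v / L)); last by ring.
  by rewrite -wv -[leRHS]mulrA ler_wpM2r.
- rewrite /wcut2 -/a -/w -/v; apply: (le_trans (ler_normD _ _)); rewrite !normrM.
  have s1 : (a * x * v / L) ^+ 2 <= a ^+ 2 * (w / L) * (v / L).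
    rewrite (_ : _ ^+ 2 = a ^+ 2 * (x ^+ 2 * v / L) * (v / L)); last by ring.
    rewrite ler_wpM2r ?mulr_ge0 // ler_wpM2l ?sqr_ge0 // wv ler_wpM2r // ler_wpM2r //.
    by rewrite /wt lerDr.
  have t1 : `|cutoff2 (w / L)| * `|(a * x * v / L) ^+ 2| <= C * a ^+ 2 * (v / L).
    rewrite (ger0_norm (sqr_ge0 _)).
    apply: (@le_trans _ _ (`|cutoff2 (w / L)| * (a ^+ 2 * (w / L) * (v / L)))).
      by rewrite ler_wpM2l.
    rewrite (_ : _ * _ = `|cutoff2 (w / L)| * (w / L) * (a ^+ 2 * (v / L))); last by ring.
    by rewrite -[leRHS]mulrA ler_wpM2r // !mulr_ge0 ?sqr_ge0.
  have s2 : 0 <= v + 2 * j%:R * x ^+ 2 * wt x ^+ j.-1 <= (1 + 2 * j%:R) * v.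
    have q0 : 0 <= x ^+ 2 * wt x ^+ j.-1 by rewrite mulr_ge0 ?sqr_ge0 ?wtX_ge0.
    apply/andP; split; first by rewrite addr_ge0 // -mulrA mulr_ge0.
    rewrite [leRHS]mulrDl mul1r lerD2l -[leLHS]mulrA.
    rewrite /v; case: (j) => [|i]; first by rewrite mulr0 !mul0r.
    rewrite /= [wt x ^+ i.+1]exprS; apply: ler_wpM2l; first by rewrite mulr_ge0.
    by rewrite ler_wpM2r ?wtX_ge0 // /wt lerDr.
  have [s20 s21] := andP s2.
  have t2 : `|cutoff1 (w / L)| * `|a * (v + 2 * j%:R * x ^+ 2 * wt x ^+ j.-1) / L|
      <= C * (a * (1 + 2 * j%:R)) * (v / L).
    have s3 : 0 <= a * (v + 2 * j%:R * x ^+ 2 * wt x ^+ j.-1) / L.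
      by rewrite mulr_ge0 // mulr_ge0.
    rewrite (ger0_norm s3).
    rewrite (_ : C * _ * _ = C * (a * ((1 + 2 * j%:R) * v) / L)); last by ring.
    apply: ler_pM => //.
    by rewrite ler_wpM2r // ler_wpM2l.
  have -> : D * v / L = C * a ^+ 2 * (v / L) + C * (a * (1 + 2 * j%:R)) * (v / L).
    by rewrite /D; ring.
  by rewrite -!normrM; apply: lerD; rewrite normrM.
- exists (- cutoff1 (w / L) * a); last first.
    by rewrite /wcut1 -/w -/a -/v; field; exact: lt0r_neq0.
  move: h2 => /andP[h21 h22]; rewrite mulr_ge0 //; last by rewrite oppr_ge0.
  by apply: le_trans CaD; rewrite ler_wpM2r //; lra.
Qed.

Lemma wcut_elementary j L : elementary (wcut j L).
Proof.
pose q : {poly R} := 1 - L^-1 *: (1 + 'X^2) ^+ j.+1.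
apply: (@elementary_eq _ (fun x => (expR 1)%:P.[x] * bump 1 q.[x])).
  move=> x; rewrite /wcut /cutoff hornerC; congr (_ * bump _ _).
  rewrite /q hornerD hornerN hornerZ horner_exp hornerD hornerXn !hornerC.
  by rewrite /wt mulrC.
by apply: elementary_mul; [exact: elementary_poly|exact: elementary_bump].
Qed.

End WeightCutoff.

(** * Propagation of moments *)

Section Moments.
Variables (R : realType) (beta alpha : R) (V : {poly R}).
Variables (rho0 : probability (measurableTypeR R) R)
  (rho : R -> probability (measurableTypeR R) R).
Hypotheses (beta_ge0 : 0 <= beta) (alpha_gt0 : 0 < alpha)
  (V_convex : forall x : R, alpha <= V^`()^`().[x])
  (rho0_compact : compactly_supported rho0)
  (sol : mckean_vlasov_solution beta V rho0 rho).
Implicit Types (x y t s T : R).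

(** Convexity gives x (V'(x) - V'(0)) >= alpha x^2, and completing the square absorbs the linear
    term x V'(0). *)
Lemma confining : exists2 C : R, 0 <= C & forall x, - C <= x * V^`().[x].
Proof.
exists (V^`().[0] ^+ 2 / (4 * alpha)).
  by rewrite divr_ge0 ?sqr_ge0 // mulr_ge0 // ltW.
move=> x.
have mvt : alpha * x ^+ 2 <= x * (V^`().[x] - V^`().[0]).
  have [x0|x0] := lerP 0 x.
    have [c _ e] := is_derive_MVT x0 (fun c _ => is_derive_poly V^`() c).
    rewrite e (_ : x * _ = V^`()^`().[c] * x ^+ 2); last by ring.
    by rewrite ler_wpM2r ?sqr_ge0.
  have [c _ e] := is_derive_MVT (ltW x0) (fun c _ => is_derive_poly V^`() c).
  rewrite -opprB e (_ : x * _ = V^`()^`().[c] * x ^+ 2); last by ring.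
  by rewrite ler_wpM2r ?sqr_ge0.
have sq : 0 <= alpha * (x + V^`().[0] / (2 * alpha)) ^+ 2 by rewrite mulr_ge0 ?sqr_ge0 // ltW.
have : alpha * (x + V^`().[0] / (2 * alpha)) ^+ 2
   = alpha * x ^+ 2 + x * V^`().[0] + V^`().[0] ^+ 2 / (4 * alpha).
  by field; exact: lt0r_neq0.
move: sq mvt; rewrite mulrBr; lra.
Qed.

Lemma rho_0_moments : has_moments (rho 0).
Proof.
case: sol => _ e _; apply: eq_prob_moments e _.
exact: compactly_supported_moments.
Qed.

Definition moment_bound T k (C : R) := forall t, 0 <= t <= T ->
  (rho t).-integrable setT (EFin \o (fun x : R => wt x ^+ k)) /\
  \int[rho t]_x wt x ^+ k <= C.

Lemma prob_integrable_bounded (mu : probability (measurableTypeR R) R) (h : R -> R) (C : R) :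
  continuous h -> (forall x, `|h x| <= C) -> mu.-integrable setT (EFin \o h).
Proof.
move=> ch hC; apply: measurable_bounded_integrable => //.
- exact: le_lt_trans (probability_le1 mu measurableT) (ltry _).
- exact: continuous_measurable_fun.
exists C; split; rewrite ?num_real // => B CB x _ /=; exact: le_trans (hC x) (ltW CB).
Qed.

(** The equation is tested against L [wcut k L]. Its rate of change is at least -A: the interaction
    is bounded by the moment of order k and the drift by the confinement, both uniformly in L. Hence
    the truncated moments grow at most linearly in time, and monotone convergence removes the
    truncation. *)
Lemma moment_step T k C : 0 <= T -> moment_bound T k C -> exists C', moment_bound T k.+1 C'.
Proof.
move=> T0 hk.
have [D D0 hD] := wcut_bounds R k.
have [E E0 hE] := confining.
have C0 : 0 <= C.
  have [] := hk 0; first by rewrite lexx T0.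
  by move=> _; apply: le_trans; apply: Rintegral_ge0 => x _; exact: wtX_ge0.
pose A := beta / 4 * (2 * D * C) + D * E * C.
have A0 : 0 <= A by rewrite /A !(mulr_ge0, addr_ge0).
pose m0 := \int[rho 0]_x wt x ^+ k.+1.
have rhs L t : 1 <= L -> 0 <= t <= T ->
    \int[rho t]_x (L - L * wcut k L x) <= D * m0 + A * T.
  move=> L1 /andP[t0 tT]; have L0 : 0 < L by exact: lt_le_trans L1.
  pose f x := L * wcut k L x; pose f1 x := L * wcut1 k L x; pose f2 x := L * wcut2 k L x.
  have df x : is_derive x 1 f (f1 x).
    apply: (is_derive_eq (is_deriveM (is_derive_cst L x 1) (is_derive_wcut k L x))).
    by rewrite /GRing.scale /f1 /=; ring.
  have df1 x : is_derive x 1 f1 (f2 x).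
    apply: (is_derive_eq (is_deriveM (is_derive_cst L x 1) (is_derive_wcut1 k L x))).
    by rewrite /GRing.scale /f2 /=; ring.
  have ef : derive1 f = f1.
    by apply/funext => x; rewrite derive1E; have [] := df x.
  have cf : continuous f.
    by move=> x; apply/differentiable_continuous/derivable1_diffP; exact: ex_derive.
  have cf1 : continuous f1.
    by move=> x; apply/differentiable_continuous/derivable1_diffP; exact: ex_derive.
  have tf : test_function f.
    apply: (@elementary_test _ _ (L + 1)).
      apply: (@elementary_eq _ (fun x => L%:P.[x] * wcut k L x)).
        by move=> x; rewrite hornerC.
      by apply: elementary_mul; [exact: elementary_poly|exact: wcut_elementary].
    by move=> x /(wcut_support k L0) [e _]; rewrite /f e mulr0.
  have weq := let: And3 _ _ w := sol in w f t tf t0.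
  pose a s := beta / 4%:R *
     (\int[rho s]_x \int[rho s]_y difference_quotient (derive1 f) x y)
     - \int[rho s]_x (derive1 f x * V^`().[x]).
  have [B B0 hB] : exists2 B : R, 0 <= B & forall x, `|f1 x * V^`().[x]| <= B.
    have cfV : continuous (fun x => f1 x * V^`().[x]).
      by move=> x; apply: continuousM; [exact: cf1|exact: continuous_horner].
    have LL : - (L + 1) <= L + 1 by lra.
    have [B B0 hB] := segment_bounded LL (continuous_subspaceT cfV).
    exists B => // x; have [xL|xL] := lerP `|x| (L + 1).
      by apply: hB; rewrite -ler_norml.
    by have [_ e] := wcut_support k L0 xL; rewrite /f1 e mulr0 mul0r normr0.
  have fV x : f1 x * V^`().[x] <= D * E * wt x ^+ k.
    rewrite /f1; have [_ _ _ _ [c /andP[c0 cD] ->]] := hD L x L1.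
    rewrite [leLHS](_ : _ = c * wt x ^+ k * (- (x * V^`().[x]))); last by ring.
    apply: (@le_trans _ _ (c * wt x ^+ k * E)).
      by rewrite ler_wpM2l ?mulr_ge0 ?wtX_ge0 //; have := hE x; lra.
    by rewrite mulrAC ler_wpM2r ?wtX_ge0 // ler_wpM2r.
  (* Only the lower bound has to be uniform in L. The upper one, through [B], may depend on L: it
     merely makes the time integral finite, as [a] is not known to be measurable. *)
  have bound s : 0 <= s <= T -> - A <= a s <= beta / 4 * (2 * D * C) + B.
    move=> sT; have [iw mw] := hk s sT.
    have dq x y : `|difference_quotient (derive1 f) x y - 0| <= D * (wt x ^+ k + wt y ^+ k).
      rewrite subr0 ef; apply: (difference_quotient_bound _ _ D0 df1) => c.
      have [_ _ _ h _] := hD L c L1; rewrite /f2 normrM (ger0_norm (ltW L0)).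
      by rewrite mulrC -ler_pdivlMr.
    have icst (c : R) : (rho s).-integrable setT (EFin \o (fun _ : R => c)).
      exact: finite_measure_integrable_cst.
    have h1 : `|\int[rho s]_x \int[rho s]_y difference_quotient (derive1 f) x y| <= 2 * D * C.
      have z : \int[rho s]_x \int[rho s]_y (0 : R) = 0 by rewrite !tame_int_cst.
      have i0 : (rho s).-integrable setT (EFin \o (fun _ : R => \int[rho s]_y (0 : R))).
        exact: icst.
      have := difference_quotient_integral_bound iw D0 (fun _ => icst 0) i0 dq.
      by rewrite z subr0 => h; apply: (le_trans h); rewrite ler_wpM2l // mulr_ge0.
    have := @Rintegral_sandwich _ _ _ (rho s) setT (fun=> - B) (fun x => f1 x * V^`().[x])
       (fun x => D * E * wt x ^+ k) measurableT (icst _) (integrableZl measurableT (D * E) iw).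
    rewrite RintegralZl // tame_int_cst => h2.
    have {h2} /andP[h2 h3] : - B <= \int[rho s]_x (f1 x * V^`().[x]) <= D * E * \int[rho s]_x wt x ^+ k.
      apply: h2 => x _; rewrite fV andbT; have := hB x; by rewrite ler_norml => /andP[].
    have h4 : D * E * \int[rho s]_x wt x ^+ k <= D * E * C by rewrite ler_wpM2l // mulr_ge0.
    rewrite /a; move: h1; rewrite ler_norml ef => /andP[h1 h1'].
    have b4 : 0 <= beta / 4 by rewrite divr_ge0.
    have h5 := ler_wpM2l b4 h1; have h6 := ler_wpM2l b4 h1'.
    by rewrite /A; clear - beta_ge0 alpha_gt0 V_convex rho0_compact sol h2 h3 h4 h5 h6; apply/andP; split; lra.
  have time : - A * t <= \int[lebesgue_measure]_(s in `[0, t]) a s.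
    have icst c : (@lebesgue_measure R).-integrable `[0, t] (EFin \o (fun _ : R => c)).
      apply: continuous_compact_integrable; first exact: segment_compact.
      by apply: continuous_subspaceT => x; exact: cst_continuous.
    have := @Rintegral_sandwich _ _ _ (@lebesgue_measure R) `[0, t] (fun=> - A) a
      (fun=> beta / 4 * (2 * D * C) + B) (measurable_itv _) (icst _) (icst _).
    rewrite !Rintegral_cst // => h.
    have {h} /andP[+ _] : - A * fine (lebesgue_measure `[0, t]%classic) <=
        \int[lebesgue_measure]_(s in `[0, t]) a s <=
        (beta / 4 * (2 * D * C) + B) * fine (lebesgue_measure `[0, t]%classic).
      by apply: h => s; rewrite /= in_itv /= => /andP[s0 st]; apply: bound; rewrite s0 (le_trans st).
    by rewrite lebesgue_measure_itv /= lte_fin; case: ltP => h; rewrite /= ?subr0 //;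
      rewrite (_ : t = 0) ?mulr0 //; apply/eqP; rewrite eq_le h.
  have fb x : `|f x| <= L.
    rewrite /f normrM (ger0_norm (ltW L0)) ger0_norm ?wcut_ge0 // ler_piMr ?(ltW L0) //.
    apply: (le_trans (cutoff_le _)); first by rewrite divr_ge0 ?wtX_ge0 // ltW.
    by rewrite ge_max ler01 andbT gerBl divr_ge0 ?wtX_ge0 // ltW.
  have jf s : (rho s).-integrable setT (EFin \o f) by exact: prob_integrable_bounded cf fb.
  have icst s (c : R) : (rho s).-integrable setT (EFin \o (fun _ : R => c)).
    exact: finite_measure_integrable_cst.
  have e0 s : \int[rho s]_x (L - f x) = L - \int[rho s]_x f x.
    by rewrite (RintegralB measurableT (icst s L) (jf s)) tame_int_cst.
  rewrite (e0 t) weq; have : \int[rho 0]_x (L - f x) <= D * m0.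
    rewrite /m0 -(tame_intZ rho_0_moments D (tame_wt R k.+1)).
    apply: le_Rintegral => //.
    - exact: (integrableB measurableT (icst 0 L) (jf 0)).
    - exact: (integrableZl measurableT D (rho_0_moments k.+1)).
    - by move=> x _; have [h _ _ _ _] := hD L x L1.
  rewrite (e0 0); have : A * t <= A * T by rewrite ler_wpM2l.
  by move: time; rewrite /a mulNr; lra.
exists (D * m0 + A * T) => t tT.
apply: truncated_integral_bound; first exact: wt_continuous.
- by move=> x; exact: wtX_ge0.
move=> n.
have min_le L x : 1 <= L -> n%:R <= L -> Num.min (wt x ^+ k.+1) n%:R <= L - L * wcut k L x.
  move=> L1 nL; apply: le_trans (wcut_min k x (lt_le_trans ltr01 L1)).
  by rewrite le_min !ge_min lexx nL orbT.
pose L : R := n%:R + 1; have L1 : 1 <= L by rewrite /L lerDr.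
apply: (le_trans _ (rhs L t L1 tT)); apply: le_Rintegral => //.
- apply: (@prob_integrable_bounded _ _ n%:R).
    have -> : (fun x => Num.min (wt x ^+ k.+1) n%:R) = clamp 0 n%:R \o (fun x => wt x ^+ k.+1).
      by apply/funext => x /=; rewrite /clamp (max_l (wtX_ge0 _ _)).
    by move=> x; apply: continuous_comp; [exact: wt_continuous|exact: clamp_continuous].
  by move=> x; rewrite ger0_norm ?le_min ?wtX_ge0 ?ler0n // ge_min lexx orbT.
- apply: (@prob_integrable_bounded _ _ L).
    move=> x; apply: (is_derive_continuous (is_deriveB (is_derive_cst L x 1)
      (is_deriveM (is_derive_cst L x 1) (is_derive_wcut k L x)))).
  have L0 : 0 < L by exact: lt_le_trans L1.
  move=> x; rewrite -[L in L - _]mulr1 -mulrBr normrM (ger0_norm (ltW L0)) ler_piMr ?(ltW L0) //.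
  have := wcut_ge0 k L x; have r0 : 0 <= wt x ^+ k.+1 / L by rewrite divr_ge0 ?wtX_ge0 // ltW.
  have := cutoff_le r0; rewrite le_max -/(wcut k L x) ler_norml => h h'.
  by apply/andP; split; case/orP: h => h; lra.
- by move=> x _; apply: min_le => //; rewrite /L lerDl.
Qed.

Lemma moments_bounded T k : 0 <= T -> exists C, moment_bound T k C.
Proof.
move=> T0; elim: k => [|k [C hC]]; last exact: moment_step hC.
exists 1 => t _; split; first exact: finite_measure_integrable_cst.
by under eq_Rintegral do rewrite expr0; rewrite tame_int_cst.
Qed.

Lemma rho_moments t : 0 <= t -> has_moments (rho t).
Proof.
by move=> t0 k; have [C hC] := moments_bounded k t0; have [] := hC t; rewrite ?t0 ?lexx.
Qed.

End Moments.

(** * Continuity in time, and the weak equation for bounded test functions *)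

Section TimeContinuity.
Variables (R : realType) (beta alpha : R) (V : {poly R}).
Variables (rho0 : probability (measurableTypeR R) R)
  (rho : R -> probability (measurableTypeR R) R).
Hypotheses (beta_ge0 : 0 <= beta) (alpha_gt0 : 0 < alpha)
  (V_convex : forall x : R, alpha <= V^`()^`().[x])
  (rho0_compact : compactly_supported rho0)
  (sol : mckean_vlasov_solution beta V rho0 rho).
Implicit Types (x y t s r c T L : R) (f g h : R -> R).

Let mom t (t0 : 0 <= t) : has_moments (rho t) :=
  rho_moments beta_ge0 alpha_gt0 V_convex rho0_compact sol t0.

(** Freezing negative times at 0 trades continuity within a half-line for ordinary continuity, which
    is the form used for time integrals and limits. *)
Lemma continuous_max0 f : {within `[0, +oo[, continuous f} ->
  continuous (fun s => f (Num.max s 0)).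
Proof.
move=> /continuous_within_itvcyP [cf c0] s; case: (ltrgtP s 0) => s0.
- apply/cvgrPdist_lt => e e0; near=> r.
  rewrite (max_r (ltW s0)) max_r ?subrr ?normr0 //; apply: ltW.
  by near: r; exact: lt_nbhsl.
- have cs : {for s, continuous f} by apply: cf; rewrite in_itv /= s0.
  apply/cvgrPdist_lt => e e0; near=> r; rewrite (max_l (ltW s0)) max_l.
    by near: r; exact: near_continuous.
  by apply: ltW; near: r; exact: lt_nbhsr.
- rewrite s0; apply/cvgrPdist_lt => e e0; rewrite maxxx.
  have /cvgrPdist_lt /(_ _ e0) [d /= d0 hd] := c0.
  near=> r; have rd : `|0 - r| < d by near: r; exists d.
  case: (lerP r 0) => r0; first by rewrite subrr normr0.
  by apply: hd.
Unshelve. all: by end_near.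
Qed.

Lemma moment_le T f : 0 <= T -> tame f ->
  exists2 C : R, 0 <= C & forall t, 0 <= t <= T -> \int[rho t]_x `|f x| <= C.
Proof.
move=> T0 tf; have [_ [C [k [C0 hC]]]] := tf.
have [B hB] := moments_bounded beta_ge0 alpha_gt0 V_convex rho0_compact sol k T0.
have B0 : 0 <= B.
  have [|_] := hB 0; first by rewrite lexx.
  by apply: le_trans; apply: Rintegral_ge0 => x _; exact: wtX_ge0.
exists (C * B); first exact: mulr_ge0.
move=> t tT; have t0 : 0 <= t by case/andP: tT.
apply: (@le_trans _ _ (\int[rho t]_x (C * wt x ^+ k))).
  by apply: (tame_int_le (mom t0)) => //; [exact: tame_norm|exact/tameZ/tame_wt].
rewrite (tame_intZ (mom t0) _ (tame_wt R k)) ler_wpM2l //; by have [] := hB t tT.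
Qed.

Lemma wcut_continuous j L : continuous (wcut j L).
Proof. by move=> x; exact: (is_derive_continuous (is_derive_wcut j L x)). Qed.

Lemma compact_support_bounded f B : continuous f -> (forall x, B < `|x| -> f x = 0) ->
  exists2 C : R, 0 <= C & forall x, `|f x| <= C.
Proof.
move=> cf f0; have BB : - `|B| <= `|B| by have := normr_ge0 B; lra.
have [C C0 hC] := segment_bounded BB (continuous_subspaceT cf).
exists C => // x; have [xB|xB] := lerP `|x| `|B|.
  by apply: hC; rewrite -ler_norml.
by rewrite f0 ?normr0 //; apply: le_lt_trans xB; exact: ler_norm.
Qed.

(** Weak continuity speaks of bounded functions only. Multiplying f by [wcut 0 L] changes its
    integral by at most 1/L times a moment that is bounded uniformly up to time [Num.max s 0] +
    1. *)
Lemma tame_time_continuous f : tame f ->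
  continuous (fun s => \int[rho (Num.max s 0)]_x f x).
Proof.
move=> tf s; apply/cvgrPdist_lt => e e0.
have [D D0 hD] := wcut_bounds R 0.
have m0 r : 0 <= Num.max r 0 by rewrite le_max lexx orbT.
have tfw : tame (fun x => f x * (D * wt x)).
  by apply: tameM => //; apply: tameZ; have := tame_wt R 1.
have T0 : 0 <= Num.max s 0 + 1 by rewrite addr_ge0.
have [C C0 hC] := moment_le T0 tfw.
pose L := 1 + 4 * C / e.
have L1 : 1 <= L by rewrite lerDl divr_ge0 ?mulr_ge0 // ltW.
have L0 : 0 < L by exact: lt_le_trans L1.
pose g x := f x * wcut 0 L x.
have cg : continuous g.
  by move=> x; apply: continuousM; [case: tf => + _; apply|exact: wcut_continuous].
have [B B0 hB] : exists2 B : R, 0 <= B & forall x, `|g x| <= B.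
  apply: (compact_support_bounded cg (B := L + 1)) => x /(wcut_support 0 L0) [h _].
  by rewrite /g h mulr0.
have tg : tame g := tame_bounded cg hB.
have close r : Num.max r 0 <= Num.max s 0 + 1 ->
    `|\int[rho (Num.max r 0)]_x f x - \int[rho (Num.max r 0)]_x g x| <= e / 4.
  move=> rs; rewrite -(tame_intB (mom (m0 r)) tf tg).
  have h x : `|f x - g x| <= L^-1 * `|f x * (D * wt x)|.
    have := wcut_ge0 0 L x; have [_ + _ _ _] := hD L x L1; rewrite !expr1 => h1 h0.
    have h2 : wcut 0 L x <= 1.
      have r0 : 0 <= wt x ^+ 1 / L by rewrite divr_ge0 ?wtX_ge0 // ltW.
      by apply: (le_trans (cutoff_le r0)); rewrite ge_max ler01 andbT gerBl.
    rewrite /g -{1}[f x]mulr1 -mulrBr !normrM mulrCA ler_wpM2l //.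
    rewrite (ger0_norm D0) (ger0_norm (wt_ge0 x)) ger0_norm; last lra.
    by apply: (le_trans h1); rewrite mulrC.
  apply: (le_trans (tame_int_norm (mom (m0 r)) (tameB tf tg)
    (tameZ L^-1 (tame_norm tfw)) h)).
  rewrite (tame_intZ (mom (m0 r))); last exact: tame_norm.
  apply: (@le_trans _ _ (L^-1 * C)).
    by rewrite ler_wpM2l ?invr_ge0 ?(ltW L0) // hC // m0.
  rewrite mulrC ler_pdivrMr // /L mulrDr mulr1.
  rewrite (_ : e / 4 * (4 * C / e) = C); first by rewrite lerDr divr_ge0 // ltW.
  by field; exact: lt0r_neq0.
have cIg : continuous (fun s => \int[rho (Num.max s 0)]_x g x).
  apply: (@continuous_max0 (fun s => \int[rho s]_x g x)).
  case: sol => wc _ _; apply: wc => //.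
  by exists B; split; rewrite ?num_real // => M BM x _; apply: le_trans (hB x) (ltW BM).
near=> r.
have rs : Num.max r 0 <= Num.max s 0 + 1.
  have : r < s + 1 by near: r; apply: lt_nbhsl; rewrite ltrDl.
  rewrite ge_max T0 andbT => /ltW h; apply: (le_trans h).
  by rewrite lerD2r le_max lexx.
have h1 := close r rs.
have h2 : `|\int[rho (Num.max s 0)]_x f x - \int[rho (Num.max s 0)]_x g x| <= e / 4.
  by apply: close; rewrite lerDl.
have h3 : `|\int[rho (Num.max s 0)]_x g x - \int[rho (Num.max r 0)]_x g x| < e / 4.
  by near: r; apply: (near_continuous (cIg s)); rewrite divr_gt0.
move: h1 h2 h3; clear - sol mom; rewrite !ltr_norml !ler_norml => /andP[? ?] /andP[? ?] /andP[? ?].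
by apply/andP; split; lra.
Unshelve. all: by end_near.
Qed.

Lemma difference_quotientB f g df dg x y :
  (forall c : R, is_derive c 1 f (df c)) -> (forall c : R, is_derive c 1 g (dg c)) ->
  difference_quotient f x y - difference_quotient g x y
    = difference_quotient (fun x => f x - g x) x y.
Proof.
move=> hf hg; rewrite /difference_quotient; case: eqP => _; last by rewrite -mulrBl; congr (_ / _); ring.
have e := is_deriveB (hf x) (hg x).
rewrite !derive1E (@derive_val _ _ _ _ _ _ _ e).
by have [_ ->] := hf x; have [_ ->] := hg x.
Qed.

Lemma perturbed_increment (p p' q q' u v k l : R) : p = q + u ->
  `|u - v| <= l -> `|p - p'| <= k -> `|q - q'| <= k -> `|p' - q' - v| <= k + k + l.
Proof.
by move=> -> ; rewrite !ler_norml => /andP[? ?] /andP[? ?] /andP[? ?]; apply/andP; split; lra.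
Qed.

(* The test functions are [f] times the cutoffs [wcut 0 L], with L tending to infinity. *)
Lemma weak_equation_bounded f f1 f2 (C : R) t : elementary f ->
  (forall x, is_derive x 1 f (f1 x)) -> (forall x, is_derive x 1 f1 (f2 x)) ->
  (forall x, [/\ `|f x| <= C, `|f1 x| <= C & `|f2 x| <= C]) ->
  (forall s x, 0 <= s -> (rho s).-integrable setT (EFin \o difference_quotient f1 x)) ->
  (forall s, 0 <= s ->
    (rho s).-integrable setT (EFin \o (fun x => \int[rho s]_y difference_quotient f1 x y))) ->
  let a s := beta / 4%:R * (\int[rho s]_x \int[rho s]_y difference_quotient f1 x y)
             - \int[rho s]_x (f1 x * V^`().[x]) in
  (@lebesgue_measure R).-integrable `[0, t] (EFin \o a) -> 0 <= t ->
  \int[rho t]_x f x = \int[rho 0]_x f x + \int[lebesgue_measure]_(s in `[0, t]) a s.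
Proof.
move=> ef df df1 hC iD iDD a ia t0.
have C0 : 0 <= C by have [h _ _] := hC 0; exact: le_trans h.
have [D D0 hD] := wcut_bounds R 0.
have cf : continuous f by move=> x; exact: is_derive_continuous (df x).
have cf1 : continuous f1 by move=> x; exact: is_derive_continuous (df1 x).
have tf : tame f by apply: (tame_bounded cf (C := C)) => x; have [] := hC x.
have tf1 : tame f1 by apply: (tame_bounded cf1 (C := C)) => x; have [] := hC x.
have tw : tame (@wt R) := tame_wt R 1.
have tV : tame (fun x => wt x * V^`().[x]) by apply: tameM => //; exact: tame_poly.
have [M1 M10 hM1] := moment_le t0 tw.
have [M2 M20 hM2] := moment_le t0 tV.
pose E := 4 * (C * D); have E0 : 0 <= E by rewrite !mulr_ge0.
pose K := beta / 4 * (2 * E * M1) + E * M2; have K0 : 0 <= K.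
  by rewrite /K !(addr_ge0, mulr_ge0) ?invr_ge0.
suff key L : 1 <= L -> `|\int[rho t]_x f x - \int[rho 0]_x f x
    - \int[lebesgue_measure]_(s in `[0, t]) a s| <= (2 * (E * M1) + K * t) / L.
  apply/eqP; rewrite -subr_eq0 opprD addrA -normr_le0 leNgt; apply/negP => pos.
  set N := `|_| in pos; pose B := 2 * (E * M1) + K * t.
  have B0 : 0 <= B by rewrite /B addr_ge0 // ?mulr_ge0.
  (* The discrepancy N satisfies N L <= B for every L >= 1; at L = 1 + B / N this reads N + B <= B,
     which contradicts N > 0. *)
  have L1 : 1 <= 1 + B / N by rewrite lerDl divr_ge0 // ltW.
  have := key _ L1; rewrite -/N -/B ler_pdivlMr ?(lt_le_trans ltr01 L1) //.
  rewrite mulrDr mulr1 mulrCA divff ?mulr1 ?lt0r_neq0 //; lra.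
move=> L1; have L0 : 0 < L by exact: lt_le_trans L1.
have iL0 : 0 <= L^-1 by rewrite invr_ge0 ltW.
pose w := wcut 0 L; pose w1 := wcut1 0 L; pose w2 := wcut2 0 L.
pose g x := f x * w x; pose g1 x := f1 x * w x + f x * w1 x.
pose g2 x := f2 x * w x + 2 * (f1 x * w1 x) + f x * w2 x.
have dg x : is_derive x 1 g (g1 x).
  apply: (is_derive_eq (is_deriveM (df x) (is_derive_wcut 0 L x))).
  by rewrite /GRing.scale /g1 /w /w1 /=; ring.
have dg1 x : is_derive x 1 g1 (g2 x).
  apply: (is_derive_eq (is_deriveD (is_deriveM (df1 x) (is_derive_wcut 0 L x))
    (is_deriveM (df x) (is_derive_wcut1 0 L x)))).
  by rewrite /GRing.scale /g2 /w /w1 /w2 /=; ring.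
have eg : derive1 g = g1 by apply/funext => x; rewrite derive1E; have [] := dg x.
have tg : test_function g.
  apply: (@elementary_test _ _ (L + 1)); first by apply: elementary_mul => //; exact: wcut_elementary.
  by move=> x /(wcut_support 0 L0) [h _]; rewrite /g /w h mulr0.
have weq := let: And3 _ _ w := sol in w g t tg t0.
have wb x : [/\ `|w x - 1| <= D * wt x / L, `|w1 x| <= D * wt x / L &
                `|w2 x| <= D * wt x / L].
  have [_ h1 h2 h3 _] := hD L x L1; rewrite !expr1 in h1 h2.
  have r0 : 0 <= wt x ^+ 1 / L by rewrite divr_ge0 ?wtX_ge0 // ltW.
  have w_le1 : w x <= 1.
    by apply: (le_trans (cutoff_le r0)); rewrite ge_max ler01 andbT gerBl.
  split => //; first by rewrite distrC ger0_norm // subr_ge0.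
  apply: (le_trans h3); rewrite ler_wpM2r // expr0 ler_wpM2l //; exact: wt_ge1.
have eW x (u : R) : `|u| <= D * wt x / L -> C * `|u| <= E / 4 * L^-1 * wt x.
  move=> hu; apply: (le_trans (ler_wpM2l C0 hu)).
  by rewrite /E le_eqVlt; apply/orP; left; apply/eqP; field; exact: lt0r_neq0.
have pw x : 0 <= E * L^-1 * wt x by rewrite mulr_ge0 ?wt_ge0 // mulr_ge0.
have e0 x : `|g x - f x| <= E * L^-1 * wt x.
  have [h _ _] := wb x; have [c _ _] := hC x.
  rewrite /g (_ : _ - _ = f x * (w x - 1)); last by ring.
  rewrite normrM; apply: (le_trans (ler_wpM2r (normr_ge0 _) c)).
  by apply: (le_trans (eW _ _ h)); have := pw x; clear - sol mom; lra.
have e1 x : `|g1 x - f1 x| <= E * L^-1 * wt x.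
  have [h h' _] := wb x; have [c c' _] := hC x.
  rewrite /g1 (_ : _ - _ = f1 x * (w x - 1) + f x * w1 x); last by ring.
  apply: (le_trans (ler_normD _ _)); rewrite (normrM (f1 x)) (normrM (f x)).
  have := ler_wpM2r (normr_ge0 (w x - 1)) c'; have := ler_wpM2r (normr_ge0 (w1 x)) c.
  have := eW _ _ h; have := eW _ _ h'; have := pw x; clear - sol mom; lra.
have e2 x : `|g2 x - f2 x| <= E * L^-1 * wt x.
  have [h h' h''] := wb x; have [c c' c''] := hC x.
  rewrite /g2 (_ : _ - _ = f2 x * (w x - 1) + 2 * (f1 x * w1 x) + f x * w2 x); last by ring.
  apply: (le_trans (ler_normD _ _)).
  have h4 := ler_normD (f2 x * (w x - 1)) (2 * (f1 x * w1 x)).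
  move: h4; rewrite (normrM (f2 x)) (normrM 2) (normrM (f1 x)) (normrM (f x)) (@ger0_norm _ 2) // => h4.
  have := ler_wpM2r (normr_ge0 (w x - 1)) c''; have := ler_wpM2r (normr_ge0 (w1 x)) c'.
  have := ler_wpM2r (normr_ge0 (w2 x)) c.
  have := eW _ _ h; have := eW _ _ h'; have := eW _ _ h''; have := pw x; clear - sol mom h4; lra.
have EL0 : 0 <= E * L^-1 by rewrite mulr_ge0.
have tg0 : tame g.
  by apply: tameM => //; split; [exact: wcut_continuous|exists 1, 0%N; split => // x;
    rewrite expr0 mulr1 ger0_norm ?wcut_ge0 //; apply: (le_trans (cutoff_le _));
    rewrite ?ge_max ?ler01 ?andbT ?gerBl divr_ge0 ?wtX_ge0 // ltW].
have tg1 : tame g1.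
  rewrite (_ : g1 = fun x => (g1 x - f1 x) + f1 x); last by apply/funext => x; ring.
  apply: tameD => //; split.
    move=> x; apply: continuousB; last exact: cf1.
    exact: is_derive_continuous (dg1 x).
  by exists (E * L^-1), 1%N; split => // x; rewrite expr1.
have w_int s : 0 <= s <= t -> \int[rho s]_x wt x <= M1.
  move=> st; apply: le_trans (hM1 s st); have s0 : 0 <= s by case/andP: st.
  apply: (tame_int_le (mom s0)) => //; first exact: tame_norm.
  by move=> x; exact: ler_norm.
have d0 s : 0 <= s <= t -> `|\int[rho s]_x g x - \int[rho s]_x f x| <= E * M1 / L.
  move=> st; have s0 : 0 <= s by case/andP: st.
  rewrite -(tame_intB (mom s0)) //.
  apply: (le_trans (tame_int_norm (mom s0) (tameB tg0 tf) (tameZ (E * L^-1) tw) e0)).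
  by rewrite (tame_intZ (mom s0)) // mulrAC ler_wpM2r // ler_wpM2l // w_int.
pose b s := beta / 4%:R * (\int[rho s]_x \int[rho s]_y difference_quotient g1 x y)
             - \int[rho s]_x (g1 x * V^`().[x]).
have dab s : 0 <= s <= t -> `|b s - a s| <= K / L.
  move=> st; have s0 : 0 <= s by case/andP: st.
  have dd x y : `|difference_quotient g1 x y - difference_quotient f1 x y|
      <= E * L^-1 * (wt x ^+ 1 + wt y ^+ 1).
    rewrite (difference_quotientB x y dg1 df1).
    apply: (difference_quotient_bound x y EL0 (fun c => is_deriveB (dg1 c) (df1 c))) => c.
    by rewrite expr1; exact: e2.
  have h1 := difference_quotient_integral_bound (mom s0 1) EL0 (fun x => iD s x s0) (iDD s s0) dd.
  have h2 : `|\int[rho s]_x (g1 x * V^`().[x]) - \int[rho s]_x (f1 x * V^`().[x])| <= E * M2 / L.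
    have t1 : tame (fun x => g1 x * V^`().[x]) by apply: tameM => //; exact: tame_poly.
    have t2 : tame (fun x => f1 x * V^`().[x]) by apply: tameM => //; exact: tame_poly.
    rewrite -(tame_intB (mom s0)) //.
    have hb x : `|g1 x * V^`().[x] - f1 x * V^`().[x]| <= E * L^-1 * `|wt x * V^`().[x]|.
      by rewrite -mulrBl !normrM (ger0_norm (wt_ge0 x)) mulrA ler_wpM2r.
    apply: (le_trans (tame_int_norm (mom s0) (tameB t1 t2) (tameZ (E * L^-1) (tame_norm tV)) hb)).
    rewrite (tame_intZ (mom s0)); last exact: tame_norm.
    by rewrite mulrAC ler_wpM2r // ler_wpM2l // hM2.
  have h3 : 2 * (E * L^-1) * \int[rho s]_x wt x ^+ 1 <= 2 * E * M1 / L.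
    under eq_Rintegral do rewrite expr1.
    rewrite (_ : 2 * E * M1 / L = 2 * (E * L^-1) * M1); last by ring.
    by rewrite ler_wpM2l ?mulr_ge0 // w_int.
  have b4 : 0 <= beta / 4 by rewrite divr_ge0.
  have h4 := ler_wpM2l b4 (le_trans h1 h3).
  rewrite /b /a; set x1 := \int[_]_x \int[_]_y _ in h4 *; set x2 := \int[_]_x \int[_]_y _ in h4 *.
  set x3 := \int[_]_x _ in h2 *; set x4 := \int[_]_x _ in h2 *.
  rewrite (_ : _ - _ = beta / 4 * (x1 - x2) - (x3 - x4)); last by ring.
  apply: (le_trans (ler_normB _ _)); rewrite normrM (ger0_norm b4).
  apply: (le_trans (lerD h4 h2)).
  by rewrite /K le_eqVlt; apply/orP; left; apply/eqP; ring.
have time : `|\int[lebesgue_measure]_(s in `[0, t]) b s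
    - \int[lebesgue_measure]_(s in `[0, t]) a s| <= K * t / L.
  have icst c : (@lebesgue_measure R).-integrable `[0, t] (EFin \o (fun _ : R => c)).
    apply: continuous_compact_integrable; first exact: segment_compact.
    by apply: continuous_subspaceT => x; exact: cst_continuous.
  have hs s : `[0, t]%classic s -> a s - K / L <= b s <= a s + K / L.
    by rewrite /= in_itv /= => /dab; rewrite ler_distl.
  have mI : measurable (`[0, t]%classic : set (measurableTypeR R)) by exact: measurable_itv.
  have := Rintegral_sandwich mI (integrableB mI ia (icst (K / L)))
    (integrableD mI ia (icst (K / L))) hs.
  rewrite (RintegralB mI ia (icst (K / L))) (RintegralD mI ia (icst (K / L))) !Rintegral_cst //.
  have -> : fine (lebesgue_measure `[0, t]%classic) = t.
    rewrite lebesgue_measure_itv /= lte_fin; case: ltP => h /=; first by rewrite subr0.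
    by apply/eqP; rewrite eq_le t0 h.
  by rewrite (mulrAC K) ler_distl.
rewrite eg -/b in weq.
have h1 := d0 t (introT andP (conj t0 (lexx t))).
have h2 := d0 0 (introT andP (conj (lexx 0) t0)).
have -> : (2 * (E * M1) + K * t) / L = E * M1 / L + E * M1 / L + K * t / L by ring.
exact: perturbed_increment weq time h1 h2.
Qed.

End TimeContinuity.

Local Open Scope complex_scope.

(** * The evolution of the Stieltjes transform *)

Section ComplexIntegral.
Variable R : realType.
Implicit Types (u v z w : R[i]) (f g : R -> R[i]) (x y : R).

Lemma cReD u v : complex.Re (u + v) = complex.Re u + complex.Re v.
Proof. by case: u; case: v. Qed.

Lemma cImD u v : complex.Im (u + v) = complex.Im u + complex.Im v.
Proof. by case: u; case: v. Qed.

Lemma cReN u : complex.Re (- u) = - complex.Re u.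
Proof. by case: u. Qed.

Lemma cImN u : complex.Im (- u) = - complex.Im u.
Proof. by case: u. Qed.

Lemma cReM u v :
  complex.Re (u * v) = complex.Re u * complex.Re v - complex.Im u * complex.Im v.
Proof. by case: u; case: v. Qed.

Lemma cImM u v :
  complex.Im (u * v) = complex.Re u * complex.Im v + complex.Im u * complex.Re v.
Proof. by case: u => a b; case: v => c d. Qed.

Definition ReImE := (cReD, cImD, cReN, cImN, cReM, cImM).

Lemma complex_ext u v : complex.Re u = complex.Re v -> complex.Im u = complex.Im v -> u = v.
Proof. by case: u => a b; case: v => c d /= -> ->. Qed.

Definition ctame g := tame (fun x => complex.Re (g x)) /\ tame (fun x => complex.Im (g x)).

Lemma ctame_eq f g : f =1 g -> ctame f -> ctame g.
Proof. by move=> /funext ->. Qed.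

Lemma ctameD f g : ctame f -> ctame g -> ctame (fun x => f x + g x).
Proof.
move=> [a b] [c d]; split.
  by rewrite (_ : (fun x => _) = fun x => complex.Re (f x) + complex.Re (g x));
    [exact: tameD|apply/funext => x; rewrite cReD].
by rewrite (_ : (fun x => _) = fun x => complex.Im (f x) + complex.Im (g x));
  [exact: tameD|apply/funext => x; rewrite cImD].
Qed.

Lemma ctameM f g : ctame f -> ctame g -> ctame (fun x => f x * g x).
Proof.
move=> [a b] [c d]; split.
  rewrite (_ : (fun x => _) = fun x => complex.Re (f x) * complex.Re (g x)
      - complex.Im (f x) * complex.Im (g x)).
    by apply: tameB; apply: tameM.
  by apply/funext => x; rewrite cReM.
rewrite (_ : (fun x => _) = fun x => complex.Re (f x) * complex.Im (g x)
    + complex.Im (f x) * complex.Re (g x)).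
  by apply: tameD; apply: tameM.
by apply/funext => x; rewrite cImM.
Qed.

Lemma ctame_cst u : ctame (fun=> u).
Proof. by split; exact: tame_cst. Qed.

Lemma ctameZ u f : ctame f -> ctame (fun x => u * f x).
Proof. by move=> tf; apply: ctameM => //; exact: ctame_cst. Qed.

Lemma ctameX f n : ctame f -> ctame (fun x => f x ^+ n).
Proof.
move=> tf; elim: n => [|n IH].
  by apply: ctame_eq (ctame_cst 1) => x; rewrite expr0.
by apply: ctame_eq (ctameM tf IH) => x; rewrite exprS.
Qed.

Lemma ctame_real (h : R -> R) : tame h -> ctame (fun x => (h x)%:C).
Proof. by move=> th; split => //; exact: tame_cst. Qed.

Lemma ctame_sum (n : nat) (F : nat -> R -> R[i]) : (forall i, ctame (F i)) ->
  ctame (fun x => \sum_(i < n) F i x).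
Proof.
move=> tF; elim: n => [|n IH].
  by apply: ctame_eq (ctame_cst 0) => x; rewrite big_ord0.
by apply: ctame_eq (ctameD IH (tF n)) => x; rewrite big_ord_recr.
Qed.

Definition cauchy z x : R[i] := (x%:C - z)^-1.

Lemma cauchyE z x : cauchy z x
  = cauchy_re (complex.Re z) (complex.Im z) x +i* cauchy_im (complex.Re z) (complex.Im z) x.
Proof.
case: z => a b; rewrite /cauchy /cauchy_re /cauchy_im /=.
by congr (_ +i* _); rewrite !sub0r ?sqrrN // mulNr opprK.
Qed.

Lemma cauchy_re_im_bound a b x : b != 0 ->
  `|cauchy_re a b x| <= `|b|^-1 /\ `|cauchy_im a b x| <= `|b|^-1.
Proof.
move=> b0; have n0 := sqr_add_gt0 (x - a) b0.
have nb : 0 < `|b| by rewrite normr_gt0.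
set X := x - a in n0 *; rewrite /cauchy_re /cauchy_im -/X !normrM normfV (ger0_norm (ltW n0)).
rewrite !ler_pdivrMr //.
rewrite !ler_pdivlMl //.
rewrite -(real_normK (num_real X)) -(real_normK (num_real b)) -expr2.
split; last by rewrite lerDr sqr_ge0.
have := sqr_ge0 (`|X| - `|b|); have := sqr_ge0 `|X|; have := sqr_ge0 `|b|; nra.
Qed.

Lemma ctame_cauchy z : complex.Im z != 0 -> ctame (cauchy z).
Proof.
case: z => a b /= b0.
apply: (@ctame_eq (fun x => cauchy_re a b x +i* cauchy_im a b x)).
  by move=> x; rewrite cauchyE.
split=> /=; apply: (tame_bounded (C := `|b|^-1)).
- by move=> x; exact: is_derive_continuous (is_derive_cauchy a x b0).1.
- by move=> x; have [] := cauchy_re_im_bound a x b0.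
- by move=> x; exact: is_derive_continuous (is_derive_cauchy a x b0).2.
- by move=> x; have [] := cauchy_re_im_bound a x b0.
Qed.

Section Integral.
Variable mu : probability (measurableTypeR R) R.

Definition Cint g : R[i] :=
  (\int[mu]_x complex.Re (g x)) +i* (\int[mu]_x complex.Im (g x)).

Lemma stieltjesE z : stieltjes mu z = Cint (cauchy z).
Proof. by []. Qed.

Lemma eq_Cint f g : f =1 g -> Cint f = Cint g.
Proof. by move=> /funext ->. Qed.

Hypothesis mom : has_moments mu.

Lemma CintD f g : ctame f -> ctame g -> Cint (fun x => f x + g x) = Cint f + Cint g.
Proof.
move=> [a b] [c d]; apply: complex_ext; rewrite ReImE /=.
  by under eq_Rintegral do rewrite cReD; rewrite tame_intD.
by under eq_Rintegral do rewrite cImD; rewrite tame_intD.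
Qed.

Lemma CintZ u f : ctame f -> Cint (fun x => u * f x) = u * Cint f.
Proof.
move=> [a b]; apply: complex_ext; rewrite ReImE /=.
  under eq_Rintegral do rewrite cReM.
  by rewrite tame_intB ?tame_intZ //; exact: tameZ.
under eq_Rintegral do rewrite cImM.
by rewrite tame_intD ?tame_intZ //; exact: tameZ.
Qed.

Lemma CintN f : ctame f -> Cint (fun x => - f x) = - Cint f.
Proof.
by move=> tf; rewrite -mulN1r -CintZ //; apply: eq_Cint => x; rewrite mulN1r.
Qed.

Lemma CintB f g : ctame f -> ctame g -> Cint (fun x => f x - g x) = Cint f - Cint g.
Proof.
move=> tf tg; rewrite -CintN // -CintD //.
by apply: ctame_eq (ctameZ (-1) tg) => x; rewrite mulN1r.
Qed.

Lemma Cint_real (h : R -> R) : Cint (fun x => (h x)%:C) = (\int[mu]_x h x)%:C.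
Proof. by apply: complex_ext => //=; rewrite tame_int_cst. Qed.

Lemma Cint_cst u : Cint (fun=> u) = u.
Proof. by apply: complex_ext => /=; rewrite tame_int_cst. Qed.

Lemma Cint_sum (n : nat) (F : nat -> R -> R[i]) : (forall i, ctame (F i)) ->
  Cint (fun x => \sum_(i < n) F i x) = \sum_(i < n) Cint (F i).
Proof.
move=> tF; elim: n => [|n IH].
  rewrite big_ord0; transitivity (Cint (fun=> 0)); last exact: Cint_cst.
  by apply: eq_Cint => x; rewrite big_ord0.
rewrite big_ord_recr /= -IH -CintD //; last exact: ctame_sum.
by apply: eq_Cint => x; rewrite big_ord_recr.
Qed.

End Integral.
End ComplexIntegral.

Section ComplexNorm.
Variable R : realType.
Implicit Types (u v z w : R[i]) (x y : R).

(** The norm of R[i] takes its values in R[i]; this is the modulus as a real number. *)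
Definition cabs u : R := Normc.normc u.

Lemma cabs_ge0 u : 0 <= cabs u.
Proof. by case: u => a b; exact: sqrtr_ge0. Qed.

Lemma cabs_sqr u : cabs u ^+ 2 = complex.Re u ^+ 2 + complex.Im u ^+ 2.
Proof. by case: u => a b; rewrite /cabs /= sqr_sqrtr // addr_ge0 ?sqr_ge0. Qed.

Lemma cabsM u v : cabs (u * v) = cabs u * cabs v.
Proof. exact: Normc.normcM. Qed.

Lemma cabsV u : cabs u^-1 = (cabs u)^-1.
Proof. exact: Normc.normcV. Qed.

Lemma cabsX u n : cabs (u ^+ n) = cabs u ^+ n.
Proof.
elim: n => [|n IH]; first by rewrite !expr0 /cabs Normc.normc1.
by rewrite !exprS cabsM IH.
Qed.

Lemma cabsD u v : cabs (u + v) <= cabs u + cabs v.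
Proof. exact: le_normcD. Qed.

Lemma cabsN u : cabs (- u) = cabs u.
Proof. exact: normcN. Qed.

Lemma cabsB u v : cabs (u - v) <= cabs u + cabs v.
Proof. by rewrite -(cabsN v); exact: cabsD. Qed.

Lemma cabs_real x : cabs x%:C = `|x|.
Proof. by rewrite /cabs /= expr0n /= addr0 sqrtr_sqr. Qed.

Lemma cabs0 : cabs 0 = 0. Proof. exact: Normc.normc0. Qed.

Lemma cabs_eq0 u : cabs u = 0 -> u = 0.
Proof. exact: Normc.eq0_normc. Qed.

Lemma cabs_gt0 u : u != 0 -> 0 < cabs u.
Proof.
by move=> u0; rewrite lt0r cabs_ge0 andbT; apply: contra u0 => /eqP/cabs_eq0 ->.
Qed.

Lemma Re_le_cabs u : `|complex.Re u| <= cabs u.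
Proof.
rewrite -[leRHS]ger0_norm ?cabs_ge0 // -ler_sqr ?nnegrE // !real_normK ?num_real //.
by rewrite cabs_sqr lerDl sqr_ge0.
Qed.

Lemma Im_le_cabs u : `|complex.Im u| <= cabs u.
Proof.
rewrite -[leRHS]ger0_norm ?cabs_ge0 // -ler_sqr ?nnegrE // !real_normK ?num_real //.
by rewrite cabs_sqr lerDr sqr_ge0.
Qed.

Lemma cabs_le_ReIm u : cabs u <= `|complex.Re u| + `|complex.Im u|.
Proof.
rewrite -ler_sqr ?nnegrE ?cabs_ge0 ?addr_ge0 // cabs_sqr sqrrD !real_normK ?num_real //.
by rewrite -addrA lerD2l addrC lerDl mulrn_wge0 // mulr_ge0.
Qed.

Lemma off_axis_neq0 z x : complex.Im z != 0 -> x%:C - z != 0.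
Proof.
apply: contra => /eqP e; have : complex.Im (x%:C - z) = 0 by rewrite e.
by rewrite cImD cImN /= add0r => /eqP; rewrite oppr_eq0.
Qed.

Lemma cabs_cauchy_le z x : complex.Im z != 0 -> cabs (cauchy z x) <= `|complex.Im z|^-1.
Proof.
move=> z0; have n0 := off_axis_neq0 x z0.
rewrite /cauchy cabsV lef_pV2 ?posrE ?normr_gt0 ?cabs_gt0 //.
by apply: le_trans (Im_le_cabs _); rewrite !ReImE /= add0r normrN.
Qed.

Lemma cauchyB z x y : complex.Im z != 0 ->
  cauchy z x - cauchy z y = (y - x)%:C * (cauchy z x * cauchy z y).
Proof.
move=> z0; have n0 := off_axis_neq0 x z0; have n1 := off_axis_neq0 y z0.
by rewrite /cauchy rmorphB; field; rewrite n0 n1.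
Qed.

Lemma cauchy_resolvent z w x : complex.Im z != 0 -> complex.Im w != 0 ->
  cauchy z x - cauchy w x = (z - w) * (cauchy z x * cauchy w x).
Proof.
move=> z0 w0; have n0 := off_axis_neq0 x z0; have n1 := off_axis_neq0 x w0.
by rewrite /cauchy; field; rewrite n0 n1.
Qed.

(** The boolean selects real or imaginary part, so that derivatives and integrals, which are
    available for real functions, are handled once for both parts. *)
Definition cpart (b : bool) u := if b then complex.Re u else complex.Im u.

Lemma cpartD b u v : cpart b (u + v) = cpart b u + cpart b v.
Proof. by case: b; rewrite /cpart ReImE. Qed.

Lemma cpartN b u : cpart b (- u) = - cpart b u.
Proof. by case: b; rewrite /cpart ReImE. Qed.

Lemma cpart_realM b x u : cpart b (x%:C * u) = x * cpart b u.
Proof. by case: b; rewrite /cpart ReImE /= mul0r ?subr0 ?addr0. Qed.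

Lemma cpart_le b u : `|cpart b u| <= cabs u.
Proof. by case: b; [exact: Re_le_cabs|exact: Im_le_cabs]. Qed.

Lemma cpart_Cint b (mu : probability (measurableTypeR R) R) g :
  cpart b (Cint mu g) = \int[mu]_x cpart b (g x).
Proof. by case: b. Qed.

Lemma ctame_cpart b g : ctame g -> tame (fun x => cpart b (g x)).
Proof. by case: b => -[]. Qed.

Lemma is_derive_cpart_cauchy b z x : complex.Im z != 0 ->
  is_derive x 1 (fun x => cpart b (cauchy z x)) (cpart b (- cauchy z x ^+ 2)) /\
  is_derive x 1 (fun x => cpart b (- cauchy z x ^+ 2)) (cpart b (2 * cauchy z x ^+ 3)).
Proof.
case: z => p q /= q0.
have e1 : (fun x => complex.Re (cauchy (p +i* q) x)) = cauchy_re p q.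
  by apply/funext => y; rewrite cauchyE.
have e2 : (fun x => complex.Im (cauchy (p +i* q) x)) = cauchy_im p q.
  by apply/funext => y; rewrite cauchyE.
have e3 : (fun x => complex.Re (- cauchy (p +i* q) x ^+ 2))
   = (fun x => cauchy_im p q x * cauchy_im p q x - cauchy_re p q x * cauchy_re p q x).
  by apply/funext => y; rewrite cauchyE expr2 !ReImE /=; ring.
have e4 : (fun x => complex.Im (- cauchy (p +i* q) x ^+ 2))
   = (fun x => - (cauchy_re p q x * cauchy_im p q x) - cauchy_re p q x * cauchy_im p q x).
  by apply/funext => y; rewrite cauchyE expr2 !ReImE /=; ring.
have [dr di] := is_derive_cauchy p x q0.
have two : (2 : R[i]) = 2%:C by rewrite rmorph_nat.
case: b; rewrite /cpart ?e1 ?e2 ?e3 ?e4; split.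
- by apply: (is_derive_eq dr); rewrite cauchyE expr2 !ReImE /=; ring.
- apply: (is_derive_eq (is_deriveB (is_deriveM di di) (is_deriveM dr dr))).
  by rewrite two cauchyE !exprS expr0 !ReImE /GRing.scale /=; ring.
- by apply: (is_derive_eq di); rewrite cauchyE expr2 !ReImE /=; ring.
- apply: (is_derive_eq (is_deriveB (is_deriveN (is_deriveM dr di)) (is_deriveM dr di))).
  by rewrite two cauchyE !exprS expr0 !ReImE /GRing.scale /=; ring.
Qed.

Lemma cpart_cauchy_elementary b z : complex.Im z != 0 ->
  elementary (fun x => cpart b (cauchy z x)).
Proof.
case: z => p q /= q0; case: b; rewrite /cpart.
  by apply: (elementary_eq _ (elementary_re p q0)) => x; rewrite cauchyE.
by apply: (elementary_eq _ (elementary_im p q0)) => x; rewrite cauchyE.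
Qed.

(** With X and Y the kernels at x and y, X - Y = -(x - y) X Y, so the quotient of -X^2 is X Y (X +
    Y). The symmetrized interaction thereby splits into products of functions of x and of y, and its
    double integral is twice [stieltjes] times [stieltjes2]. *)
Lemma difference_quotient_cauchy b z x y : complex.Im z != 0 ->
  difference_quotient (fun x => cpart b (- cauchy z x ^+ 2)) x y
    = cpart b (cauchy z x * cauchy z y ^+ 2 + cauchy z x ^+ 2 * cauchy z y).
Proof.
move=> z0; rewrite /difference_quotient; case: eqP => [->|/eqP xy].
  rewrite derive1E; have [_ ->] := (is_derive_cpart_cauchy b y z0).2.
  by congr cpart; ring.
have xy0 : x - y != 0 by rewrite subr_eq0.
apply: (mulIf xy0); rewrite divfK // mulrC -cpart_realM -cpartN -cpartD; congr cpart.
have h : cauchy z x - cauchy z y + (x - y)%:C * (cauchy z x * cauchy z y) = 0.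
  by rewrite cauchyB // !rmorphB; ring.
set X := cauchy z x in h *; set Y := cauchy z y in h *; set d := (x - y)%:C in h *.
have -> : - X ^+ 2 - - Y ^+ 2 = - ((X - Y + d * (X * Y)) * (X + Y)) + d * (X * Y) * (X + Y) by ring.
by rewrite h; ring.
Qed.

End ComplexNorm.

Section StieltjesEvolution.
Variables (R : realType) (beta alpha : R) (V : {poly R}).
Variables (rho0 : probability (measurableTypeR R) R)
  (rho : R -> probability (measurableTypeR R) R).
Hypotheses (beta_ge0 : 0 <= beta) (alpha_gt0 : 0 < alpha)
  (V_convex : forall x : R, alpha <= V^`()^`().[x])
  (rho0_compact : compactly_supported rho0)
  (sol : mckean_vlasov_solution beta V rho0 rho).
Implicit Types (x y t s r : R) (z w : R[i]) (b : bool) (g : R -> R[i]).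

(** The derivative of the Stieltjes transform in z, written as an integral. *)
Definition stieltjes2 (mu : probability (measurableTypeR R) R) z : R[i] :=
  Cint mu (fun x => cauchy z x ^+ 2).

(** The z-derivative of (beta / 4) U^2 plus the transform of V' rho, that is, the right-hand side of
    the equation for U with V' U + T not yet separated into transport and source. *)
Definition stieltjes_rate (mu : probability (measurableTypeR R) R) z : R[i] :=
  (beta / 2)%:C * (stieltjes mu z * stieltjes2 mu z)
  + Cint mu (fun x => cauchy z x ^+ 2 * (V^`().[x])%:C).

Lemma cpart_Cint_continuous b g : ctame g ->
  continuous (fun s => cpart b (Cint (rho (Num.max s 0)) g)).
Proof.
move=> tg.
rewrite (_ : (fun s => _) = (fun s => \int[rho (Num.max s 0)]_x cpart b (g x))).
  apply: (tame_time_continuous beta_ge0 alpha_gt0 V_convex rho0_compact sol).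
  exact: ctame_cpart.
by apply/funext => s; rewrite cpart_Cint.
Qed.

Lemma stieltjes_rate_continuous b z : complex.Im z != 0 ->
  continuous (fun s => cpart b (stieltjes_rate (rho (Num.max s 0)) z)).
Proof.
move=> z0; have t1 := ctame_cauchy z0; have t2 := ctameX 2 t1.
have t3 := ctameM t2 (ctame_real (tame_poly V^`())).
have c1 b' : continuous (fun s => cpart b' (stieltjes (rho (Num.max s 0)) z)).
  exact: (@cpart_Cint_continuous b' _ t1).
have c2 b' := @cpart_Cint_continuous b' _ t2; have c3 b' := @cpart_Cint_continuous b' _ t3.
have c4 : continuous (fun s => cpart b (stieltjes (rho (Num.max s 0)) z
    * stieltjes2 (rho (Num.max s 0)) z)).
  pose p r := stieltjes (rho (Num.max r 0)) z; pose q r := stieltjes2 (rho (Num.max r 0)) z.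
  case: b; rewrite /cpart.
    rewrite (_ : (fun s => _) = fun s => cpart true (p s) * cpart true (q s)
      - cpart false (p s) * cpart false (q s)); last by apply/funext => s; rewrite cReM.
    exact: (continuous_subr (continuous_mulr (c1 true) (c2 true)) (continuous_mulr (c1 false) (c2 false))).
  rewrite (_ : (fun s => _) = fun s => cpart true (p s) * cpart false (q s)
    + cpart false (p s) * cpart true (q s)); last by apply/funext => s; rewrite cImM.
  exact: (continuous_addr (continuous_mulr (c1 true) (c2 false)) (continuous_mulr (c1 false) (c2 true))).
rewrite (_ : (fun s => _) = fun s => (beta / 2) * cpart b (stieltjes (rho (Num.max s 0)) z
    * stieltjes2 (rho (Num.max s 0)) z) + cpart b (Cint (rho (Num.max s 0))
      (fun x => cauchy z x ^+ 2 * (V^`().[x])%:C))); last first.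
  by apply/funext => s; rewrite cpartD cpart_realM.
have ck : continuous (fun _ : R => beta / 2) by move=> s; exact: cst_continuous.
exact: (continuous_addr (continuous_mulr ck c4) (c3 b)).
Qed.

(** The weak equation tested against the real or imaginary part of a Cauchy kernel. Times enter as
    [Num.max s 0] to make the integrand continuous on R, hence integrable and fit for the
    fundamental theorem of calculus. *)
Lemma stieltjes_weak b z t : complex.Im z != 0 -> 0 <= t ->
  cpart b (stieltjes (rho t) z) = cpart b (stieltjes (rho 0) z) +
  \int[lebesgue_measure]_(s in `[0, t]) cpart b (stieltjes_rate (rho (Num.max s 0)) z).
Proof.
move=> z0 t0; rewrite !stieltjesE !cpart_Cint.
have mom s (s0 : 0 <= s) := rho_moments beta_ge0 alpha_gt0 V_convex rho0_compact sol s0.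
have tc := ctame_cauchy z0; have tc2 := ctameX 2 tc.
have two : (2 : R[i]) = 2%:C by rewrite rmorph_nat.
pose B := `|complex.Im z|^-1; have B0 : 0 <= B by rewrite invr_ge0.
have cB x : cabs (cauchy z x) <= B := cabs_cauchy_le x z0.
have cBn n x : cabs (cauchy z x ^+ n) <= B ^+ n.
  by rewrite cabsX lerXn2r ?nnegrE ?cabs_ge0.
pose F x := cpart b (cauchy z x); pose F1 x := cpart b (- cauchy z x ^+ 2).
pose F2 x := cpart b (2 * cauchy z x ^+ 3).
have dF x : is_derive x 1 F (F1 x) := (is_derive_cpart_cauchy b x z0).1.
have dF1 x : is_derive x 1 F1 (F2 x) := (is_derive_cpart_cauchy b x z0).2.
have tF : forall x, [/\ `|F x| <= B + B ^+ 2 + 2 * B ^+ 3,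
    `|F1 x| <= B + B ^+ 2 + 2 * B ^+ 3 & `|F2 x| <= B + B ^+ 2 + 2 * B ^+ 3].
  have B2 : 0 <= B ^+ 2 by exact: exprn_ge0.
  have B3 : 0 <= B ^+ 3 by exact: exprn_ge0.
  move=> x; have h1 := cB x; have h2 := cBn 2%N x; have h3 := cBn 3%N x.
  have := cpart_le b (2 * cauchy z x ^+ 3).
  have -> : cabs (2 * cauchy z x ^+ 3) = 2 * cabs (cauchy z x ^+ 3).
    by rewrite cabsM two cabs_real ger0_norm.
  split; [apply: le_trans (cpart_le _ _) _|apply: le_trans (cpart_le _ _) _|]; rewrite ?cabsN; lra.
have eD x y : difference_quotient F1 x y
    = cpart b (cauchy z x * cauchy z y ^+ 2 + cauchy z x ^+ 2 * cauchy z y).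
  exact: difference_quotient_cauchy.
have tD x : ctame (fun y => cauchy z x * cauchy z y ^+ 2 + cauchy z x ^+ 2 * cauchy z y).
  by apply: ctameD; apply: ctameZ.
have eI s x : 0 <= s -> \int[rho s]_y difference_quotient F1 x y
    = cpart b (stieltjes2 (rho s) z * cauchy z x + stieltjes (rho s) z * cauchy z x ^+ 2).
  move=> s0; have := cpart_Cint b (rho s) (fun y => cauchy z x * cauchy z y ^+ 2 + cauchy z x ^+ 2 * cauchy z y).
  rewrite (CintD (mom s s0)); try exact: ctameZ.
  rewrite !(CintZ (mom s s0)) // => h.
  under eq_Rintegral do rewrite eD.
  by rewrite -h mulrC [X in _ + X]mulrC.
have tI s : ctame (fun x => stieltjes2 (rho s) z * cauchy z x + stieltjes (rho s) z * cauchy z x ^+ 2).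
  by apply: ctameD; apply: ctameZ.
have eII s : 0 <= s -> \int[rho s]_x \int[rho s]_y difference_quotient F1 x y
    = cpart b (2 * (stieltjes (rho s) z * stieltjes2 (rho s) z)).
  move=> s0; under eq_Rintegral do rewrite eI //.
  rewrite -cpart_Cint (CintD (mom s s0)); try exact: ctameZ.
  by rewrite !(CintZ (mom s s0)) //; congr cpart; rewrite /stieltjes2 stieltjesE; ring.
have ea s : 0 <= s -> beta / 4%:R * (\int[rho s]_x \int[rho s]_y difference_quotient F1 x y)
     - \int[rho s]_x (F1 x * V^`().[x]) = cpart b (stieltjes_rate (rho s) z).
  move=> s0; rewrite eII // /stieltjes_rate cpartD cpart_realM; congr (_ + _).
    by rewrite two cpart_realM; field.
  rewrite cpart_Cint -(tame_intN (mom s s0)).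
    apply: eq_Rintegral => x _; rewrite /F1 cpartN mulNr opprK.
    by rewrite [in RHS]mulrC cpart_realM mulrC.
  apply: tameM; last exact: tame_poly.
  have t1 := ctame_cpart b tc2.
  have := tameN t1; congr tame; apply/funext => x; by rewrite /F1 cpartN.
have crate := @stieltjes_rate_continuous b z z0.
have irate : (@lebesgue_measure R).-integrable `[0, t]
    (EFin \o (fun s => cpart b (stieltjes_rate (rho (Num.max s 0)) z))).
  apply: continuous_compact_integrable; first exact: segment_compact.
  exact: continuous_subspaceT.
have eqr s : s \in `[0, t]%classic -> beta / 4%:R * (\int[rho s]_x \int[rho s]_y difference_quotient F1 x y)
     - \int[rho s]_x (F1 x * V^`().[x]) = cpart b (stieltjes_rate (rho (Num.max s 0)) z).
  by rewrite inE /= in_itv /= => /andP[s0 _]; rewrite ea // max_l.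
have mI : measurable (`[0, t]%classic : set (measurableTypeR R)) by exact: measurable_itv.
rewrite (weak_equation_bounded beta_ge0 alpha_gt0 V_convex rho0_compact sol
  (cpart_cauchy_elementary b z0) dF dF1 tF) //.
- by congr (_ + _); apply: eq_Rintegral => s; exact: eqr.
- move=> s x s0; apply: (tame_integrable (mom s s0)).
  rewrite (_ : difference_quotient F1 x = fun y => cpart b
    (cauchy z x * cauchy z y ^+ 2 + cauchy z x ^+ 2 * cauchy z y)); last exact/funext.
  exact: ctame_cpart (tD x).
- move=> s s0; apply: (tame_integrable (mom s s0)).
  rewrite (_ : (fun x => _) = fun x => cpart b (stieltjes2 (rho s) z * cauchy z x
    + stieltjes (rho s) z * cauchy z x ^+ 2)); first exact: ctame_cpart (tI s).
  by apply/funext => x; exact: eI.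
- apply: (@eq_integrable _ _ _ _ _ mI _ _ _ irate) => s sI; congr EFin.
  exact: (esym (eqr s sI)).
Qed.

Lemma is_derive_stieltjes b z t : complex.Im z != 0 -> 0 < t ->
  is_derive t 1 (fun t => cpart b (stieltjes (rho t) z)) (cpart b (stieltjes_rate (rho t) z)).
Proof.
move=> z0 t0; pose a s := cpart b (stieltjes_rate (rho (Num.max s 0)) z).
have ca : continuous a by exact: stieltjes_rate_continuous.
have ia : (@lebesgue_measure R).-integrable `[0, t + 1] (EFin \o a).
  by apply: continuous_compact_integrable; [exact: segment_compact|exact: continuous_subspaceT].
have tt1 : t < t + 1 by rewrite ltrDl.
have [dg eg] := continuous_FTC1_closed tt1 ia t0 (ca t).
have e : \near t, cpart b (stieltjes (rho 0) z) + \int[lebesgue_measure]_(s in `[0, t]) a s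
    = cpart b (stieltjes (rho t) z).
  near=> s; rewrite -stieltjes_weak //; apply: ltW; near: s; exact: lt_nbhsr.
apply: (near_eq_is_derive e).
have -> : cpart b (stieltjes_rate (rho t) z) = 0 + a t by rewrite add0r /a max_l // ltW.
apply: (@is_deriveD _ _ _ (cst _)); apply: DeriveDef; first exact: dg.
by rewrite -derive1E eg.
Unshelve. all: by end_near.
Qed.

End StieltjesEvolution.

(** * Real polynomials at complex points, energy of the Cauchy kernel, and the source term *)

Section ComplexPolynomial.
Variable R : realType.
Implicit Types (p : {poly R}) (z w : R[i]) (x : R).

Definition cpoly p z : R[i] := (map_poly (real_complex R) p).[z].

Lemma cpoly0 z : cpoly 0 z = 0.
Proof. by rewrite /cpoly rmorph0 horner0. Qed.

Lemma cpolyMXC p (c : R) z : cpoly (p * 'X + c%:P) z = cpoly p z * z + c%:C.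
Proof. by rewrite /cpoly rmorphD rmorphM /= map_polyX map_polyC hornerMXaddC. Qed.

Lemma cpolyD p q z : cpoly (p + q) z = cpoly p z + cpoly q z.
Proof. by rewrite /cpoly rmorphD hornerD. Qed.

Lemma cpolyMX p z : cpoly (p * 'X) z = cpoly p z * z.
Proof. by rewrite /cpoly rmorphM /= map_polyX hornerMX. Qed.

(** The coefficients are real, so the imaginary part is O(|Im z|), by induction through Im(p z) = Re
    p Im z + Im p Re z. This is what prevents V' from driving characteristics into the real axis. *)
Lemma cpoly_bounds p (M : R) : 0 <= M -> exists2 C : R, 0 <= C &
  forall z w, cabs z <= M -> cabs w <= M ->
  [/\ cabs (cpoly p z) <= C, `|complex.Im (cpoly p z)| <= C * `|complex.Im z| &
      cabs (cpoly p z - cpoly p w) <= C * cabs (z - w)].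
Proof.
move=> M0; elim/poly_ind: p => [|p c [C C0 hC]].
  by exists 0 => // z w _ _; rewrite !cpoly0 subrr cabs0 !mul0r /= normr0.
exists (C * M + `|c| + C); first by rewrite !addr_ge0 // mulr_ge0.
have CM0 : 0 <= C * M by exact: mulr_ge0.
move=> z w zM wM; rewrite !cpolyMXC; have [h1 h2 h3] := hC z w zM wM.
have z0 := cabs_ge0 z; have z0' := cabs_ge0 (cpoly p z); split.
- apply: (le_trans (cabsD _ _)); rewrite cabsM cabs_real.
  have := ler_pM z0' z0 h1 zM; lra.
- rewrite cImD cImM addr0; apply: (le_trans (ler_normD _ _)); rewrite !normrM.
  have a1 : `|complex.Re (cpoly p z)| * `|complex.Im z| <= C * `|complex.Im z|.
    by rewrite ler_wpM2r // (le_trans (Re_le_cabs _)).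
  have a2 : `|complex.Im (cpoly p z)| * `|complex.Re z| <= C * `|complex.Im z| * M.
    by apply: ler_pM => //; apply: le_trans zM; exact: Re_le_cabs.
  have a3 : 0 <= `|c| * `|complex.Im z| by rewrite mulr_ge0.
  by rewrite !mulrDl; lra.
- rewrite (_ : _ - _ = (cpoly p z - cpoly p w) * z + cpoly p w * (z - w)); last by ring.
  apply: (le_trans (cabsD _ _)); rewrite !cabsM.
  have [h4 _ _] := hC w z wM zM; have zw0 := cabs_ge0 (z - w).
  have a1 : cabs (cpoly p z - cpoly p w) * cabs z <= C * cabs (z - w) * M.
    by apply: ler_pM => //; exact: cabs_ge0.
  have a2 : cabs (cpoly p w) * cabs (z - w) <= C * cabs (z - w) by rewrite ler_wpM2r.
  have a3 : 0 <= `|c| * cabs (z - w) by rewrite mulr_ge0.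
  by rewrite !mulrDl; lra.
Qed.

(* Second-order Taylor expansion at z; the remainder is (x - z)^2 times a polynomial in x
   whose coefficients are real polynomials evaluated at z. *)
Lemma cpoly_taylor p : exists (m : nat) (r : nat -> {poly R}), forall z x,
  (p.[x])%:C = cpoly p z + cpoly p^`() z * (x%:C - z)
    + (x%:C - z) ^+ 2 * \sum_(i < m) cpoly (r i) z * (x ^+ i)%:C.
Proof.
elim/poly_ind: p => [|p c [m [r h]]].
  exists 0%N, (fun=> 0) => z x; rewrite deriv0 !cpoly0 horner0 big_ord0; by ring.
exists m.+1, (fun i => if i is j.+1 then r j else p^`()) => z x.
rewrite hornerMXaddC derivMXaddC cpolyD cpolyMX cpolyMXC big_ord_recl /= expr0.
have -> : \sum_(i < m) cpoly (r i) z * (x ^+ i.+1)%:C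
    = x%:C * \sum_(i < m) cpoly (r i) z * (x ^+ i)%:C.
  by rewrite mulr_sumr; apply: eq_bigr => i _; rewrite exprS rmorphM mulrCA.
rewrite rmorphD rmorphM /= (h z x); set s := \sum_(i < m) _; rewrite rmorph1.
by set u := x%:C; set v := cpoly _^`() _; ring.
Qed.

End ComplexPolynomial.

Section CauchyEnergy.
Variables (R : realType) (mu : probability (measurableTypeR R) R).
Hypothesis mom : has_moments mu.
Implicit Types (x y : R) (z w : R[i]) (g : R -> R[i]).

Lemma tame_cabs g : ctame g -> tame (fun x => cabs (g x)).
Proof.
move=> [[cr [C [k [C0 hC]]]] [ci [D [l [D0 hD]]]]].
have [_ [E [m [E0 hE]]]] : tame (fun x => `|complex.Re (g x)| + `|complex.Im (g x)|).
  by apply: tameD; apply: tame_norm; split=> //; [exists C, k|exists D, l].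
split; last first.
  exists E, m; split=> // x; apply: le_trans (hE x).
  rewrite ger0_norm ?cabs_ge0 //; apply: (le_trans (cabs_le_ReIm _)); exact: ler_norm.
have -> : (fun x => cabs (g x))
    = Num.sqrt \o (fun x => complex.Re (g x) * complex.Re (g x) + complex.Im (g x) * complex.Im (g x)).
  apply/funext => x /=; rewrite -!expr2 -cabs_sqr sqrtr_sqr ger0_norm //; exact: cabs_ge0.
have c2 := continuous_addr (continuous_mulr cr cr) (continuous_mulr ci ci).
by move=> x; apply: continuous_comp; [exact: c2|exact: sqrt_continuous].
Qed.

(** |I|^2 is the real part of the integral of conj(I) g, hence at most |I| times the integral of
    |g|. *)
Lemma cabs_Cint_le g : ctame g -> cabs (Cint mu g) <= \int[mu]_x cabs (g x).
Proof.
move=> tg; set I := Cint mu g; have [I0|I0] := eqVneq I 0.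
  by rewrite I0 cabs0; apply: Rintegral_ge0 => x _; exact: cabs_ge0.
have Ip := cabs_gt0 I0.
rewrite -(ler_pM2l Ip) -expr2 cabs_sqr.
have -> : complex.Re I ^+ 2 + complex.Im I ^+ 2 = cpart true (I^* * I).
  by rewrite /cpart cReM; case: (I) => a b /=; ring.
rewrite /I -(CintZ mom) // cpart_Cint -/I.
have tc : tame (fun x => cabs (g x)) := tame_cabs tg.
rewrite -(tame_intZ mom) //; apply: (tame_int_le mom).
- exact: (ctame_cpart true (ctameZ _ tg)).
- exact: tameZ.
- move=> x; apply: (le_trans (ler_norm _)); apply: (le_trans (cpart_le true _)).
  rewrite cabsM ler_wpM2r ?cabs_ge0 // /cabs; case: (I) => a b /=; by rewrite sqrrN.
Qed.

Lemma jensen_sqr (h : R -> R) : tame h -> (\int[mu]_x h x) ^+ 2 <= \int[mu]_x h x ^+ 2.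
Proof.
move=> th; set m := \int[mu]_x h x.
have th2 : tame (fun x => h x ^+ 2) by exact: tameM.
have tmh : tame (fun x => 2 * m * h x) by exact: tameZ.
have : 0 <= \int[mu]_x (h x - m) ^+ 2 by apply: Rintegral_ge0 => x _; exact: sqr_ge0.
have -> : \int[mu]_x (h x - m) ^+ 2 = \int[mu]_x (h x ^+ 2 - 2 * m * h x + m ^+ 2).
  by apply: eq_Rintegral => x _; ring.
rewrite (tame_intD mom) ?tame_int_cst; [|exact: tameB|exact: tame_cst].
rewrite (tame_intB mom) // (tame_intZ mom) // -/m; lra.
Qed.

(** The quantity called N in the overview. *)
Definition energy z : R := \int[mu]_x cabs (cauchy z x) ^+ 2.

Lemma energy_ge0 z : 0 <= energy z.
Proof. by apply: Rintegral_ge0 => x _; exact: sqr_ge0. Qed.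

Lemma Im_cauchy z x : complex.Im (cauchy z x) = complex.Im z * cabs (cauchy z x) ^+ 2.
Proof.
rewrite cabs_sqr cauchyE /= /cauchy_re /cauchy_im.
set X := x - _; set b := complex.Im z; have [->|b0] := eqVneq b 0; first by rewrite !mul0r.
by have := lt0r_neq0 (sqr_add_gt0 X b0) => n0; field.
Qed.

Lemma Im_stieltjes z : complex.Im z != 0 -> complex.Im (stieltjes mu z) = complex.Im z * energy z.
Proof.
move=> z0; rewrite stieltjesE /= -(tame_intZ mom).
  by apply: eq_Rintegral => x _; exact: Im_cauchy.
have tc := tame_cabs (ctame_cauchy z0).
exact: tameM.
Qed.

Lemma cabs_stieltjes_sqr z : complex.Im z != 0 -> cabs (stieltjes mu z) ^+ 2 <= energy z.
Proof.
move=> z0; have tc := ctame_cauchy z0; have tc' := tame_cabs tc.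
apply: le_trans (jensen_sqr tc'); rewrite lerXn2r ?nnegrE ?cabs_ge0 //.
  by apply: Rintegral_ge0 => x _; exact: cabs_ge0.
exact: cabs_Cint_le.
Qed.

Lemma Im_stieltjes_ge0 z : 0 < complex.Im z -> 0 <= complex.Im (stieltjes mu z).
Proof.
move=> z0; rewrite Im_stieltjes ?gt_eqF // mulr_ge0 ?energy_ge0 //; exact: ltW.
Qed.

End CauchyEnergy.

Section Source.
Variables (R : realType) (beta alpha : R) (V : {poly R}).
Variables (rho0 : probability (measurableTypeR R) R)
  (rho : R -> probability (measurableTypeR R) R).
Hypotheses (beta_ge0 : 0 <= beta) (alpha_gt0 : 0 < alpha)
  (V_convex : forall x : R, alpha <= V^`()^`().[x])
  (rho0_compact : compactly_supported rho0)
  (sol : mckean_vlasov_solution beta V rho0 rho).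
Implicit Types (x y t s r : R) (z w : R[i]) (b : bool) (g : R -> R[i]).

(* The part of the evolution of [stieltjes] that is not transport. *)
Definition source (mu : probability (measurableTypeR R) R) z : R[i] :=
  Cint mu (fun x => cauchy z x ^+ 2 * (V^`().[x])%:C) - cpoly V^`() z * stieltjes2 mu z.

Lemma stieltjes_rateE mu z : stieltjes_rate beta V mu z =
  ((beta / 2)%:C * stieltjes mu z + cpoly V^`() z) * stieltjes2 mu z + source mu z.
Proof. by rewrite /stieltjes_rate /source; ring. Qed.

(** Dividing the expansion V'(x) = V'(z) + V''(z) (x - z) + (x - z)^2 r(x) by (x - z)^2 and
    integrating, the first term is the transport, the second gives V''(z) U, and the last is a
    combination of moments. So the source is no more singular near the axis than U itself. *)
Lemma sourceE : exists (m : nat) (r : nat -> {poly R}),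
  forall (mu : probability (measurableTypeR R) R) z, has_moments mu -> complex.Im z != 0 ->
  source mu z = cpoly V^`()^`() z * stieltjes mu z
    + \sum_(i < m) cpoly (r i) z * (\int[mu]_x x ^+ i)%:C.
Proof.
have [m [r h]] := cpoly_taylor V^`(); exists m, r => mu z mom z0.
have tc := ctame_cauchy z0; have tc2 := ctameX 2 tc.
have tx (i : nat) : ctame (fun x : R => (x ^+ i)%:C).
  apply: ctame_real; rewrite (_ : (fun x => _) = horner 'X^i); first exact: tame_poly.
  by apply/funext => x; rewrite hornerXn.
have tF (i : nat) : ctame (fun x : R => cpoly (r i) z * (x ^+ i)%:C) by exact: ctameZ.
rewrite /source.
have -> : Cint mu (fun x => cauchy z x ^+ 2 * (V^`().[x])%:C) =
    Cint mu (fun x => (cpoly V^`() z * cauchy z x ^+ 2 + cpoly V^`()^`() z * cauchy z x)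
      + \sum_(i < m) cpoly (r i) z * (x ^+ i)%:C).
  apply: eq_Cint => x; rewrite (h z x) /cauchy; set s := \sum_(i < m) _.
  by have n0 := off_axis_neq0 x z0; field.
rewrite (CintD mom); [|by apply: ctameD; exact: ctameZ|exact: (ctame_sum m tF)].
rewrite (CintD mom); try exact: ctameZ.
rewrite !(CintZ mom) // (Cint_sum mom m tF) -stieltjesE -/(stieltjes2 mu z).
rewrite [in X in _ + X - _](eq_bigr (fun i : 'I_m => cpoly (r i) z * (\int[mu]_x x ^+ i)%:C)).
  by ring.
by move=> i _; rewrite (CintZ mom) // Cint_real.
Qed.

Lemma cabs_sum (m : nat) (F : 'I_m -> R[i]) : cabs (\sum_i F i) <= \sum_i cabs (F i).
Proof.
elim/big_ind2: _ => [|u a v b ha hb|//]; first by rewrite cabs0.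
by apply: (le_trans (cabsD _ _)); exact: lerD.
Qed.

Lemma moment_power_bound T (m : nat) : 0 <= T -> exists2 C : R, 0 <= C &
  forall t (i : 'I_m), 0 <= t <= T -> `|\int[rho t]_x x ^+ i| <= C.
Proof.
move=> T0; have [C C0 hC] := moment_le beta_ge0 alpha_gt0 V_convex rho0_compact sol T0 (tame_wt R m).
exists C => // t i tT; have t0 : 0 <= t by case/andP: tT.
apply: le_trans (hC t tT).
have mom := rho_moments beta_ge0 alpha_gt0 V_convex rho0_compact sol t0.
apply: (tame_int_norm mom).
- rewrite (_ : (fun x => _) = horner 'X^i); first exact: tame_poly.
  by apply/funext => x; rewrite hornerXn.
- exact/tame_norm/tame_wt.
- move=> x; rewrite (ger0_norm (wtX_ge0 _ _)) normrX pow_le_wt //.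
  by rewrite mul2n -addnn (leq_trans (ltnW (ltn_ord i))) // leq_addr.
Qed.

(** For the imaginary part the delicate product is Im V''(z) Re U, of size Im z |U|. It is at most
    Im z (|U|^2 + 1), and |U|^2 <= [energy] turns this into Im U + Im z. The difference estimate
    splits V''(z) U - V''(w) W in the usual way. *)
Lemma source_bounds T (M : R) : 0 <= T -> 0 <= M -> exists2 C : R, 0 <= C &
  forall t z w, 0 <= t <= T -> 0 < complex.Im z -> 0 < complex.Im w ->
    cabs z <= M -> cabs w <= M ->
  [/\ cabs (source (rho t) z) <= C * (cabs (stieltjes (rho t) z) + 1),
      `|complex.Im (source (rho t) z)|
        <= C * (complex.Im (stieltjes (rho t) z) + complex.Im z) &
      cabs (source (rho t) z - source (rho t) w) <= C *
        (cabs (stieltjes (rho t) z - stieltjes (rho t) w)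
         + (cabs (stieltjes (rho t) w) + 1) * cabs (z - w))].
Proof.
move=> T0 M0; have [m [r hs]] := sourceE.
have [A A0 hA] := cpoly_bounds V^`()^`() M0.
have [B B0 hB] := moment_power_bound m T0.
have [D D0 hD] : exists2 D : R, 0 <= D & forall (i : 'I_m) z w, cabs z <= M -> cabs w <= M ->
  [/\ cabs (cpoly (r i) z) <= D, `|complex.Im (cpoly (r i) z)| <= D * `|complex.Im z| &
      cabs (cpoly (r i) z - cpoly (r i) w) <= D * cabs (z - w)].
  have /fin_all_exists2 [d d0 hd] : forall i : 'I_m, exists2 C : R, 0 <= C & forall z w, cabs z <= M -> cabs w <= M ->
    [/\ cabs (cpoly (r i) z) <= C, `|complex.Im (cpoly (r i) z)| <= C * `|complex.Im z| &
      cabs (cpoly (r i) z - cpoly (r i) w) <= C * cabs (z - w)].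
    by move=> i; exact: cpoly_bounds.
  exists (\sum_i d i); first by apply: sumr_ge0.
  move=> i z w zM wM; have [h1 h2 h3] := hd i z w zM wM.
  have dD : d i <= \sum_i d i by rewrite (bigD1 i) //= lerDl sumr_ge0.
  split; [exact: le_trans h1 dD|apply: le_trans h2 _|apply: le_trans h3 _];
    by rewrite ler_wpM2r ?cabs_ge0.
pose E := m%:R * (D * B); have E0 : 0 <= E by rewrite !mulr_ge0.
have sumE (F : 'I_m -> R) (k : R) : (forall i, F i <= D * B * k) -> \sum_i F i <= E * k.
  move=> hF; apply: (@le_trans _ _ (\sum_(i < m) D * B * k)); first exact: ler_sum.
  by rewrite sumr_const card_ord -mulr_natl mulrA.
exists (2 * A + E); first by rewrite addr_ge0 // mulr_ge0.
move=> t z w tT z0 w0 zM wM; have t0 : 0 <= t by case/andP: tT.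
have mom := rho_moments beta_ge0 alpha_gt0 V_convex rho0_compact sol t0.
have z0' : complex.Im z != 0 by rewrite gt_eqF.
have w0' : complex.Im w != 0 by rewrite gt_eqF.
rewrite !hs //; set U := stieltjes (rho t) z; set W := stieltjes (rho t) w.
have [a1 a2 a3] := hA z w zM wM; have [a4 _ _] := hA w z wM zM.
have U0 := cabs_ge0 U; have W0 := cabs_ge0 W; have zw0 := cabs_ge0 (z - w).
split.
- apply: (le_trans (cabsD _ _)); rewrite cabsM.
  have h1 : cabs (cpoly V^`()^`() z) * cabs U <= A * cabs U by rewrite ler_wpM2r.
  have h2 : cabs (\sum_(i < m) cpoly (r i) z * (\int[rho t]_x x ^+ i)%:C) <= E * 1.
    apply: (le_trans (cabs_sum _)); apply: sumE => i; rewrite cabsM cabs_real mulr1.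
    have [h _ _] := hD i z w zM wM; apply: ler_pM => //; first exact: cabs_ge0.
    exact: hB.
  have h3 : 0 <= A * cabs U by rewrite mulr_ge0.
  have h4 : 0 <= E * cabs U by rewrite mulr_ge0.
  by move: h2; rewrite mulr1 mulrDr mulr1 mulrDl; lra.
- rewrite cImD; apply: (le_trans (ler_normD _ _)).
  have yU : complex.Im z * cabs U <= complex.Im U + complex.Im z.
    have y0 := ltW z0; have e := Im_stieltjes mom z0'; rewrite -/U in e.
    have q := cabs_stieltjes_sqr mom z0'; rewrite -/U in q.
    have := ler_wpM2l y0 q; rewrite -e.
    have : complex.Im z * cabs U <= complex.Im z * (cabs U ^+ 2 + 1).
      rewrite ler_wpM2l //; have := sqr_ge0 (cabs U - 2^-1); nra.
    rewrite mulrDr mulr1; lra.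
  have ImU0 : 0 <= complex.Im U by exact: Im_stieltjes_ge0.
  have h1 : `|complex.Im (cpoly V^`()^`() z * U)| <= 2 * A * (complex.Im U + complex.Im z).
    rewrite cImM; apply: (le_trans (ler_normD _ _)); rewrite !normrM (ger0_norm ImU0).
    have b1 : `|complex.Re (cpoly V^`()^`() z)| * complex.Im U <= A * complex.Im U.
      by rewrite ler_wpM2r // (le_trans (Re_le_cabs _)).
    have b2 : `|complex.Im (cpoly V^`()^`() z)| * `|complex.Re U| <= A * `|complex.Im z| * cabs U.
      by apply: ler_pM => //; exact: Re_le_cabs.
    rewrite (ger0_norm (ltW z0)) -mulrA in b2.
    have := ler_wpM2l A0 yU; have := mulr_ge0 A0 (ltW z0); lra.
  have h2 : `|complex.Im (\sum_(i < m) cpoly (r i) z * (\int[rho t]_x x ^+ i)%:C)|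
      <= E * complex.Im z.
    have -> : complex.Im (\sum_(i < m) cpoly (r i) z * (\int[rho t]_x x ^+ i)%:C)
        = \sum_(i < m) complex.Im (cpoly (r i) z) * \int[rho t]_x x ^+ i.
      elim/big_ind2: _ => [//|u a v b <- <-|i _]; first by rewrite cImD.
      by rewrite cImM /= mulr0 add0r.
    apply: (le_trans (ler_norm_sum _ _ _)); apply: sumE => i; rewrite normrM.
    have [_ h _] := hD i z w zM wM; rewrite (ger0_norm (ltW z0)) in h.
    rewrite mulrAC; apply: ler_pM => //; exact: hB.
  have : 0 <= E * complex.Im U by rewrite mulr_ge0.
  rewrite (_ : (2 * A + E) * _ = 2 * A * (complex.Im U + complex.Im z)
    + E * complex.Im U + E * complex.Im z); last by ring.
  lra.
- rewrite (_ : _ - _ = cpoly V^`()^`() z * (U - W) + (cpoly V^`()^`() z - cpoly V^`()^`() w) * W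
    + (\sum_(i < m) cpoly (r i) z * (\int[rho t]_x x ^+ i)%:C
       - \sum_(i < m) cpoly (r i) w * (\int[rho t]_x x ^+ i)%:C)); last by ring.
  have UW0 := cabs_ge0 (U - W).
  apply: (le_trans (cabsD _ _)); apply: (le_trans (lerD (cabsD _ _) (lexx _))); rewrite !cabsM.
  have h1 : cabs (cpoly V^`()^`() z) * cabs (U - W) <= A * cabs (U - W) by rewrite ler_wpM2r.
  have h2 : cabs (cpoly V^`()^`() z - cpoly V^`()^`() w) * cabs W <= A * cabs (z - w) * cabs W.
    by rewrite ler_wpM2r.
  have h3 : cabs (\sum_(i < m) cpoly (r i) z * (\int[rho t]_x x ^+ i)%:C
       - \sum_(i < m) cpoly (r i) w * (\int[rho t]_x x ^+ i)%:C) <= E * cabs (z - w).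
    rewrite -sumrB; apply: (le_trans (cabs_sum _)); apply: sumE => i.
    rewrite -mulrBl cabsM cabs_real mulrAC; have [_ _ h] := hD i z w zM wM.
    apply: ler_pM => //; [exact: cabs_ge0|exact: hB].
  have p1 := mulr_ge0 A0 UW0; have p2 := mulr_ge0 E0 UW0.
  have p3 := mulr_ge0 A0 zw0; have p4 := mulr_ge0 (mulr_ge0 A0 zw0) W0.
  have p5 := mulr_ge0 (mulr_ge0 E0 zw0) W0.
  rewrite (_ : (2 * A + E) * _ = 2 * (A * cabs (U - W)) + E * cabs (U - W)
     + 2 * (A * cabs (z - w) * cabs W) + 2 * (A * cabs (z - w))
     + E * cabs (z - w) * cabs W + E * cabs (z - w)); last by ring.
  lra.
Qed.

End Source.

(** * The Stieltjes transform along a moving point *)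

Section Characteristics.
Variables (R : realType) (beta alpha : R) (V : {poly R}).
Variables (rho0 : probability (measurableTypeR R) R)
  (rho : R -> probability (measurableTypeR R) R).
Hypotheses (beta_ge0 : 0 <= beta) (alpha_gt0 : 0 < alpha)
  (V_convex : forall x : R, alpha <= V^`()^`().[x])
  (rho0_compact : compactly_supported rho0)
  (sol : mckean_vlasov_solution beta V rho0 rho).
Implicit Types (x y t s r T : R) (z w : R[i]) (b : bool) (g : R -> R[i]) (X Y p : R -> R).

(** The product rule at a zero of the first factor: mere continuity of p at s suffices. *)
Lemma is_derive_increment_mul X p s (dX : R) : is_derive s 1 X dX -> {for s, continuous p} ->
  is_derive s 1 (fun r => (X r - X s) * p r) (dX * p s).
Proof.
move=> hX cp.
have [dXs eX] := hX.
have cvX : h^-1 *: ((X \o shift s) (h *: 1) - X s) @[h --> (0 : R)^'] --> dX.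
  by rewrite -eX; exact: dXs.
have cvp : (p \o shift s) (h *: (1 : R)) @[h --> (0 : R)^'] --> p s.
  apply/cvgrPdist_lt => e e0; have [d /= d0 hd] := near_continuous cp e0.
  near=> h; rewrite /= /GRing.scale /= mulr1; apply: hd => /=.
  rewrite opprD addrCA subrr addr0 normrN.
  by near: h; apply: dnbhs0_lt.
suff h : h^-1 *: (((fun r => (X r - X s) * p r) \o shift s) (h *: 1) - (X s - X s) * p s)
    @[h --> (0 : R)^'] --> dX * p s.
  by apply: DeriveDef; [apply/cvg_ex; eexists; exact: h|exact/cvg_lim].
rewrite (_ : (fun h => _) = (fun h => (h^-1 *: ((X \o shift s) (h *: 1) - X s))
    * (p \o shift s) (h *: 1))); first exact: cvgM cvX cvp.
by apply/funext => h; rewrite /= subrr mul0r subr0 /GRing.scale /= mulrA.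
Unshelve. all: by end_near.
Qed.

Lemma cabs_Cint_bound (mu : probability (measurableTypeR R) R) g (B : R) :
  has_moments mu -> ctame g -> (forall x, cabs (g x) <= B) -> cabs (Cint mu g) <= B.
Proof.
move=> mom tg hB; apply: (le_trans (cabs_Cint_le mom tg)).
rewrite -(tame_int_cst mu B); apply: (tame_int_le mom) => //; [exact: tame_cabs|exact: tame_cst].
Qed.

Lemma stieltjesB (mu : probability (measurableTypeR R) R) z w : has_moments mu ->
  complex.Im z != 0 -> complex.Im w != 0 ->
  stieltjes mu z - stieltjes mu w = (z - w) * Cint mu (fun x => cauchy z x * cauchy w x).
Proof.
move=> mom z0 w0; have tz := ctame_cauchy z0; have tw := ctame_cauchy w0.
rewrite !stieltjesE -(CintB mom) // -(CintZ mom); last exact: ctameM.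
by apply: eq_Cint => x; exact: cauchy_resolvent.
Qed.

(** A chain rule that avoids joint differentiability. By the resolvent identity the transform at z r
    equals the one at the fixed point z s plus (z r - z s) P r, with P the integral of the product
    of the two kernels. The first summand is differentiated in time only; in the second the
    increment vanishes at s and P is continuous there. *)
Lemma is_derive_stieltjes_along b X Y (dX dY : R) T s : s < T -> 0 < Y s ->
  is_derive s 1 X dX -> is_derive s 1 Y dY ->
  is_derive s 1 (fun r => cpart b (stieltjes (rho (T - r)) (X r +i* Y r)))
    (cpart b ((dX +i* dY) * stieltjes2 (rho (T - s)) (X s +i* Y s)
              - stieltjes_rate beta V (rho (T - s)) (X s +i* Y s))).
Proof.
move=> sT Ys hX hY.
have mom t (t0 : 0 <= t) := rho_moments beta_ge0 alpha_gt0 V_convex rho0_compact sol t0.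
have cX := is_derive_continuous hX; have cY := is_derive_continuous hY.
pose z r := X r +i* Y r; pose z0 := z s.
have z00 : complex.Im z0 != 0 by rewrite /z0 /z /= gt_eqF.
pose P r := Cint (rho (T - r)) (fun x => cauchy (z r) x * cauchy z0 x).
(* In Q both kernels are frozen at z0, so its continuity is that of the integral of a fixed tame
   function; P - Q is of the order of the displacement z r - z0. *)
pose Q r := Cint (rho (Num.max (T - r) 0)) (fun x => cauchy z0 x ^+ 2).
have Ys2 : 0 < Y s / 2 by rewrite divr_gt0.
have nearY : \forall r \near s, Y s / 2 < Y r.
  near=> r; have : `|Y s - Y r| < Y s / 2 by near: r; exact: near_continuous.
  rewrite ltr_norml => /andP[_]; lra.
have nearT : \forall r \near s, r < T by exact: lt_nbhsl.
have Qs : Q s = P s.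
  rewrite /Q /P max_l; last by rewrite subr_ge0 ltW.
  by apply: eq_Cint => x; rewrite expr2.
pose B : R := (Y s / 2)^-1 * ((Y s)^-1) ^+ 2.
have B0 : 0 <= B by rewrite mulr_ge0 ?exprn_ge0 ?invr_ge0 // ltW.
have closePQ r : Y s / 2 < Y r -> r < T -> cabs (P r - Q r) <= cabs (z r - z0) * B.
  move=> Yr rT; have T0 : 0 <= T - r by rewrite subr_ge0 ltW.
  have Yr0 : 0 < Y r by apply: lt_trans Yr.
  have zr0 : complex.Im (z r) != 0 by rewrite /z /= gt_eqF.
  have tz := ctame_cauchy zr0; have tw := ctame_cauchy z00; have tw2 := ctameX 2 tw.
  rewrite /P /Q max_l // -(CintB (mom _ T0)) //; last exact: ctameM.
  have -> : Cint (rho (T - r)) (fun x => cauchy (z r) x * cauchy z0 x - cauchy z0 x ^+ 2)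
      = (z r - z0) * Cint (rho (T - r)) (fun x => cauchy (z r) x * cauchy z0 x ^+ 2).
    rewrite -(CintZ (mom _ T0)); last exact: ctameM.
    by apply: eq_Cint => x; rewrite expr2 -mulrBl (cauchy_resolvent x zr0 z00); ring.
  rewrite cabsM ler_wpM2l ?cabs_ge0 //; apply: (cabs_Cint_bound (mom _ T0)); first exact: ctameM.
  move=> x; rewrite cabsM cabsX; apply: ler_pM => //; try exact: cabs_ge0.
  - by rewrite exprn_ge0 // cabs_ge0.
  - apply: (le_trans (cabs_cauchy_le x zr0)); rewrite /z /= (ger0_norm (ltW Yr0)).
    by rewrite lef_pV2 ?posrE // ltW.
  - rewrite lerXn2r ?nnegrE ?cabs_ge0 ?invr_ge0 ?(ltW Ys) //.
    by apply: (le_trans (cabs_cauchy_le x z00)); rewrite /z0 /z /= (ger0_norm (ltW Ys)).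
have cP b' : {for s, continuous (fun r => cpart b' (P r))}.
  apply/cvgrPdist_lt => e e0.
  have cQ : {for s, continuous (fun r => cpart b' (Q r))}.
    apply: (@continuous_comp _ _ _ (fun r => T - r)
      (fun r => cpart b' (Cint (rho (Num.max r 0)) (fun x => cauchy z0 x ^+ 2)))).
      by apply: continuousB; [exact: cst_continuous|].
    have tw2 := ctameX 2 (ctame_cauchy z00).
    exact: (@cpart_Cint_continuous _ _ _ _ _ _ beta_ge0 alpha_gt0 V_convex rho0_compact sol b' _ tw2).
  have e4 : 0 < e / 4 by rewrite divr_gt0.
  have eB : 0 < e / 4 / (B + 1) by rewrite divr_gt0 // ltr_wpDl.
  near=> r.
  have rT : r < T by near: r; exact: nearT.
  have Yr : Y s / 2 < Y r by near: r; exact: nearY.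
  have h1 : `|X s - X r| < e / 4 / (B + 1) by near: r; exact: near_continuous.
  have h2 : `|Y s - Y r| < e / 4 / (B + 1) by near: r; exact: near_continuous.
  have h3 : `|cpart b' (Q s) - cpart b' (Q r)| < e / 4.
    by near: r; exact: (near_continuous cQ).
  have h4 := closePQ r Yr rT.
  have h5 : cabs (z r - z0) * B <= e / 2.
    have h6 : cabs (z r - z0) <= e / 2 / (B + 1).
      apply: (le_trans (cabs_le_ReIm _)); rewrite /z0 /z /= distrC [`|Y r - _|]distrC.
      by rewrite (_ : e / 2 / (B + 1) = e / 4 / (B + 1) + e / 4 / (B + 1)); [lra|field; rewrite lt0r_neq0 // ltr_wpDl].
    apply: (@le_trans _ _ (e / 2 / (B + 1) * (B + 1))).
      by apply: ler_pM => //; [exact: cabs_ge0|rewrite lerDl].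
    by rewrite divfK // lt0r_neq0 // ltr_wpDl.
  have h7 := cpart_le b' (P r - Q r); rewrite cpartD cpartN in h7.
  rewrite -Qs; move: h3 h7; rewrite ltr_norml => /andP[h31 h32].
  move=> h7; have := le_trans h7 (le_trans h4 h5); rewrite ler_norml ltr_norml => /andP[h61 h62].
  by clear - beta_ge0 alpha_gt0 V_convex rho0_compact sol h31 h32 h61 h62; apply/andP; split; lra.
have e : \near s, cpart b (stieltjes (rho (T - s)) z0) + cpart b ((z s - z0) * P s)
    = cpart b (stieltjes (rho (T - s)) (X s +i* Y s)).
  near=> r.
  have rT : r < T by near: r; exact: nearT.
  have Yr : Y s / 2 < Y r by near: r; exact: nearY.
  have T0 : 0 <= T - r by rewrite subr_ge0 ltW.
  have zr0 : complex.Im (z r) != 0 by rewrite /z /= gt_eqF // (lt_trans Ys2).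
  by rewrite -cpartD /P -(stieltjesB (mom _ T0)) //; congr cpart; rewrite addrC subrK.
apply: (near_eq_is_derive e).
have dU : is_derive s 1 (fun r => cpart b (stieltjes (rho (T - r)) z0))
    (- cpart b (stieltjes_rate beta V (rho (T - s)) z0)).
  have Ts : 0 < T - s by rewrite subr_gt0.
  have d1 := @is_derive_stieltjes _ _ _ _ _ _ beta_ge0 alpha_gt0 V_convex rho0_compact sol b z0 _ z00 Ts.
  have d2 : is_derive s 1 (fun r => T - r) (-1).
    by apply: is_derive_eq; rewrite /GRing.scale /=; ring.
  apply: (is_derive_eq (@is_derive1_comp _ _ (fun r => T - r) s _ _ d1 d2)).
  by rewrite mulrN1.
have dP : is_derive s 1 (fun r => cpart b ((z r - z0) * P r)) (cpart b ((dX +i* dY) * P s)).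
  have a1 b' := is_derive_increment_mul hX (cP b').
  have a2 b' := is_derive_increment_mul hY (cP b').
  case: b {e dU}; rewrite /cpart.
    have := is_deriveB (a1 true) (a2 false).
    by rewrite cReM /=; congr is_derive; apply/funext => r; rewrite cReM.
  have := is_deriveD (a1 false) (a2 true).
  by rewrite cImM /=; congr is_derive; apply/funext => r; rewrite cImM.
apply: (is_derive_eq (is_deriveD dU dP)).
rewrite -cpartN -cpartD addrC; congr (cpart b (_ * _ - _)).
Unshelve. all: by end_near.
Qed.

End Characteristics.

(** * Backward characteristics *)

Section Comparison.
Variable R : realType.
Implicit Types (y v dy dv g : R -> R) (b C S s : R).

(** An affine substitute for Gronwall: (1 + 2 C (s - a)) y is nondecreasing as long as 2 C (s - a)
    <= 1. *)
Lemma growth_lower_bound y dy C (a S : R) : 0 <= C -> a <= S -> 2 * C * (S - a) <= 1 ->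
  (forall s, a <= s <= S -> is_derive s 1 y (dy s)) ->
  (forall s, a <= s <= S -> 0 <= y s /\ - C * y s <= dy s) ->
  y a <= (1 + 2 * C * (S - a)) * y S.
Proof.
move=> C0 aS CS hd hy.
have := @is_derive_ge0_le _ (fun s => (1 + 2 * C * (s - a)) * y s)
  (fun s => 2 * C * y s + (1 + 2 * C * (s - a)) * dy s) a S aS.
rewrite subrr mulr0 addr0 mul1r; apply.
  move=> s sS.
  have d1 : is_derive s 1 (fun s : R => 1 + 2 * C * (s - a)) (2 * C).
    by apply: is_derive_eq; rewrite /GRing.scale /=; ring.
  apply: (is_derive_eq (is_deriveM d1 (hd s sS))).
  by rewrite /GRing.scale /=; ring.
move=> s /[dup] sS /andP[s0 s1]; have [y0 hy'] := hy s sS.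
have C2 : 0 <= 2 * C by rewrite mulr_ge0.
have c1 : 0 <= 1 + 2 * C * (s - a) by rewrite addr_ge0 // mulr_ge0 // subr_ge0.
have c2 : 2 * C * (s - a) <= 1 by apply: le_trans CS; rewrite ler_wpM2l // lerD2r.
have h1 := ler_wpM2l c1 hy'.
have Cy := mulr_ge0 C0 y0; have h2 := ler_wpM2r Cy c2; lra.
Qed.

(** Here (1 - C s) y is nonincreasing, and 1 - C S >= 1/2. *)
Lemma growth_upper_bound y dy C S : 0 <= C -> 0 <= S -> 2 * C * S <= 1 ->
  (forall s, 0 <= s <= S -> is_derive s 1 y (dy s)) ->
  (forall s, 0 <= s <= S -> 0 <= y s /\ dy s <= C * y s) -> y S <= 2 * y 0.
Proof.
move=> C0 S0 CS hd hy.
have h : (1 - C * S) * y S <= y 0.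
  have := @is_derive_ge0_le _ (fun s => - ((1 - C * s) * y s))
    (fun s => C * y s - (1 - C * s) * dy s) 0 S S0.
  rewrite mulr0 subr0 mul1r lerN2; apply.
    move=> s sS.
    have d1 : is_derive s 1 (fun s : R => 1 - C * s) (- C).
      by apply: is_derive_eq; rewrite /GRing.scale /=; ring.
    apply: (is_derive_eq (is_deriveN (is_deriveM d1 (hd s sS)))).
    by rewrite /GRing.scale /=; ring.
  move=> s /[dup] sS /andP[s0 s1]; have [y0 hy'] := hy s sS.
  have c2 : C * s <= C * S by rewrite ler_wpM2l.
  have c1 : 0 <= 1 - C * s by lra.
  have h1 := ler_wpM2l c1 hy'.
  have := mulr_ge0 (mulr_ge0 C0 s0) (mulr_ge0 C0 y0); lra.
have [yS _] := hy S (introT andP (conj S0 (lexx S))).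
have c : 0 <= 2^-1 - C * S by lra.
by have := mulr_ge0 c yS; lra.
Qed.

(** (1 + 4 C s) y - b s v is nondecreasing and starts at y 0 >= 0: the term b v in y' compensates
    the derivative of b s, and the factor 4 leaves room for all errors of size C. It is used with y
    the height of a characteristic, v = Im U and b = k; dividing by y bounds the energy. *)
Lemma riccati_bound y v dy dv b C S : 0 <= b -> 0 <= C -> 0 <= S ->
  4 * C * S <= 1 -> b * S <= 1 ->
  (forall s, 0 <= s <= S -> is_derive s 1 y (dy s)) ->
  (forall s, 0 <= s <= S -> is_derive s 1 v (dv s)) ->
  (forall s, 0 <= s <= S -> [/\ 0 <= y s, 0 <= v s, b * v s - C * y s <= dy s &
    dv s <= C * (v s + y s)]) ->
  b * S * v S <= (1 + 4 * C * S) * y S.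
Proof.
move=> b0 C0 S0 CS bS hy hv h.
have := @is_derive_ge0_le _ (fun s => (1 + 4 * C * s) * y s - b * s * v s)
  (fun s => 4 * C * y s + (1 + 4 * C * s) * dy s - (b * v s + b * s * dv s)) 0 S S0.
rewrite !mulr0 mul0r addr0 mul1r subr0 => hh.
have [y00 _ _ _] := h 0 (introT andP (conj (lexx 0) S0)).
rewrite -subr_ge0; apply: le_trans y00 _; apply: hh.
  move=> s sS.
  have d1 : is_derive s 1 (fun s : R => 1 + 4 * C * s) (4 * C).
    by apply: is_derive_eq; rewrite /GRing.scale /=; ring.
  have d2 : is_derive s 1 (fun s : R => b * s) b.
    by apply: is_derive_eq; rewrite /GRing.scale /=; ring.
  apply: (is_derive_eq (is_deriveB (is_deriveM d1 (hy s sS)) (is_deriveM d2 (hv s sS)))).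
  by rewrite /GRing.scale /=; ring.
move=> s /[dup] sS /andP[s0 s1]; have [y0 v0 h1 h2] := h s sS.
have c1 : 0 <= 1 + 4 * C * s by rewrite addr_ge0 // !mulr_ge0.
have c2 : 4 * C * s <= 1 by apply: le_trans CS; rewrite ler_wpM2l // mulr_ge0.
have c3 : b * s <= 1 by apply: le_trans bS; rewrite ler_wpM2l.
have bs : 0 <= b * s by rewrite mulr_ge0.
have e1 := ler_wpM2l c1 h1; have e2 := ler_wpM2l bs h2.
have Cy := mulr_ge0 C0 y0.
have e3 := ler_wpM2r Cy c2; have e4 := ler_wpM2r Cy c3.
have e5 := mulr_ge0 bs (mulr_ge0 C0 v0); lra.
Qed.

Lemma never_exits g s0 : 0 <= s0 -> (forall s, 0 <= s <= s0 -> {for s, continuous g}) ->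
  (forall S, 0 <= S <= s0 -> (forall r : R, 0 <= r < S -> 0 <= g r) -> 0 < g S) ->
  forall s, 0 <= s <= s0 -> 0 < g s.
Proof.
move=> s00 cg hg.
suff key : forall s, 0 <= s <= s0 -> 0 <= g s.
  by move=> s /andP[a b]; apply: hg; rewrite ?a // => r /andP[r0 rs]; apply: key; rewrite r0 (le_trans (ltW rs)).
move=> s sS; rewrite leNgt; apply/negP => gs.
pose A := [set r : R | 0 <= r <= s0 /\ g r < 0].
have Ane : A !=set0 by exists s.
have Alb : has_lbound A by exists 0 => r [/andP[]].
have hA : has_inf A by [].
pose S := inf A.
have S0 : 0 <= S by apply: lb_le_inf => // r [/andP[]].
have Ss : S <= s0 by apply: le_trans (ge_inf Alb (conj sS gs)) _; case/andP: sS.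
have below r : 0 <= r < S -> 0 <= g r.
  move=> /andP[r0 rS]; rewrite leNgt; apply/negP => gr.
  have : S <= r by apply: ge_inf => //; split=> //; rewrite r0 (le_trans (ltW rS)).
  by rewrite leNgt rS.
have SS : 0 <= S <= s0 by rewrite S0.
have gS := hg S SS below.
have [d /= d0 hd] := near_continuous (cg S SS) gS.
have [r [rs gr] rS] := inf_adherent d0 hA.
have Sr : S <= r by apply: ge_inf.
have : `|g S - g r| < g S.
  by apply: hd => /=; rewrite distrC ger0_norm ?subr_ge0 //; rewrite ltrBlDl.
by rewrite ltr_norml => /andP[_]; lra.
Qed.

(** The variant in which the hypothesis may also use g S >= 0: a negative value at S > 0 would
    already occur slightly before S. The time 0 is therefore treated separately. *)
Lemma never_exits_closed g s0 : 0 <= s0 -> (forall s, 0 <= s <= s0 -> {for s, continuous g}) ->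
  0 < g 0 ->
  (forall S, 0 <= S <= s0 -> (forall r : R, 0 <= r <= S -> 0 <= g r) -> 0 < g S) ->
  forall s, 0 <= s <= s0 -> 0 < g s.
Proof.
move=> s00 cg g0 hg; apply: never_exits => // S SS below.
have /andP[S0 _] := SS; have [->//|Sn0] := eqVneq S 0.
have Sp : 0 < S by rewrite lt0r Sn0.
apply: hg => // r /andP[r0]; rewrite le_eqVlt => /predU1P[->|rS]; last by apply: below; rewrite r0.
rewrite leNgt; apply/negP => gS; have ngS : 0 < - g S by rewrite oppr_gt0.
have [d /= d0 hd] := near_continuous (cg S SS) ngS.
pose q := Num.max 0 (S - d / 2).
have qS : 0 <= q < S.
  rewrite /q le_max lexx /= gt_max Sp /=; have : 0 < d / 2 by rewrite divr_gt0.
  lra.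
have := below q qS; have : `|g S - g q| < - g S.
  apply: hd => /=; move: (qS) => /andP[_ /ltW qS']; rewrite ger0_norm ?subr_ge0 //.
  have : S - d / 2 <= q by rewrite /q le_max lexx orbT.
  have : 0 < d / 2 by rewrite divr_gt0.
  lra.
by rewrite ltr_norml => /andP[]; lra.
Qed.

End Comparison.

Section BackwardCharacteristic.
Variables (R : realType) (beta alpha : R) (V : {poly R}).
Variables (rho0 : probability (measurableTypeR R) R)
  (rho : R -> probability (measurableTypeR R) R).
Hypotheses (beta_gt0 : 0 < beta) (alpha_gt0 : 0 < alpha)
  (V_convex : forall x : R, alpha <= V^`()^`().[x])
  (rho0_compact : compactly_supported rho0)
  (sol : mckean_vlasov_solution beta V rho0 rho).
Implicit Types (x y t s r T : R) (z w : R[i]) (b : bool) (X Y : R -> R).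

Let beta_ge0 : 0 <= beta := ltW beta_gt0.
Let mom t (t0 : 0 <= t) := rho_moments beta_ge0 alpha_gt0 V_convex rho0_compact sol t0.
Let k := beta / 2.
Let k_gt0 : 0 < k. Proof. by rewrite /k divr_gt0. Qed.

Definition velocity t z : R[i] := k%:C * stieltjes (rho t) z + cpoly V^`() z.

(** The parameter s is the time elapsed backwards from t. As dU/dt is velocity times dU/dz plus the
    source, moving with plus the velocity in backward time cancels the transport. *)
Definition is_characteristic t (S : R) X Y := forall s, 0 <= s <= S ->
  [/\ 0 < Y s,
      is_derive s 1 X (complex.Re (velocity (t - s) (X s +i* Y s))) &
      is_derive s 1 Y (complex.Im (velocity (t - s) (X s +i* Y s)))].

(** One constant for every estimate on the source and on V' at points of modulus at most M and times
    up to T. *)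
Definition field_bound T (M C : R) := 0 <= C /\
  forall t z w, 0 <= t <= T -> 0 < complex.Im z -> 0 < complex.Im w ->
    cabs z <= M -> cabs w <= M ->
  [/\ cabs (source V (rho t) z) <= C * (cabs (stieltjes (rho t) z) + 1),
      `|complex.Im (source V (rho t) z)|
        <= C * (complex.Im (stieltjes (rho t) z) + complex.Im z) &
      cabs (source V (rho t) z - source V (rho t) w) <= C *
        (cabs (stieltjes (rho t) z - stieltjes (rho t) w)
         + (cabs (stieltjes (rho t) w) + 1) * cabs (z - w))] /\
  [/\ cabs (cpoly V^`() z) <= C, `|complex.Im (cpoly V^`() z)| <= C * complex.Im z &
      cabs (cpoly V^`() z - cpoly V^`() w) <= C * cabs (z - w)].

Lemma field_bound_exists T (M : R) : 0 <= T -> 0 <= M -> exists C : R, field_bound T M C.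
Proof.
move=> T0 M0.
have [A A0 hA] := source_bounds beta_ge0 alpha_gt0 V_convex rho0_compact sol T0 M0.
have [B B0 hB] := cpoly_bounds V^`() M0.
exists (A + B); split; first exact: addr_ge0.
move=> t z w tT z0 w0 zM wM.
have [h1 h2 h3] := hA t z w tT z0 w0 zM wM; have [h4 h5 h6] := hB z w zM wM.
have AAB : A <= A + B by rewrite lerDl.
have BAB : B <= A + B by rewrite lerDr.
have U0 := Im_stieltjes_ge0 (mom (proj1 (andP tT))) z0.
split; split.
- by apply: (le_trans h1); rewrite ler_wpM2r // addr_ge0 // cabs_ge0.
- by apply: (le_trans h2); rewrite ler_wpM2r // addr_ge0 // ltW.
- apply: (le_trans h3); rewrite ler_wpM2r // addr_ge0 ?cabs_ge0 //.
  by rewrite mulr_ge0 ?addr_ge0 ?cabs_ge0.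
- exact: le_trans BAB.
- by rewrite (ger0_norm (ltW z0)) in h5; apply: (le_trans h5); rewrite ler_wpM2r // ltW.
- by apply: (le_trans h6); rewrite ler_wpM2r // cabs_ge0.
Qed.

Lemma is_derive_characteristic b t (S : R) X Y s : is_characteristic t S X Y -> S < t ->
  0 <= s <= S ->
  is_derive s 1 (fun r => cpart b (stieltjes (rho (t - r)) (X r +i* Y r)))
    (- cpart b (source V (rho (t - s)) (X s +i* Y s))).
Proof.
move=> hc St sS; have [Ys dX dY] := hc s sS.
have st : s < t by apply: le_lt_trans St; case/andP: sS.
apply: (is_derive_eq (@is_derive_stieltjes_along _ _ _ _ _ _ beta_ge0 alpha_gt0 V_convex
  rho0_compact sol b _ _ _ _ _ _ st Ys dX dY)).
have e u : complex.Re u +i* complex.Im u = u by case: u.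
by rewrite e stieltjes_rateE -/k -/(velocity _ _) opprD addrA subrr add0r cpartN.
Qed.

(** A priori bounds for any characteristic that stays in the ball of radius M. They do not involve
    the initial height, which is what allows starting points arbitrarily near the axis; the
    smallness of S depends on k and C alone. *)
Lemma characteristic_estimates T (M C : R) t (S : R) X Y : field_bound T M C ->
  0 <= S -> S < t -> t <= T -> is_characteristic t S X Y ->
  (forall s, 0 <= s <= S -> cabs (X s +i* Y s) <= M) ->
  80 * k * S <= 1 -> 16 * C * S <= 1 ->
  let U s := stieltjes (rho (t - s)) (X s +i* Y s) in
  [/\ 2 * Y 0 <= 3 * Y S,
      k * S * energy (rho (t - S)) (X S +i* Y S) <= 1 + 4 * C * S,
      forall r, 0 <= r <= S -> cabs (U r) ^+ 2 + 1 <= 2 * (cabs (U S) ^+ 2 + 1),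
      `|X S - X 0| <= 2^-1 & `|Y S - Y 0| <= 2^-1].
Proof.
move=> [C0 hC] S0 St tT hc hM kS CS U.
have CS0 : 0 <= C * S by rewrite mulr_ge0.
have S00 : 0 <= (0 : R) <= S by apply/andP.
have SS : 0 <= S <= S by apply/andP.
have ts s : 0 <= s <= S -> 0 <= t - s <= T.
  by move=> /andP[s0 sS]; apply/andP; split; lra.
have Y0 s (sS : 0 <= s <= S) : 0 < Y s by have [] := hc s sS.
have dX s (sS : 0 <= s <= S) := let: And3 _ h _ := hc s sS in h.
have dY s (sS : 0 <= s <= S) := let: And3 _ _ h := hc s sS in h.
have F s (sS : 0 <= s <= S) := hC _ (X s +i* Y s) (X s +i* Y s) (ts s sS) (Y0 s sS) (Y0 s sS) (hM s sS) (hM s sS).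
have dU b s (sS : 0 <= s <= S) : is_derive s 1 (fun r => cpart b (U r))
    (- cpart b (source V (rho (t - s)) (X s +i* Y s))).
  exact: (@is_derive_characteristic b _ _ _ _ _ hc St sS).
have vE s (sS : 0 <= s <= S) : complex.Im (velocity (t - s) (X s +i* Y s))
    = k * complex.Im (U s) + complex.Im (cpoly V^`() (X s +i* Y s)).
  by rewrite /velocity cImD -/(cpart false (_ * _)) cpart_realM.
have U0 s (sS : 0 <= s <= S) : 0 <= complex.Im (U s).
  by apply: Im_stieltjes_ge0; [apply: mom; case/andP: (ts s sS)|exact: Y0].
have Yge s (sS : 0 <= s <= S) : k * complex.Im (U s) - C * Y s
    <= complex.Im (velocity (t - s) (X s +i* Y s)).
  have [_ [_ h _]] := F s sS; rewrite vE //; move: h; rewrite ler_norml /= => /andP[h _]; lra.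
have est1 : Y 0 <= (1 + 2 * C * (S - 0)) * Y S.
  apply: (growth_lower_bound C0 S0) dY _; first by rewrite subr0; lra.
  move=> s sS; split; first exact: ltW (Y0 s sS).
  have := Yge s sS; have := mulr_ge0 (ltW k_gt0) (U0 s sS); lra.
have YS := Y0 S SS; rewrite subr0 in est1.
have est2 : k * S * complex.Im (U S) <= (1 + 4 * C * S) * Y S.
  apply: (riccati_bound (ltW k_gt0) C0 S0 _ _ dY (dU false)); [lra|lra|].
  move=> s sS; split; [exact: ltW (Y0 s sS)|exact: U0|exact: Yge|].
  have [[_ h _] _] := F s sS; move: h; rewrite ler_norml /= => /andP[h _].
  by rewrite -/(U s) /cpart; lra.
have est3 r : 0 <= r <= S -> cabs (U r) ^+ 2 + 1 <= 2 * (cabs (U S) ^+ 2 + 1).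
  move=> /andP[r0 rS]; pose n s := cpart true (U s) * cpart true (U s)
    + cpart false (U s) * cpart false (U s) + 1.
  have nE s : n s = cabs (U s) ^+ 2 + 1 by rewrite cabs_sqr /n -!expr2.
  have sub s : r <= s <= S -> 0 <= s <= S by move=> /andP[rs ->]; rewrite (le_trans r0 rs).
  have C80 : 0 <= 8 * C by rewrite mulr_ge0.
  have Sr : 2 * (8 * C) * (S - r) <= 1.
    have : C * (S - r) <= C * S by rewrite ler_wpM2l // gerBl.
    lra.
  pose dn s := 2 * (cpart true (U s) * - cpart true (source V (rho (t - s)) (X s +i* Y s))
    + cpart false (U s) * - cpart false (source V (rho (t - s)) (X s +i* Y s))).
  have := @growth_lower_bound _ n dn (8 * C) r S C80 rS Sr.
  rewrite !nE => h; apply: (le_trans (h _ _)).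
  - move=> s /sub sS.
    have d := is_deriveD (is_deriveD (is_deriveM (dU true s sS) (dU true s sS))
      (is_deriveM (dU false s sS) (dU false s sS))) (is_derive_cst (1 : R) s 1).
    apply: (is_derive_eq d).
    by rewrite /GRing.scale /dn /U /=; ring.
  - move=> s /sub sS; rewrite nE; have u0 := cabs_ge0 (U s).
    split; first by rewrite addr_ge0 // sqr_ge0.
    have [[h1 _ _] _] := F s sS; rewrite -/(U s) in h1.
    set G := source V (rho (t - s)) (X s +i* Y s) in h1 *.
    have p1 b : `|cpart b (U s) * - cpart b G| <= cabs (U s) * (C * (cabs (U s) + 1)).
      by rewrite normrM normrN; apply: ler_pM => //; [exact: cpart_le|apply: le_trans h1; exact: cpart_le].
    have := p1 true; have := p1 false; rewrite !ler_norml => /andP[p2 _] /andP[p3 _].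
    rewrite /dn; have := mulr_ge0 C0 (sqr_ge0 (cabs (U s) - 1)).
    have := mulr_ge0 C0 (sqr_ge0 (cabs (U s))); clear - sol mom k_gt0 C0 u0 p2 p3; lra.
  - by rewrite ler_wpM2r ?addr_ge0 ?sqr_ge0 //; clear - sol mom k_gt0 Sr; lra.
have en : k * S * energy (rho (t - S)) (X S +i* Y S) <= 1 + 4 * C * S.
  rewrite -(ler_pM2r YS); apply: le_trans est2.
  have YSn : complex.Im (X S +i* Y S) != 0 by rewrite /= gt_eqF.
  have T0 : 0 <= t - S by case/andP: (ts S SS).
  rewrite /U (Im_stieltjes (mom T0) YSn) /=.
  by rewrite le_eqVlt; apply/orP; left; apply/eqP; ring.
(* The speed is at most k |U| + C. By the comparison |U|^2 is of order 1 / (k S), so k S |U| is of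
   order (k S)^(1/2); 80 k S <= 1 makes it at most 1/4, and C S <= 1/16. *)
have disp b r : 0 <= r <= S -> `|cpart b (velocity (t - r) (X r +i* Y r))| * S <= 2^-1.
  move=> rS; apply: (@le_trans _ _ ((k * cabs (U r) + C) * S)).
    rewrite ler_wpM2r //; apply: (le_trans (cpart_le _ _)); apply: (le_trans (cabsD _ _)).
    rewrite cabsM cabs_real (ger0_norm (ltW k_gt0)) lerD2l.
    by have [_ []] := F r rS.
  have u0 := cabs_ge0 (U r).
  suff : S * k * cabs (U r) <= 4^-1 by lra.
  have Sk0 : 0 <= S * k by rewrite mulr_ge0 // ltW.
  have q : 0 <= S * k * cabs (U r) by rewrite mulr_ge0.
  rewrite -(@ler_pXn2r _ 2) ?nnegrE ?invr_ge0 // exprMn.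
  have YSn : complex.Im (X S +i* Y S) != 0 by rewrite /= gt_eqF.
  have T0 : 0 <= t - S by case/andP: (ts S SS).
  have e1 := cabs_stieltjes_sqr (mom T0) YSn; rewrite -/(U S) in e1.
  have e2 := est3 r rS.
  have e3 : cabs (U r) ^+ 2 <= 2 * energy (rho (t - S)) (X S +i* Y S) + 1.
    by clear - sol mom k_gt0 e1 e2; lra.
  have e4 := ler_wpM2l (sqr_ge0 (S * k)) e3.
  have e5 := ler_wpM2l Sk0 en.
  have e6 : (S * k) * (S * k) <= 80^-1 * (S * k).
    by rewrite ler_wpM2r //; clear - sol mom k_gt0 kS; lra.
  have e7 : S * k * (4 * C * S) <= S * k * 4^-1 by rewrite ler_wpM2l //; clear - sol mom k_gt0 CS; lra.
  have -> : (4^-1 : R) ^+ 2 = 16^-1 by field.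
  apply: (le_trans e4); rewrite mulrDr mulr1 expr2.
  have -> : S * k * (S * k) * (2 * energy (rho (t - S)) (X S +i* Y S))
    = 2 * (S * k * (k * S * energy (rho (t - S)) (X S +i* Y S))) by ring.
  rewrite mulrDr mulr1 in e5; lra.
split => //.
- have := ler_wpM2r (ltW YS) (_ : 4 * C * S <= 1); lra.
- have [c cS ->] := is_derive_MVT S0 dX; rewrite subr0 normrM (ger0_norm S0).
  exact: (disp true).
- have [c cS ->] := is_derive_MVT S0 dY; rewrite subr0 normrM (ger0_norm S0).
  exact: (disp false).
Qed.

End BackwardCharacteristic.

Section CharacteristicExistence.
Variables (R : realType) (beta alpha : R) (V : {poly R}).
Variables (rho0 : probability (measurableTypeR R) R)
  (rho : R -> probability (measurableTypeR R) R).
Hypotheses (beta_gt0 : 0 < beta) (alpha_gt0 : 0 < alpha)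
  (V_convex : forall x : R, alpha <= V^`()^`().[x])
  (rho0_compact : compactly_supported rho0)
  (sol : mckean_vlasov_solution beta V rho0 rho).
Implicit Types (x y t s r T : R) (z w : R[i]) (b : bool) (X Y : R -> R).

Let beta_ge0 : 0 <= beta := ltW beta_gt0.
Let mom t (t0 : 0 <= t) := rho_moments beta_ge0 alpha_gt0 V_convex rho0_compact sol t0.
Let k := beta / 2.
Let k_gt0 : 0 < k. Proof. by rewrite /k divr_gt0. Qed.

Lemma stieltjes_lip (mu : probability (measurableTypeR R) R) (d : R) z w :
  has_moments mu -> 0 < d -> d <= complex.Im z -> d <= complex.Im w ->
  cabs (stieltjes mu z - stieltjes mu w) <= d^-1 ^+ 2 * cabs (z - w).
Proof.
move=> hm d0 dz dw; have z0 := lt_le_trans d0 dz; have w0 := lt_le_trans d0 dw.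
have z0' : complex.Im z != 0 by rewrite gt_eqF.
have w0' : complex.Im w != 0 by rewrite gt_eqF.
rewrite (stieltjesB hm) // cabsM mulrC ler_wpM2r ?cabs_ge0 //.
apply: (cabs_Cint_bound hm); first by apply: ctameM; exact: ctame_cauchy.
move=> x; rewrite cabsM expr2; apply: ler_pM; try exact: cabs_ge0.
  by apply: (le_trans (cabs_cauchy_le x z0')); rewrite gtr0_norm // lef_pV2 ?posrE.
by apply: (le_trans (cabs_cauchy_le x w0')); rewrite gtr0_norm // lef_pV2 ?posrE.
Qed.

(** The velocity is Lipschitz only away from the axis, so its argument is clamped to a box with
    heights at least y0 / 2, and the clamped system is solved on all of [0, S]. As long as the curve
    stays in the box it is a genuine characteristic; then the a priori estimates (height at least 2
    y0 / 3, displacement at most 1/2, with M >= 1) put it strictly inside, so it never leaves. The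
    box lies in the ball of radius 4 M. *)
Lemma characteristic_exists T (M C : R) t (S : R) x0 y0 :
  field_bound V rho T (4 * M) C -> 1 <= M -> 0 <= S -> S < t -> t <= T ->
  80 * k * S <= 1 -> 16 * C * S <= 1 -> `|x0| <= M -> 0 < y0 <= M ->
  exists X Y, [/\ X 0 = x0, Y 0 = y0, is_characteristic beta V rho t S X Y &
    forall s, 0 <= s <= S -> `|X s| <= 2 * M /\ Y s <= 2 * M].
Proof.
move=> hC M1 S0 St tT kS CS x0M /andP[y00 y0M].
have [C0 hC'] := hC.
pose cx := clamp (- (2 * M)) (2 * M); pose cy := clamp (y0 / 2) (2 * M).
pose zc x y := cx x +i* cy y.
pose fld (tau : R) z := k%:C * stieltjes (rho tau) z + cpoly V^`() z.
pose F b s x y := cpart b (fld (Num.max (t - s) 0) (zc x y)).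
have M0 : 0 < M by lra.
have MM : - (2 * M) <= 2 * M by lra.
have yM : y0 / 2 <= 2 * M by lra.
have y20 : 0 < y0 / 2 by rewrite divr_gt0.
have zcI x y : y0 / 2 <= complex.Im (zc x y) by have /andP[] := clamp_in y yM.
have zcI0 x y : 0 < complex.Im (zc x y) := lt_le_trans y20 (zcI x y).
have zcM x y : cabs (zc x y) <= 4 * M.
  apply: (le_trans (cabs_le_ReIm _)).
  have /andP[h1 h2] := clamp_in x MM; have /andP[h3 h4] := clamp_in y yM.
  have : `|complex.Re (zc x y)| <= 2 * M by rewrite ler_norml h1 h2.
  have : `|complex.Im (zc x y)| <= 2 * M by rewrite ler_norml /= /cy; apply/andP; split => //; lra.
  lra.
have zcL x y x' y' : cabs (zc x y - zc x' y') <= `|x - x'| + `|y - y'|.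
  by apply: (le_trans (cabs_le_ReIm _)); apply: lerD; exact: clamp_lip.
pose L := k * (y0 / 2)^-1 ^+ 2 + C + 1.
have kY : 0 <= k * (y0 / 2)^-1 ^+ 2 by rewrite mulr_ge0 ?sqr_ge0 // ltW.
have L0 : 0 < L by rewrite /L; lra.
have lF b : lip_field L (F b).
  move=> s x y x' y'; rewrite /F -cpartN -cpartD; apply: (le_trans (cpart_le _ _)).
  set tau := Num.max (t - s) 0; have tau0 : 0 <= tau by rewrite le_max lexx orbT.
  have h1 := stieltjes_lip (mom tau0) y20 (zcI x y) (zcI x' y').
  (* The bounds on V' do not involve the time and are read off at time 0; [tau] itself may exceed T
     when s is negative. *)
  have t0T : 0 <= (0 : R) <= T by apply/andP; split => //; lra.
  have [_ [_ _ h2]] := hC' 0 _ _ t0T (zcI0 x y) (zcI0 x' y') (zcM x y) (zcM x' y').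
  have h3 := zcL x y x' y'; set D := `|x - x'| + _ in h3 *.
  have D0 : 0 <= D by exact: addr_ge0.
  have -> : fld tau (zc x y) - fld tau (zc x' y') = k%:C * (stieltjes (rho tau) (zc x y)
     - stieltjes (rho tau) (zc x' y')) + (cpoly V^`() (zc x y) - cpoly V^`() (zc x' y')).
    by rewrite /fld; ring.
  apply: (le_trans (cabsD _ _)); rewrite cabsM cabs_real (ger0_norm (ltW k_gt0)).
  have h4 := ler_wpM2l (ltW k_gt0) h1; have h5 := ler_wpM2l kY h3; have h6 := ler_wpM2l C0 h3.
  rewrite /L; clear - sol mom k_gt0 h2 h4 h5 h6 D0; lra.
have cF b x y : continuous (fun s => F b s x y).
  have zn : complex.Im (zc x y) != 0 by rewrite gt_eqF.
  have tz := ctame_cauchy zn.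
  have c1 := @cpart_Cint_continuous _ _ _ _ _ _ beta_ge0 alpha_gt0 V_convex rho0_compact sol b _ tz.
  have c2 : continuous (fun s : R => t - s).
    by apply: continuous_subr => s; [exact: cst_continuous|].
  rewrite (_ : (fun s => _) = fun s => k * cpart b (Cint (rho (Num.max (t - s) 0)) (cauchy (zc x y)))
     + cpart b (cpoly V^`() (zc x y))); last first.
    by apply/funext => s; rewrite /F /fld cpartD cpart_realM.
  apply: continuous_addr; last by move=> s; exact: cst_continuous.
  apply: continuous_mulr; first by move=> s; exact: cst_continuous.
  move=> s; apply: (@continuous_comp _ _ _ (fun s => t - s)
    (fun r => cpart b (Cint (rho (Num.max r 0)) (cauchy (zc x y))))); first exact: c2.
  exact: c1.
have [X [Y [X0 Y0 hXY]]] := picard_lindelof x0 y0 L0 S0 (lF true) (lF false) (cF true) (cF false).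
have in_box s : 0 <= s <= S -> `|X s| <= 2 * M -> y0 / 2 <= Y s <= 2 * M ->
    [/\ 0 < Y s, is_derive s 1 X (complex.Re (velocity beta V rho (t - s) (X s +i* Y s))) &
      is_derive s 1 Y (complex.Im (velocity beta V rho (t - s) (X s +i* Y s)))].
  move=> sS hx hy; have Ys : 0 < Y s by case/andP: hy => h _; exact: lt_le_trans h.
  have zs : zc (X s) (Y s) = X s +i* Y s by rewrite /zc /cx /cy !clamp_id // -ler_norml.
  have [d1 d2] := hXY s sS; rewrite /F zs max_l in d1 d2; first by split.
  by case/andP: sS => _ sS; clear - sol mom k_gt0 sS St; lra.
(* The smallest of the three margins to the sides of the box, positive exactly in its interior. *)
pose g : R -> R^o := (((fun s => 2 * M - `|X s|) : R -> R^o) \min (fun s => 2 * M - Y s))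
    \min (fun s => Y s - y0 / 2).
have g_gt0 s : 0 < g s <-> [/\ `|X s| < 2 * M, Y s < 2 * M & y0 / 2 < Y s].
  rewrite /g /= !lt_min !subr_gt0 -andbA; split; first by case/and3P.
  by case=> -> -> ->.
have g_ge0 s : 0 <= g s -> `|X s| <= 2 * M /\ y0 / 2 <= Y s <= 2 * M.
  by rewrite /g /= !le_min !subr_ge0 -andbA => /and3P[-> -> ->].
have key s : 0 <= s <= S -> 0 < g s.
  move: s; apply: never_exits_closed => //.
  - move=> s sS; have [d1 d2] := hXY s sS.
    have c1 := is_derive_continuous d1; have c2 := is_derive_continuous d2.
    have c3 : {for s, continuous (fun s => 2 * M - `|X s| : R^o)}.
      apply: continuousB; first exact: cst_continuous.
      by apply: continuous_comp; [exact: c1|exact: norm_continuous].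
    have c4 : {for s, continuous (fun s => 2 * M - Y s : R^o)}.
      by apply: continuousB; first exact: cst_continuous.
    have c5 : {for s, continuous (fun s => Y s - y0 / 2 : R^o)}.
      by apply: continuousB => //; exact: cst_continuous.
    exact: (continuous_min (continuous_min c3 c4) c5).
  - by apply/g_gt0; rewrite X0 Y0; clear - sol mom k_gt0 x0M y00 y0M M1; split; lra.
  move=> S' /andP[S'0 S'S] hg; apply/g_gt0.
  have sub r : 0 <= r <= S' -> 0 <= r <= S.
    by move=> /andP[-> h]; exact: le_trans S'S.
  have hc : is_characteristic beta V rho t S' X Y.
    by move=> r rS; have [h1 h2] := g_ge0 r (hg r rS); apply: in_box => //; exact: sub.
  have hM r : 0 <= r <= S' -> cabs (X r +i* Y r) <= 4 * M.
    move=> rS; have [h1 /andP[h2 h3]] := g_ge0 r (hg r rS).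
    apply: (le_trans (cabs_le_ReIm _)) => /=; rewrite (@ger0_norm _ (Y r)); clear - sol mom k_gt0 h1 h2 h3 y20; lra.
  have S't : S' < t by exact: le_lt_trans St.
  have kS' : 80 * k * S' <= 1 by apply: le_trans kS; rewrite ler_wpM2l // mulr_ge0 // ltW.
  have CS' : 16 * C * S' <= 1 by apply: le_trans CS; rewrite ler_wpM2l // mulr_ge0.
  have [e1 _ _ e2 e3] := characteristic_estimates beta_gt0 alpha_gt0 V_convex rho0_compact sol
    hC S'0 S't tT hc hM kS' CS'.
  move: e2 e3; rewrite X0 Y0 in e1 *; rewrite !ler_norml => e2 e3; move: x0M; rewrite ler_norml ltr_norml.
  clear - sol mom k_gt0 M1 y00 y0M e1 e2 e3; move: e2 e3 => /andP[? ?] /andP[? ?] /andP[? ?].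
  by split; [apply/andP; split|..]; lra.
exists X, Y; split => // s sS; have [h1 h2 h3] := (g_gt0 s).1 (key s sS).
  by apply: in_box => //; [exact: ltW|apply/andP; split; exact: ltW].
by split; exact: ltW.
Qed.

End CharacteristicExistence.

(** * Equicontinuity up to the real axis *)

Section StaticEstimate.
Variables (R : realType) (mu : probability (measurableTypeR R) R).
Hypothesis mom : has_moments mu.
Implicit Types (x y r : R) (z w : R[i]).

Lemma cabs_cauchy_dist z x : complex.Im z != 0 -> cabs (cauchy z x) * `|x - complex.Re z| <= 1.
Proof.
move=> z0; have n0 := cabs_gt0 (off_axis_neq0 x z0).
rewrite /cauchy cabsV mulrC ler_pdivrMr // mul1r.
by apply: le_trans (Re_le_cabs _); rewrite cReD cReN.
Qed.

(* On [|x - Re w| <= r] the product is controlled by its square, elsewhere by the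
   Poisson kernel at height r. *)
Lemma cauchy_product_le w1 w2 (r l : R) x : complex.Im w1 != 0 -> complex.Im w2 != 0 ->
  0 < r -> 0 < l -> 2 * cabs (w1 - w2) <= r ->
  cabs (cauchy w1 x) * cabs (cauchy w2 x) <=
    l * (cabs (cauchy w1 x) * cabs (cauchy w2 x)) ^+ 2
    + (r / (2 * l) + 4 / r) * cauchy_im (complex.Re w1) r x.
Proof.
move=> w10 w20 r0 l0 hr; set p1 := cabs (cauchy w1 x); set p2 := cabs (cauchy w2 x).
have p10 : 0 <= p1 by exact: cabs_ge0.
have p20 : 0 <= p2 by exact: cabs_ge0.
have h1 : p1 * `|x - complex.Re w1| <= 1 by exact: cabs_cauchy_dist.
have h2 : p2 * `|x - complex.Re w2| <= 1 by exact: cabs_cauchy_dist.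
rewrite /cauchy_im; set a := complex.Re w1 in h1 *.
set n := (x - a) ^+ 2 + r ^+ 2.
have n0 : 0 < n by rewrite ltr_wpDl ?sqr_ge0 // exprn_gt0.
have rn0 : 0 <= r / n by rewrite divr_ge0 // ltW.
have l20 : 0 <= r / (2 * l) by rewrite divr_ge0 ?mulr_ge0 // ltW.
have r40 : 0 <= 4 / r by rewrite divr_ge0 // ltW.
rewrite mulrDl; have q1 : 0 <= r / (2 * l) * (r / n) by exact: mulr_ge0.
have q2 : 0 <= 4 / r * (r / n) by exact: mulr_ge0.
have [near|far] := lerP `|x - a| r.
  have n2 : n <= 2 * r ^+ 2.
    have : (x - a) ^+ 2 <= r ^+ 2 by rewrite -real_normK ?num_real // lerXn2r ?nnegrE // ltW.
    by rewrite /n; lra.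
  have k1 : (4 * l)^-1 <= r / (2 * l) * (r / n).
    rewrite (_ : r / (2 * l) * (r / n) = (4 * l)^-1 * (2 * r ^+ 2 / n)); last first.
      by field; rewrite !lt0r_neq0.
    by rewrite ler_peMr ?invr_ge0 ?mulr_ge0 ?(ltW l0) // ler_pdivlMr // mul1r.
  have : 0 <= l * (p1 * p2 - (2 * l)^-1) ^+ 2 by rewrite mulr_ge0 ?sqr_ge0 // ltW.
  rewrite (_ : l * _ = l * (p1 * p2) ^+ 2 - p1 * p2 + (4 * l)^-1); last first.
    by field; exact: lt0r_neq0.
  lra.
have d0 : 0 < `|x - a| by exact: lt_trans far.
have h3 : `|x - a| <= 2 * `|x - complex.Re w2|.
  have : `|complex.Re (w1 - w2)| <= r / 2.
    by apply: (le_trans (Re_le_cabs _)); lra.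
  rewrite cReD cReN -/a => h.
  have : `|x - a| <= `|x - complex.Re w2| + `|a - complex.Re w2|.
    rewrite (_ : x - a = (x - complex.Re w2) - (a - complex.Re w2)); last by ring.
    exact: ler_normB.
  lra.
have h4 : p1 * p2 * `|x - a| ^+ 2 <= 2.
  have e1 : p2 * `|x - a| <= 2.
    by apply: (le_trans (ler_wpM2l p20 h3)); rewrite mulrCA -[leRHS]mulr1 ler_pM2l.
  have := ler_pM (mulr_ge0 p10 (ltW d0)) (mulr_ge0 p20 (ltW d0)) h1 e1.
  by rewrite mul1r expr2 mulrACA.
have n2 : n <= 2 * `|x - a| ^+ 2.
  have : r ^+ 2 <= `|x - a| ^+ 2 by rewrite lerXn2r ?nnegrE // ltW.
  by rewrite /n -[(x - a) ^+ 2]real_normK ?num_real //; lra.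
have k2 : p1 * p2 <= 4 / r * (r / n).
  have -> : 4 / r * (r / n) = 4 / n by field; rewrite !lt0r_neq0.
  rewrite ler_pdivlMr //; have := ler_wpM2l (mulr_ge0 p10 p20) n2; lra.
have : 0 <= l * (p1 * p2) ^+ 2 by rewrite mulr_ge0 ?sqr_ge0 // ltW.
lra.
Qed.

Lemma cabs_conj_sub (u v : R[i]) : cabs (u^* - v) ^+ 2
  = cabs u ^+ 2 + cabs v ^+ 2 - 2 * complex.Re (u * v).
Proof. by rewrite !cabs_sqr; case: u => a b; case: v => c d /=; ring. Qed.

(* Near-equality in the Cauchy-Schwarz inequality for the Cauchy kernels at w1 and w2
   forces w1 and w2 to be close. *)
Lemma cauchy_schwarz_stability w1 w2 (h q d r B : R) :
  0 < complex.Im w1 -> 0 < complex.Im w2 -> 0 < h -> 0 < B -> 0 < r ->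
  h * energy mu w1 <= 1 + q -> h * energy mu w2 <= 1 + q ->
  cabs (1 - h%:C * Cint mu (fun x => cauchy w1 x * cauchy w2 x)) <= d -> d <= 2^-1 ->
  complex.Im (stieltjes mu (complex.Re w1 +i* r)) <= B ->
  2 * cabs (w1 - w2) <= r -> 32 * h * B <= r ->
  cabs (w1 - w2) ^+ 2 <= 32 * r * h * B * (q + d).
Proof.
move=> w1p w2p h0 B0 r0 en1 en2 hI d2 hB hr hrB.
have w10 : complex.Im w1 != 0 by rewrite gt_eqF.
have w20 : complex.Im w2 != 0 by rewrite gt_eqF.
have t1 := ctame_cauchy w10; have t2 := ctame_cauchy w20.
have a1 := tame_cabs t1; have a2 := tame_cabs t2.
have s1 : tame (fun x => cabs (cauchy w1 x) ^+ 2) by exact: tameM.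
have s2 : tame (fun x => cabs (cauchy w2 x) ^+ 2) by exact: tameM.
have t12 := ctameM t1 t2; have aP := tameM a1 a2.
set I := Cint _ _ in hI.
pose P x := cabs (cauchy w1 x) * cabs (cauchy w2 x).
have tP : tame P by exact: aP.
have tP2 : tame (fun x => P x ^+ 2) by exact: tameM.
pose P2 := \int[mu]_x P x ^+ 2.
have P20 : 0 <= P2 by apply: Rintegral_ge0 => x _; exact: sqr_ge0.
have hRe : 1 - d <= h * complex.Re I.
  have := le_trans (Re_le_cabs _) hI; rewrite cReD cReN -/(cpart true (_ * _)) cpart_realM /=.
  by rewrite ler_norml => /andP[_]; lra.
(* Both points lie above the axis, so reflecting one of them increases the distance. *)
have dist : cabs (w1 - w2) ^+ 2 <= cabs (w1^* - w2) ^+ 2.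
  rewrite !cabs_sqr; move: w1p w2p; case: (w1) => p1 p2; case: (w2) => q1 q2 /= h1 h2.
  have := mulr_ge0 (ltW h1) (ltW h2); nra.
(* The defect in Cauchy-Schwarz is the integral of |conj(c1) - c2|^2, with c1 and c2 the two
   kernels. Since conj(c1) is the kernel at conj(w1), the resolvent identity makes the integrand
   |conj(w1) - w2|^2 P^2. *)
have key : h * (cabs (w1 - w2) ^+ 2 * P2) <= 2 * (q + d).
  have eJ : cabs (w1^* - w2) ^+ 2 * P2 = energy mu w1 + energy mu w2 - 2 * complex.Re I.
    rewrite /P2 -(tame_intZ mom) // /energy -(tame_intD mom) //.
    have tR := ctame_cpart true t12.
    have -> : complex.Re I = \int[mu]_x cpart true (cauchy w1 x * cauchy w2 x) by [].
    rewrite -(tame_intZ mom) // -(tame_intB mom); [|exact: tameD|exact: tameZ].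
    apply: eq_Rintegral => x _; rewrite -cabs_conj_sub.
    rewrite -exprMn; congr (_ ^+ 2); rewrite /P.
    have w1c : complex.Im (w1^*) != 0 by case: (w1) w10 => p1 p2 /=; rewrite oppr_eq0.
    have ec : (cauchy w1 x)^* = cauchy (w1^*) x.
      rewrite /cauchy conjc_inv; congr (_^-1).
      by apply: complex_ext; case: (w1) => p1 p2 /=; ring.
    have ea : cabs (cauchy w1 x) = cabs ((cauchy w1 x)^*).
      by rewrite /cabs; case: (cauchy w1 x) => p1 p2 /=; rewrite sqrrN.
    rewrite ea ec -!cabsM; congr cabs.
    by rewrite -cauchy_resolvent // -ec.
  have : h * (cabs (w1^* - w2) ^+ 2 * P2) <= 2 * (q + d) by rewrite eJ; lra.
  apply: le_trans; rewrite ler_pM2l //; exact: ler_wpM2r.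
(* A lower bound for P2 is now needed. This l makes h r B / (2 l) equal to 1/8, and 32 h B <= r
   makes the other error at most 1/8. Of the mass 1/2 in [lowP] there remains 1/4 for l h P2. *)
pose l := 4 * r * h * B; have l0 : 0 < l by rewrite !mulr_gt0.
have tk : tame (cauchy_im (complex.Re w1) r).
  have rn : complex.Im (complex.Re w1 +i* r) != 0 by rewrite /= gt_eqF.
  have := (ctame_cauchy rn).2; congr tame; apply/funext => x; by rewrite cauchyE.
have Ik : \int[mu]_x cauchy_im (complex.Re w1) r x <= B.
  apply: le_trans hB; rewrite stieltjesE -/(cpart false _) cpart_Cint le_eqVlt.
  by apply/orP; left; apply/eqP; apply: eq_Rintegral => x _; rewrite /cpart cauchyE.
have lowP : 2^-1 <= h * \int[mu]_x P x.
  have : cabs I <= \int[mu]_x P x.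
    apply: (le_trans (cabs_Cint_le mom t12)); apply: (tame_int_le mom) => //.
      exact: tame_cabs.
    by move=> x; rewrite cabsM.
  move/(ler_wpM2l (ltW h0)); have := ler_wpM2l (ltW h0) (le_trans (ler_norm _) (Re_le_cabs I)).
  lra.
have upP : \int[mu]_x P x <= l * P2 + (r / (2 * l) + 4 / r) * B.
  have c0 : 0 <= r / (2 * l) + 4 / r by rewrite addr_ge0 // divr_ge0 ?mulr_ge0 // ltW.
  apply: (@le_trans _ _ (l * P2 + (r / (2 * l) + 4 / r) * \int[mu]_x cauchy_im (complex.Re w1) r x)).
    rewrite /P2 -(tame_intZ mom) // -(tame_intZ mom) // -(tame_intD mom); try exact: tameZ.
    apply: (tame_int_le mom) => //; first by apply: tameD; exact: tameZ.
    by move=> x; exact: cauchy_product_le.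
  by rewrite lerD2l ler_wpM2l.
have u1 : h * (r / (2 * l) * B) = 8^-1.
  by rewrite /l; field; rewrite !lt0r_neq0.
have u2 : h * (4 / r * B) <= 8^-1.
  rewrite (_ : h * _ = 4 * h * B / r); last by ring.
  rewrite ler_pdivrMr //; lra.
have low2 : 4^-1 <= l * (h * P2).
  have := ler_wpM2l (ltW h0) upP; rewrite mulrDr [_ * B]mulrDl mulrDr u1; lra.
have D0 : 0 <= cabs (w1 - w2) ^+ 2 by exact: sqr_ge0.
have := ler_wpM2l D0 low2; have := ler_wpM2l (ltW l0) key.
rewrite /l; lra.
Qed.

End StaticEstimate.

(** * Boundedness near the axis, and differences along pairs of characteristics *)

Section UniformContinuity.
Variables (R : realType) (beta alpha : R) (V : {poly R}).
Variables (rho0 : probability (measurableTypeR R) R)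
  (rho : R -> probability (measurableTypeR R) R).
Hypotheses (beta_gt0 : 0 < beta) (alpha_gt0 : 0 < alpha)
  (V_convex : forall x : R, alpha <= V^`()^`().[x])
  (rho0_compact : compactly_supported rho0)
  (sol : mckean_vlasov_solution beta V rho0 rho).
Implicit Types (x y t s r T : R) (z w : R[i]) (b : bool) (X Y : R -> R).

Let beta_ge0 : 0 <= beta := ltW beta_gt0.
Let mom t (t0 : 0 <= t) := rho_moments beta_ge0 alpha_gt0 V_convex rho0_compact sol t0.
Let k := beta / 2.
Let k_gt0 : 0 < k. Proof. by rewrite /k divr_gt0. Qed.

Definition in_box (M : R) z := `|complex.Re z| <= M /\ 0 < complex.Im z <= M.

(** Flow back for a time S that depends on t1, k and the field constant only: there the energy is at
    most 2 / (k S), and |U|^2 + 1 changes by at most a factor 2 along the way. *)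
Lemma stieltjes_bounded (t1 t2 M : R) : 0 < t1 -> t1 <= t2 -> 1 <= M ->
  exists2 B : R, 0 < B & forall t z, t1 <= t <= t2 -> in_box M z ->
    cabs (stieltjes (rho t) z) <= B.
Proof.
move=> t10 t12 M1.
have t20 : 0 <= t2 by lra.
have M40 : 0 <= 4 * M by lra.
have [C hC] := field_bound_exists beta_gt0 alpha_gt0 V_convex rho0_compact sol t20 M40.
have [C0 _] := hC.
(* S will be 1 / q, so u S <= 1 holds for each summand u of q; the summand 2 / t1 keeps t - S at
   least t1 / 2. *)
pose q := 2 / t1 + 80 * k + 16 * C.
have k0 := ltW k_gt0.
have p1 : 0 < 2 / t1 by rewrite divr_gt0.
have p2 : 0 < 80 * k by rewrite mulr_gt0.
have p3 : 0 <= 16 * C by rewrite mulr_ge0.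
have q0 : 0 < q by rewrite /q; lra.
pose S := q^-1; have S0 : 0 < S by rewrite invr_gt0.
have le1 u : 0 <= u -> u <= q -> u * S <= 1.
  by move=> u0 uq; rewrite /S ler_pdivrMr // mul1r.
have S1 : S <= t1 / 2.
  have : 2 / t1 * S <= 1 by apply: le1; [exact: ltW|rewrite /q; lra].
  by rewrite mulrAC ler_pdivrMr // mul1r mulrC; lra.
have S2 : 80 * k * S <= 1 by apply: le1; [exact: ltW|rewrite /q; lra].
have S3 : 16 * C * S <= 1 by apply: le1 => //; rewrite /q; lra.
have kS : 0 < k * S by rewrite mulr_gt0.
exists (4 / (k * S) + 2); first by rewrite addr_gt0 // divr_gt0.
move=> t [zp zq] /andP[tt1 tt2] [/= zx zy].
have St : S < t by lra.
have [X [Y [X0 Y0 hc hb]]] := characteristic_exists beta_gt0 alpha_gt0 V_convex rho0_compact sol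
  hC M1 (ltW S0) St tt2 S2 S3 zx zy.
have hM s : 0 <= s <= S -> cabs (X s +i* Y s) <= 4 * M.
  move=> sS; have [h1 h2] := hb s sS; have [h3 _ _] := hc s sS.
  by apply: (le_trans (cabs_le_ReIm _)) => /=; rewrite (gtr0_norm h3); lra.
have [_ en cmp _ _] := characteristic_estimates beta_gt0 alpha_gt0 V_convex rho0_compact sol
  hC (ltW S0) St tt2 hc hM S2 S3.
have S00 : 0 <= (0 : R) <= S by apply/andP; split => //; exact: ltW.
have SS : 0 <= S <= S by apply/andP; split => //; exact: ltW.
have := cmp 0 S00; cbv beta zeta; rewrite subr0 X0 Y0.
have [YS _ _] := hc S SS.
have YSn : complex.Im (X S +i* Y S) != 0 by rewrite /= gt_eqF.
have T0 : 0 <= t - S by lra.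
have := cabs_stieltjes_sqr (mom T0) YSn.
set u := cabs (stieltjes (rho (t - S)) _); set v := cabs (stieltjes (rho t) _).
move=> h1 h2.
have h3 : energy (rho (t - S)) (X S +i* Y S) <= 2 / (k * S).
  by rewrite ler_pdivlMr // mulrC; apply: (le_trans en); lra.
have K0 : 0 < (k * S)^-1 by rewrite invr_gt0.
have v0 : 0 <= v by exact: cabs_ge0.
have h4 : v ^+ 2 <= 4 / (k * S) + 1 by lra.
rewrite leNgt; apply/negP => hv.
have h5 : (4 / (k * S) + 2) ^+ 2 < v ^+ 2.
  by rewrite ltrXn2r // ?nnegrE //; lra.
have : 0 <= (4 / (k * S)) ^+ 2 by exact: sqr_ge0.
move: h5; rewrite sqrrD; lra.
Qed.

(* The increments along two backward characteristics: D' = k E + O(|D|) and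
   E' = O(|D| + |E|) with D, E the differences of positions and of Stieltjes transforms. *)
Lemma pair_estimates (D E dD dE : R -> R[i]) (C L S : R) :
  0 <= C -> 0 <= L -> 0 <= S -> 16 * (k + C + L) * S <= 1 ->
  (forall b s, 0 <= s <= S -> is_derive s 1 (fun r => cpart b (D r)) (cpart b (dD s))) ->
  (forall b s, 0 <= s <= S -> is_derive s 1 (fun r => cpart b (E r)) (cpart b (dE s))) ->
  (forall s, 0 <= s <= S -> cabs (dD s - k%:C * E s) <= C * cabs (D s)) ->
  (forall s, 0 <= s <= S -> cabs (dE s) <= L * (cabs (D s) + cabs (E s))) ->
  cabs (D 0) <= cabs (E 0) ->
  let e := cabs (E 0) in let n := cabs (D 0) in
  cabs (E S - E 0) <= 16 * L * e * S /\
  cabs (D S - (k * S)%:C * E S) <= 2 * n + 32 * (k + C + L) * (k + C + L) * e * S ^+ 2.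
Proof.
move=> C0 L0 S0 hS hD hE hdD hdE hn e n.
have k0 := ltW k_gt0.
pose K := k + C + L; have K0 : 0 <= K by rewrite /K !addr_ge0.
have e0 : 0 <= e by exact: cabs_ge0.
have n0 : 0 <= n by exact: cabs_ge0.
have hK : 16 * (K * S) <= 1 by rewrite mulrA.
have dD_le s : 0 <= s <= S -> cabs (dD s) <= k * cabs (E s) + C * cabs (D s).
  move=> sS; rewrite -[dD s](subrK (k%:C * E s)) addrC.
  apply: (le_trans (cabsD _ _)); rewrite cabsM cabs_real (ger0_norm k0) lerD2l; exact: hdD.
(* The squared size of the pair (D, E) grows at rate at most 8 K, hence at most doubles on [0, S].
   It starts below 2 e^2, which gives the crude bounds 2 e on both members. *)
pose N s := (cpart true (D s) * cpart true (D s) + cpart false (D s) * cpart false (D s))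
  + (cpart true (E s) * cpart true (E s) + cpart false (E s) * cpart false (E s)).
have NE s : N s = cabs (D s) ^+ 2 + cabs (E s) ^+ 2 by rewrite !cabs_sqr /N -!expr2.
pose dN s := 2 * (cpart true (D s) * cpart true (dD s) + cpart false (D s) * cpart false (dD s))
  + 2 * (cpart true (E s) * cpart true (dE s) + cpart false (E s) * cpart false (dE s)).
have N2 s : 0 <= s <= S -> N s <= 2 * N 0.
  move=> /andP[s0 sS]; have sub r : 0 <= r <= s -> 0 <= r <= S.
    by move=> /andP[-> rs]; exact: le_trans sS.
  apply: (@growth_upper_bound _ N dN (8 * K) s); first by rewrite mulr_ge0.
  - exact: s0.
  - have : K * s <= K * S by rewrite ler_wpM2l.
    lra.
  - move=> r /sub rS.
    have d := is_deriveD (is_deriveD (is_deriveM (hD true r rS) (hD true r rS))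
        (is_deriveM (hD false r rS) (hD false r rS)))
      (is_deriveD (is_deriveM (hE true r rS) (hE true r rS))
        (is_deriveM (hE false r rS) (hE false r rS))).
    apply: (is_derive_eq d); by rewrite /GRing.scale /dN /=; ring.
  - move=> r /sub rS; rewrite NE.
    have d0 := cabs_ge0 (D r); have E0 := cabs_ge0 (E r).
    split; first by rewrite addr_ge0 // sqr_ge0.
    have a1 b : cpart b (D r) * cpart b (dD r) <= cabs (D r) * (k * cabs (E r) + C * cabs (D r)).
      apply: (le_trans (ler_norm _)); rewrite normrM; apply: ler_pM => //; first exact: cpart_le.
      by apply: (le_trans (cpart_le _ _)); exact: dD_le.
    have a2 b : cpart b (E r) * cpart b (dE r) <= cabs (E r) * (L * (cabs (D r) + cabs (E r))).
      apply: (le_trans (ler_norm _)); rewrite normrM; apply: ler_pM => //; first exact: cpart_le.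
      by apply: (le_trans (cpart_le _ _)); exact: hdE.
    have b1 := a1 true; have b2 := a1 false; have b3 := a2 true; have b4 := a2 false.
    rewrite /dN /K.
    have c1 := mulr_ge0 k0 (sqr_ge0 (cabs (D r) - cabs (E r))).
    have c2 := mulr_ge0 L0 (sqr_ge0 (cabs (D r) - cabs (E r))).
    have c3 := mulr_ge0 C0 (sqr_ge0 (cabs (E r))); have c4 := mulr_ge0 C0 (sqr_ge0 (cabs (D r))).
    have c5 := mulr_ge0 k0 (sqr_ge0 (cabs (E r))); have c6 := mulr_ge0 k0 (sqr_ge0 (cabs (D r))).
    have c7 := mulr_ge0 L0 (sqr_ge0 (cabs (E r))); have c8 := mulr_ge0 L0 (sqr_ge0 (cabs (D r))).
    lra.
have crude s : 0 <= s <= S -> cabs (D s) <= 2 * e /\ cabs (E s) <= 2 * e.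
  move=> sS; have := N2 s sS; rewrite !NE -/e -/n => h.
  have nn : n ^+ 2 <= e ^+ 2 by rewrite lerXn2r ?nnegrE.
  have s1 := sqr_ge0 (cabs (D s)); have s2 := sqr_ge0 (cabs (E s)).
  by split; rewrite -(@ler_pXn2r _ 2) ?nnegrE ?cabs_ge0 ?mulr_ge0 // exprMn; lra.
(* The mean value theorem is applied to real and imaginary parts separately, whence the factor 2. *)
have mv (F dF : R -> R[i]) (A s : R) : 0 <= s <= S ->
    (forall b r, 0 <= r <= S -> is_derive r 1 (fun r => cpart b (F r)) (cpart b (dF r))) ->
    (forall r, 0 <= r <= S -> cabs (dF r) <= A) -> cabs (F s - F 0) <= 2 * A * s.
  move=> /andP[s0 sS] hF hA; have sub r : 0 <= r <= s -> 0 <= r <= S.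
    by move=> /andP[-> rs]; exact: le_trans sS.
  have h b : `|cpart b (F s - F 0)| <= A * s.
    rewrite cpartD cpartN -[s in A * s]subr0.
    apply: (is_derive_norm_le s0 (fun r rs => hF b r (sub r rs))) => r /sub rS.
    by apply: (le_trans (cpart_le _ _)); exact: hA.
  by apply: (le_trans (cabs_le_ReIm _)); have := h true; have := h false; rewrite /cpart; lra.
have mvE s : 0 <= s <= S -> cabs (E s - E 0) <= 8 * L * e * s.
  move=> sS; have := mv E dE (L * (4 * e)) s sS hE; rewrite (_ : 2 * _ * s = 8 * L * e * s); last by ring.
  apply=> r rS; apply: (le_trans (hdE r rS)); rewrite ler_wpM2l //.
  by have [] := crude r rS; lra.
have mvD s : 0 <= s <= S -> cabs (D s - D 0) <= 4 * (k + C) * e * s.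
  move=> sS; have := mv D dD (k * (2 * e) + C * (2 * e)) s sS hD.
  rewrite (_ : 2 * _ * s = 4 * (k + C) * e * s); last by ring.
  apply=> r rS; apply: (le_trans (dD_le r rS)); have [d1 d2] := crude r rS.
  by apply: lerD; rewrite ler_wpM2l.
have SS : 0 <= S <= S by rewrite S0 lexx.
have LK : L <= K by rewrite /K; lra.
have kCK : k + C <= K by rewrite /K; lra.
have eS0 : 0 <= e * S by rewrite mulr_ge0.
split; first by apply: (le_trans (mvE S SS)); have := mulr_ge0 L0 eS0; lra.
(* Freezing E at the final time: the derivative dD - k E(S) is of order C n + K^2 e S, so after the
   time S the error is of second order in S apart from a multiple of n. *)
pose Q s := D s - s%:C * (k%:C * E S); pose dQ s := dD s - k%:C * E S.
have hQ b s : 0 <= s <= S -> is_derive s 1 (fun r => cpart b (Q r)) (cpart b (dQ s)).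
  move=> sS.
  have d1 : is_derive s 1 (fun r : R => r * cpart b (k%:C * E S)) (cpart b (k%:C * E S)).
    by apply: is_derive_eq; rewrite /GRing.scale /=; ring.
  have -> : (fun r => cpart b (Q r)) = (fun r => cpart b (D r) - r * cpart b (k%:C * E S)).
    by apply/funext => r; rewrite /Q cpartD cpartN (cpart_realM _ r).
  by rewrite /dQ cpartD cpartN; exact: is_deriveB (hD b s sS) d1.
have dQ_le s : 0 <= s <= S -> cabs (dQ s) <= C * n + 16 * K * K * e * S.
  move=> sS; have /andP[s0 sS'] := sS.
  rewrite /dQ (_ : dD s - _ = (dD s - k%:C * E s) + k%:C * ((E s - E 0) - (E S - E 0))); last by ring.
  apply: (le_trans (cabsD _ _)); rewrite cabsM cabs_real (ger0_norm k0).
  have h1 : cabs (E s - E 0 - (E S - E 0)) <= 16 * (L * (e * S)).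
    apply: (le_trans (cabsB _ _)); have := mvE s sS; have := mvE S SS.
    have : L * e * s <= L * e * S by rewrite ler_wpM2l // mulr_ge0.
    lra.
  have h2 : cabs (D s) <= n + 4 * ((k + C) * (e * S)).
    rewrite -[D s](subrK (D 0)); apply: (le_trans (cabsD _ _)); have := mvD s sS.
    have : (k + C) * e * s <= (k + C) * e * S by rewrite ler_wpM2l // mulr_ge0 // addr_ge0.
    rewrite -/n; lra.
  have h3 := ler_wpM2l k0 h1; have h4 := le_trans (hdD s sS) (ler_wpM2l C0 h2).
  have h5 : k * (L * (e * S)) <= K * K * (e * S) / 2.
    rewrite mulrA (_ : K * K * (e * S) / 2 = K * K / 2 * (e * S)); last by ring.
    rewrite ler_wpM2r // /K; have := sqr_ge0 (k - L).
    have := mulr_ge0 k0 C0; have := mulr_ge0 L0 C0; have := sqr_ge0 C; have := sqr_ge0 (k + L); nra.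
  have h6 : C * ((k + C) * (e * S)) <= K * K * (e * S).
    rewrite mulrA ler_wpM2r //; apply: ler_pM => //; [exact: addr_ge0|rewrite /K; lra].
  have h7 := mulr_ge0 (mulr_ge0 K0 K0) eS0; lra.
have := mv Q dQ _ S SS hQ dQ_le.
have -> : Q S - Q 0 = (D S - (k * S)%:C * E S) - D 0.
  have e1 : (k * S)%:C = k%:C * S%:C by rewrite rmorphM.
  have e2 : (0 : R)%:C = 0 by [].
  by rewrite /Q e1 e2; set u := k%:C; set v := S%:C; ring.
move=> h; rewrite -[_ - (k * S)%:C * E S](subrK (D 0)).
apply: (le_trans (cabsD _ _)); rewrite -/n -/K.
have : 2 * (C * n) * S <= n.
  have : 2 * (C * S) <= 1.
    have : C * S <= K * S by rewrite ler_wpM2r // /K; lra.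
    have := mulr_ge0 C0 S0; lra.
  by move/(ler_wpM2r n0); lra.
rewrite expr2; lra.
Qed.

End UniformContinuity.

Section HoelderArgument.
Variables (R : realType) (beta alpha : R) (V : {poly R}).
Variables (rho0 : probability (measurableTypeR R) R)
  (rho : R -> probability (measurableTypeR R) R).
Hypotheses (beta_gt0 : 0 < beta) (alpha_gt0 : 0 < alpha)
  (V_convex : forall x : R, alpha <= V^`()^`().[x])
  (rho0_compact : compactly_supported rho0)
  (sol : mckean_vlasov_solution beta V rho0 rho).
Implicit Types (x y t s r T : R) (z w : R[i]) (b : bool) (X Y : R -> R).

Let beta_ge0 : 0 <= beta := ltW beta_gt0.
Let mom t (t0 : 0 <= t) := rho_moments beta_ge0 alpha_gt0 V_convex rho0_compact sol t0.
Let k := beta / 2.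
Let k_gt0 : 0 < k. Proof. by rewrite /k divr_gt0. Qed.

(* Flowing back for the time S turns the difference e of the two values at time t
   into a distance of order k S e between the characteristics, while the energies
   at their endpoints almost saturate the Cauchy-Schwarz inequality. *)
Lemma increment_bound t (M B C : R) z1 z2 (S : R) : 0 < t -> 1 <= M -> 0 < B ->
  field_bound V rho t (4 * M) C ->
  (forall s z, t / 2 <= s <= t -> in_box (2 * M) z -> cabs (stieltjes (rho s) z) <= B) ->
  let K := k + C + C * (B + 2) in let A := 32 * k * B in
  0 < S -> 2 / t * S <= 1 -> 80 * k * S <= 1 -> 32 * K * S <= 1 ->
  512 * K ^+ 2 / k * S <= 1 -> A * S <= 1 ->
  in_box M z1 -> in_box M z2 ->
  let e := cabs (stieltjes (rho t) z1 - stieltjes (rho t) z2) in let n := cabs (z1 - z2) in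
  0 < e -> n <= e -> 32 * n <= k * S * e ->
  e ^+ 2 <= 512 * A * B / k * ((4 * C + 128 * K ^+ 2 / k) * S + 8 * n / (k * S * e)).
Proof.
move=> t0 M1 B0 hC hB K A S0 St S80 SK SK2 SA; case: z1 => p1 q1; case: z2 => p2 q2.
move=> [zx1 zy1] [zx2 zy2] e n e0 ne nS; rewrite /= in zx1 zy1 zx2 zy2.
have [C0 hC'] := hC.
have k0 := ltW k_gt0.
have L0 : 0 <= C * (B + 2) by rewrite mulr_ge0 //; lra.
have K0 : 0 <= K by rewrite /K; lra.
have A0 : 0 < A by rewrite /A !mulr_gt0.
have S0' := ltW S0.
have St2 : S <= t / 2 by move: St; rewrite mulrAC ler_pdivrMr // mul1r; lra.
have Stt : S < t by lra.
have CK : C <= K by rewrite /K; lra.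
have SC : 16 * C * S <= 1.
  have := ler_wpM2r S0' CK; have := mulr_ge0 C0 S0'; lra.
have [X1 [Y1 [X10 Y10 hc1 hb1]]] := characteristic_exists beta_gt0 alpha_gt0 V_convex rho0_compact sol
  hC M1 S0' Stt (lexx t) S80 SC zx1 zy1.
have [X2 [Y2 [X20 Y20 hc2 hb2]]] := characteristic_exists beta_gt0 alpha_gt0 V_convex rho0_compact sol
  hC M1 S0' Stt (lexx t) S80 SC zx2 zy2.
pose u s := X1 s +i* Y1 s; pose v s := X2 s +i* Y2 s.
have SS : 0 <= S <= S by apply/andP.
have S00 : 0 <= (0 : R) <= S by apply/andP.
have hM X Y (hc : is_characteristic beta V rho t S X Y)
    (hb : forall s, 0 <= s <= S -> `|X s| <= 2 * M /\ Y s <= 2 * M) s :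
    0 <= s <= S -> cabs (X s +i* Y s) <= 4 * M.
  move=> sS; have [h1 h2] := hb s sS; have [h3 _ _] := hc s sS.
  by apply: (le_trans (cabs_le_ReIm _)) => /=; rewrite (gtr0_norm h3); clear - sol mom k_gt0 h1 h2; lra.
have [_ en1 _ _ _] := characteristic_estimates beta_gt0 alpha_gt0 V_convex rho0_compact sol
  hC S0' Stt (lexx t) hc1 (hM _ _ hc1 hb1) S80 SC.
have [_ en2 _ _ _] := characteristic_estimates beta_gt0 alpha_gt0 V_convex rho0_compact sol
  hC S0' Stt (lexx t) hc2 (hM _ _ hc2 hb2) S80 SC.
have ts s : 0 <= s <= S -> t / 2 <= t - s <= t.
  by clear - sol mom k_gt0 V_convex St2; move=> /andP[? ?]; apply/andP; split; lra.
have ts0 s : 0 <= s <= S -> 0 <= t - s <= t.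
  by clear - sol mom k_gt0 V_convex Stt; move=> /andP[? ?]; apply/andP; split; lra.
have bx1 s : 0 <= s <= S -> in_box (2 * M) (u s).
  by move=> sS; have [h1 h2] := hb1 s sS; have [h3 _ _] := hc1 s sS; split => //=; rewrite h3.
have bx2 s : 0 <= s <= S -> in_box (2 * M) (v s).
  by move=> sS; have [h1 h2] := hb2 s sS; have [h3 _ _] := hc2 s sS; split => //=; rewrite h3.
pose D s := u s - v s.
pose E s := stieltjes (rho (t - s)) (u s) - stieltjes (rho (t - s)) (v s).
pose dD s := velocity beta V rho (t - s) (u s) - velocity beta V rho (t - s) (v s).
pose dE s := - (source V (rho (t - s)) (u s) - source V (rho (t - s)) (v s)).
have hD b s : 0 <= s <= S -> is_derive s 1 (fun r => cpart b (D r)) (cpart b (dD s)).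
  move=> sS; have [_ d1 d2] := hc1 s sS; have [_ d3 d4] := hc2 s sS.
  rewrite /dD cpartD cpartN; case: b; [exact: is_deriveB d1 d3|exact: is_deriveB d2 d4].
have hE b s : 0 <= s <= S -> is_derive s 1 (fun r => cpart b (E r)) (cpart b (dE s)).
  move=> sS.
  have d1 := @is_derive_characteristic _ _ _ _ _ _ beta_gt0 alpha_gt0 V_convex rho0_compact sol
    b _ _ _ _ _ hc1 Stt sS.
  have d2 := @is_derive_characteristic _ _ _ _ _ _ beta_gt0 alpha_gt0 V_convex rho0_compact sol
    b _ _ _ _ _ hc2 Stt sS.
  have -> : (fun r => cpart b (E r)) = (fun r => cpart b (stieltjes (rho (t - r)) (u r))
      - cpart b (stieltjes (rho (t - r)) (v r))).
    by apply/funext => r; rewrite /E cpartD cpartN.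
  apply: (is_derive_eq (is_deriveB d1 d2)).
  by rewrite /dE (cpartN b (_ - _)) (cpartD b (source _ _ _)) (cpartN b (source _ _ _)); ring.
have F s (sS : 0 <= s <= S) := hC' _ (u s) (v s) (ts0 s sS)
  (let: And3 h _ _ := hc1 s sS in h) (let: And3 h _ _ := hc2 s sS in h)
  (hM _ _ hc1 hb1 s sS) (hM _ _ hc2 hb2 s sS).
have hdD s : 0 <= s <= S -> cabs (dD s - k%:C * E s) <= C * cabs (D s).
  move=> sS; have [_ [_ _ h]] := F s sS.
  rewrite /dD /velocity -/k (_ : _ - _ = cpoly V^`() (u s) - cpoly V^`() (v s)) //.
  by rewrite /E; ring.
have hdE s : 0 <= s <= S -> cabs (dE s) <= C * (B + 2) * (cabs (D s) + cabs (E s)).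
  move=> sS; rewrite /dE cabsN; have [[_ _ h] _] := F s sS; apply: (le_trans h).
  rewrite -mulrA ler_wpM2l // -/(E s) -/(D s).
  have hv := hB _ _ (ts s sS) (bx2 s sS).
  have := ler_wpM2r (cabs_ge0 (D s)) (_ : cabs (stieltjes (rho (t - s)) (v s)) + 1 <= B + 1).
  have := mulr_ge0 (ltW B0) (cabs_ge0 (E s)); have := cabs_ge0 (E s); have := cabs_ge0 (D s).
  rewrite lerD2r hv; move: (cabs (D s)) (cabs (E s)) (cabs (stieltjes _ _)); clear - sol mom k_gt0 V_convex => p q v'.
  by move=> ? ? ? /(_ isT); lra.
have SK16 : 16 * (k + C + C * (B + 2)) * S <= 1.
  by have := mulr_ge0 K0 S0'; move: SK; rewrite /K; clear - sol mom k_gt0 V_convex; lra.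
have u0 : u 0 = p1 +i* q1 by rewrite /u X10 Y10.
have v0 : v 0 = p2 +i* q2 by rewrite /v X20 Y20.
have eE : cabs (E 0) = e by rewrite /E subr0 u0 v0.
have eD : cabs (D 0) = n by rewrite /D u0 v0.
have := pair_estimates beta_gt0 C0 L0 S0' SK16 hD hE hdD hdE.
rewrite eE eD => /(_ ne) [h1 h2].
rewrite -/k -/K in h2.
have h2' : cabs (D S - (k * S)%:C * E S) <= 2 * n + 32 * K ^+ 2 * e * S ^+ 2.
  by apply: (le_trans h2); rewrite le_eqVlt; apply/orP; left; apply/eqP; ring.
clear h2.
(* E changes by at most 16 C (B + 2) e S <= 16 K S e, which 32 K S <= 1 makes at most e / 2. *)
have ES_lo : e / 2 <= cabs (E S).
  have h3 : e <= cabs (E S) + cabs (E S - E 0).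
    rewrite -eE -[E 0](subKr (E S)); apply: (le_trans (cabsB _ _)); by rewrite subKr lexx.
  have : C * (B + 2) * (e * S) <= K * (e * S).
    by rewrite ler_wpM2r // ?mulr_ge0 ?(ltW e0) // /K; clear - sol mom k_gt0 V_convex k0 C0; lra.
  have := ler_wpM2l (ltW e0) SK; clear - sol mom k_gt0 V_convex h1 h3; lra.
have kSe : 0 < k * S * e by rewrite !mulr_gt0.
have h4 : 32 * K ^+ 2 * e * S ^+ 2 <= k * S * e / 16.
  have h := ler_wpM2l (ltW kSe) SK2.
  have eq : k * S * e * (512 * K ^+ 2 / k * S) = 512 * K ^+ 2 * e * S ^+ 2.
    by field; exact: lt0r_neq0.
  rewrite eq in h; clear - sol mom k_gt0 V_convex h; lra.
have h5 : cabs (D S - (k * S)%:C * E S) <= k * S * e / 8 by clear - sol mom k_gt0 V_convex h2' h4 nS; lra.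
have kS0 : 0 < k * S by rewrite mulr_gt0.
have kSE : cabs ((k * S)%:C * E S) = k * S * cabs (E S).
  by rewrite cabsM cabs_real (gtr0_norm kS0).
have D_lo : k * S * e / 4 <= cabs (D S).
  have : cabs ((k * S)%:C * E S) <= cabs (D S) + cabs (D S - (k * S)%:C * E S).
    by rewrite -{1}[(k * S)%:C * E S](subKr (D S)); exact: cabsB.
  rewrite kSE; have := ler_wpM2l (ltW kS0) ES_lo; clear - sol mom k_gt0 V_convex h5 kSe; lra.
have eB : e <= 2 * B.
  have tt : t / 2 <= t <= t by clear - sol mom k_gt0 V_convex t0; apply/andP; split; lra.
  have box21 : in_box (2 * M) (p1 +i* q1) by rewrite -u0; exact: bx1.
  have box22 : in_box (2 * M) (p2 +i* q2) by rewrite -v0; exact: bx2.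
  apply: (le_trans (cabsB _ _)); have := hB _ _ tt box21; have := hB _ _ tt box22; clear - sol mom k_gt0 V_convex; lra.
have D_up : cabs (D S) <= 3 * (k * S * B).
  have : cabs (D S) <= cabs ((k * S)%:C * E S) + cabs (D S - (k * S)%:C * E S).
    by rewrite -{1}[D S](subrK ((k * S)%:C * E S)) addrC; exact: cabsD.
  have : cabs (E S) <= 2 * B.
    apply: (le_trans (cabsB _ _)).
    have := hB _ _ (ts S SS) (bx1 S SS); have := hB _ _ (ts S SS) (bx2 S SS); clear - sol mom k_gt0 V_convex; lra.
  rewrite kSE => /(ler_wpM2l (ltW kS0)); have := ler_wpM2l (ltW kS0) eB; clear - sol mom k_gt0 V_convex h5 kSe; lra.
have D0 : 0 < cabs (D S) by apply: lt_le_trans D_lo; rewrite divr_gt0.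
have T0 : 0 <= t - S by clear - sol mom k_gt0 V_convex Stt; lra.
have w10 : 0 < complex.Im (u S) by have [] := hc1 S SS.
have w20 : 0 < complex.Im (v S) by have [] := hc2 S SS.
have w1n : complex.Im (u S) != 0 by rewrite gt_eqF.
have w2n : complex.Im (v S) != 0 by rewrite gt_eqF.
pose I := Cint (rho (t - S)) (fun x => cauchy (u S) x * cauchy (v S) x).
have EI : E S = D S * I by rewrite /E (stieltjesB (mom T0)).
(* Since E S = D S I, the error D S - k S E S is D S (1 - k S I). So d is the bound 2 n + 32 K^2 e
   S^2 divided by the lower bound k S e / 4 for |D S|. *)
pose d := 8 * n / (k * S * e) + 128 * K ^+ 2 / k * S.
have hI : cabs (1 - (k * S)%:C * I) <= d.
  have e1 : D S - (k * S)%:C * E S = D S * (1 - (k * S)%:C * I) by rewrite EI; ring.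
  rewrite -(ler_pM2l D0) -cabsM -e1; apply: (le_trans h2').
  have d0 : 0 <= d.
    apply: addr_ge0; first by rewrite divr_ge0 ?(ltW kSe) // mulr_ge0 // cabs_ge0.
    exact: (mulr_ge0 (divr_ge0 (mulr_ge0 (ler0n R 128) (exprn_ge0 2 K0)) k0) S0').
  apply: le_trans (ler_wpM2r d0 D_lo).
  rewrite le_eqVlt; apply/orP; left; apply/eqP; rewrite /d; field.
  by rewrite !lt0r_neq0.
have d2 : d <= 2^-1.
  have : 8 * n / (k * S * e) <= 4^-1 by rewrite ler_pdivrMr //; clear - sol mom k_gt0 V_convex nS; lra.
  by move: SK2; rewrite /d; clear - sol mom k_gt0 V_convex; lra.
have AS0 : 0 < A * S by rewrite mulr_gt0.
have hIm : complex.Im (stieltjes (rho (t - S)) (complex.Re (u S) +i* (A * S))) <= B.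
  apply: (le_trans (ler_norm _)); apply: (le_trans (Im_le_cabs _)); apply: hB; first exact: ts.
  by split; [case: (bx1 S SS)|rewrite /= AS0 /=; clear - sol mom k_gt0 V_convex SA M1; lra].
have h6 : 2 * cabs (u S - v S) <= A * S.
  rewrite -/(D S) /A; have := mulr_gt0 kS0 B0; clear - sol mom k_gt0 V_convex D_up; lra.
have h7 : 32 * (k * S) * B <= A * S.
  by rewrite /A le_eqVlt; apply/orP; left; apply/eqP; ring.
(* Used with h = k S, q = 4 C S and r = A S. The choice A = 32 k B turns the requirement 32 h B <= r
   into an equality, and r proportional to S is what leaves a factor S in the final bound. *)
have := cauchy_schwarz_stability (mom T0) w10 w20 kS0 B0 AS0 en1 en2 hI d2 hIm h6 h7.
rewrite -/(D S) => h8.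
have h9 : (k * S * e / 4) ^+ 2 <= cabs (D S) ^+ 2.
  by rewrite lerXn2r ?nnegrE ?cabs_ge0 // ltW // divr_gt0.
have h10 : (k * S) ^+ 2 * e ^+ 2 <= (k * S) ^+ 2 *
    (512 * A * B / k * ((4 * C + 128 * K ^+ 2 / k) * S + 8 * n / (k * S * e))).
  have := le_trans h9 h8.
  rewrite (_ : (k * S * e / 4) ^+ 2 = (k * S) ^+ 2 * e ^+ 2 / 16); last by field.
  rewrite ler_pdivrMr // => /le_trans; apply.
  rewrite le_eqVlt; apply/orP; left; apply/eqP; rewrite /d; field.
  by rewrite !lt0r_neq0.
by rewrite ler_pM2l // exprn_gt0 in h10.
Qed.

(** In the increment bound one term is proportional to S and the other to n / (S e). If e exceeded
    e0, a flow time S small in terms of e0, followed by n small in terms of S and e0, would make the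
    right-hand side at most e0^2. *)
Lemma stieltjes_unif_continuous t (M : R) : 0 < t -> 1 <= M ->
  forall e0 : R, 0 < e0 -> exists2 n0 : R, 0 < n0 & forall z1 z2,
    in_box M z1 -> in_box M z2 -> cabs (z1 - z2) <= n0 ->
    cabs (stieltjes (rho t) z1 - stieltjes (rho t) z2) <= e0.
Proof.
move=> t0 M1 e0 e00.
have M40 : 0 <= 4 * M by lra.
have [C hC] := field_bound_exists beta_gt0 alpha_gt0 V_convex rho0_compact sol (ltW t0) M40.
have [C0 _] := hC.
have t20 : 0 < t / 2 by rewrite divr_gt0.
have t2t : t / 2 <= t by lra.
have M2 : 1 <= 2 * M by lra.
have [B B0 hB] := stieltjes_bounded beta_gt0 alpha_gt0 V_convex rho0_compact sol t20 t2t M2.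
pose K := k + C + C * (B + 2); pose A := 32 * k * B.
have k0 := ltW k_gt0.
have L0 : 0 <= C * (B + 2) by rewrite mulr_ge0 //; lra.
have K0 : 0 <= K by rewrite /K; lra.
have K20 : 0 <= K ^+ 2 / k by rewrite divr_ge0 ?exprn_ge0.
have A0 : 0 < A by rewrite /A !mulr_gt0.
pose G := 512 * A * B / k; have G0 : 0 < G.
  exact: (divr_gt0 (mulr_gt0 (mulr_gt0 (ltr0Sn R 511) A0) B0) k_gt0).
pose H := 4 * C + 128 * K ^+ 2 / k; have H0 : 0 <= H by rewrite /H; lra.
have e20 : 0 < e0 ^+ 2 by rewrite exprn_gt0.
have GH : 0 <= 2 * G * H / e0 ^+ 2 
  by exact: (divr_ge0 (mulr_ge0 (mulr_ge0 (ler0n R 2) (ltW G0)) H0) (ltW e20)).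
have inv_sum (q p : R) : 0 < q -> p <= q -> p * q^-1 <= 1.
  by move=> q0 pq; rewrite ler_pdivrMr // mul1r.
(* The flow time S is 1 / q. All summands but the last are the smallness conditions of the increment
   bound; the last makes G H S at most e0^2 / 2. *)
pose q := 2 / t + 80 * k + 32 * K + 512 * K ^+ 2 / k + A + 2 * G * H / e0 ^+ 2.
have tp : 0 < 2 / t by rewrite divr_gt0.
have q0 : 0 < q by rewrite /q; clear - sol mom k_gt0 tp k0 K0 K20 A0 GH; lra.
pose S := q^-1; have S0 : 0 < S by rewrite invr_gt0.
have kS0 : 0 < k * S by rewrite mulr_gt0.
(* Likewise for the distance n <= 1 / q': the first two summands give 32 n <= k S e0 and n <= e0,
   the third makes 8 G n / (k S e0) at most e0^2 / 2. *)
pose q' := 32 / (k * S * e0) + e0^-1 + 16 * G / (k * S * e0 ^+ 3).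
have e30 : 0 < e0 ^+ 3 by rewrite exprn_gt0.
have f1 : 0 < 32 / (k * S * e0) by exact: (divr_gt0 (ltr0Sn R 31) (mulr_gt0 kS0 e00)).
have f2 : 0 < e0^-1 by rewrite invr_gt0.
have f3 : 0 < 16 * G / (k * S * e0 ^+ 3).
  exact: (divr_gt0 (mulr_gt0 (ltr0Sn R 15) G0) (mulr_gt0 kS0 e30)).
have q'0 : 0 < q' by rewrite /q'; clear - sol mom k_gt0 f1 f2 f3; lra.
exists q'^-1; first by rewrite invr_gt0.
move=> z1 z2 hz1 hz2; set n := cabs (z1 - z2) => nn0.
set e := cabs _; rewrite leNgt; apply/negP => ee0.
have n0 : 0 <= n by exact: cabs_ge0.
have pn p : 0 <= p -> p <= q' -> p * n <= 1.
  by move=> p0 pq; apply: le_trans (inv_sum _ _ q'0 pq); rewrite ler_wpM2l.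
have g1 : 32 * n <= k * S * e0.
  have : 32 / (k * S * e0) * n <= 1 by apply: pn; [exact: ltW|rewrite /q'; clear - sol mom k_gt0 f1 f2 f3; lra].
  by rewrite mulrAC ler_pdivrMr ?mulr_gt0 // mul1r.
have g2 : n <= e0.
  have : e0^-1 * n <= 1 by apply: pn; [exact: ltW|rewrite /q'; clear - sol mom k_gt0 f1 f2 f3; lra].
  by rewrite mulrC ler_pdivrMr // mul1r.
have g3 : 16 * G * n <= k * S * e0 ^+ 3.
  have : 16 * G / (k * S * e0 ^+ 3) * n <= 1 by apply: pn; [exact: ltW|rewrite /q'; clear - sol mom k_gt0 f1 f2 f3; lra].
  by rewrite mulrAC ler_pdivrMr ?mulr_gt0 // mul1r.
have e_gt0 : 0 < e by exact: lt_trans ee0.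
have kSee : k * S * e0 <= k * S * e by rewrite ler_pM2l // ltW.
have := increment_bound t0 M1 B0 hC hB S0 (inv_sum _ _ q0 _) (inv_sum _ _ q0 _)
  (inv_sum _ _ q0 _) (inv_sum _ _ q0 _) (inv_sum _ _ q0 _) hz1 hz2 e_gt0 _ _.
rewrite -/k -/K -/A -/G -/H -/n -/e => hinc.
have {hinc} : e ^+ 2 <= G * (H * S + 8 * n / (k * S * e)).
  by apply: hinc => //; rewrite /q; clear - sol mom k_gt0 tp k0 K0 K20 A0 GH g1 g2 kSee ee0; lra.
have i1 : G * (H * S) <= e0 ^+ 2 / 2.
  have : 2 * G * H / e0 ^+ 2 * S <= 1 by apply: inv_sum => //; rewrite /q; clear - sol mom k_gt0 tp k0 K0 K20 A0 GH; lra.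
  by rewrite mulrAC ler_pdivrMr // mul1r; clear - sol mom k_gt0 ; lra.
have i2 : G * (8 * n / (k * S * e)) <= e0 ^+ 2 / 2.
  apply: (@le_trans _ _ (G * (8 * n / (k * S * e0)))).
    rewrite ler_pM2l // ler_wpM2l ?mulr_ge0 // lef_pV2 ?posrE ?mulr_gt0 //.
  rewrite mulrA ler_pdivrMr ?mulr_gt0 //.
  rewrite (_ : e0 ^+ 2 / 2 * _ = k * S * e0 ^+ 3 / 2); last by rewrite !exprS; ring.
  clear - sol mom k_gt0 g3; lra.
have : e0 ^+ 2 < e ^+ 2 by rewrite ltrXn2r // ?nnegrE ?(ltW e00) ?(ltW e_gt0).
rewrite mulrDr; clear - sol mom k_gt0 i1 i2; lra.
Qed.

End HoelderArgument.

(** * Boundary values and Stieltjes inversion *)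

Section Extension.
Variable R : realType.
Implicit Types (z w : R[i]) (U : R[i] -> R[i]) (M e n : R).

Definition box_unif_continuous U := forall M, 1 <= M -> forall e, 0 < e ->
  exists2 n, 0 < n & forall z w, in_box M z -> in_box M w -> cabs (z - w) <= n ->
    cabs (U z - U w) <= e.

Definition lift_point z (j : nat) : R[i] := z + 'i * (2^-1 ^+ j)%:C.

(** The limit from above along the heights 2^-j, taken at every point and not only on the axis;
    inside the half-plane it gives U back, so no case distinction is needed on the closed
    half-plane. *)
Definition boundary_limit U z : R[i] :=
  limn (fun j => complex.Re (U (lift_point z j))) +i*
  limn (fun j => complex.Im (U (lift_point z j))).

Lemma lift_pointE z j : complex.Re (lift_point z j) = complex.Re z /\
  complex.Im (lift_point z j) = complex.Im z + 2^-1 ^+ j.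
Proof. by rewrite /lift_point cReD cImD cReM cImM /=; split; ring. Qed.

Lemma half_pow_small e : 0 < e -> exists N : nat, forall j, (N <= j)%N -> 2^-1 ^+ j <= e.
Proof.
move=> e0.
have /cvgrPdist_lt /(_ _ e0) [N _ hN] : (2^-1 ^+ k : R) @[k --> \oo] --> (0 : R).
  by apply: cvg_expr; rewrite ger0_norm ?invr_ge0 // invf_lt1 // ltr1n.
exists N => j Nj; have := hN j Nj; rewrite sub0r normrN => /ltW; apply: le_trans.
exact: ler_norm.
Qed.

Lemma half_pow_gt0 j : 0 < 2^-1 ^+ j :> R.
Proof. by rewrite exprn_gt0 // invr_gt0. Qed.

Lemma half_pow_le1 j : 2^-1 ^+ j <= 1 :> R.
Proof. by rewrite exprn_ile1 ?invr_ge0 // invf_le1 // ler1n. Qed.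

(** The margin 1 in the height keeps all lifted points in the box, as each is raised by at most 1.
    The factor 2 comes from estimating real and imaginary parts separately. *)
Lemma boundary_limit_close U M e n z j : (forall z w, in_box M z -> in_box M w ->
    cabs (z - w) <= n -> cabs (U z - U w) <= e) ->
  box_unif_continuous U -> 1 <= M -> `|complex.Re z| <= M -> 0 <= complex.Im z <= M - 1 ->
  2^-1 ^+ j <= n -> cabs (boundary_limit U z - U (lift_point z j)) <= 2 * e.
Proof.
move=> hn hU M1 zx /andP[z0 zy] jn.
have inb i : in_box M (lift_point z i).
  have [h1 h2] := lift_pointE z i; split; rewrite ?h1 // h2.
  by have := half_pow_gt0 i; have := half_pow_le1 i; move=> *; apply/andP; split; lra.
have dist i l : (i <= l)%N -> cabs (lift_point z l - lift_point z i) <= 2^-1 ^+ i.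
  move=> il; have -> : lift_point z l - lift_point z i = 'i * ((2^-1 ^+ l : R) - 2^-1 ^+ i)%:C.
    by rewrite rmorphB /lift_point; ring.
  rewrite cabsM cabs_real (_ : cabs 'i = 1) ?mul1r; last first.
    by rewrite /cabs /= expr0n /= add0r expr1n sqrtr1.
  rewrite distrC ger0_norm; first by have := half_pow_gt0 l; lra.
  by rewrite subr_ge0 ler_wiXn2l // ?invr_ge0 // invf_le1 // ler1n.
have tail e' : 0 < e' -> exists N, forall i l, (N <= i)%N -> (i <= l)%N ->
    cabs (U (lift_point z l) - U (lift_point z i)) <= e'.
  move=> e'0; have [n' n'0 h] := hU M M1 e' e'0; have [N hN] := half_pow_small n'0.
  exists N => i l Ni il; apply: h => //; apply: (le_trans (dist i l il)); exact: hN.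
have cv b : cvgn (fun i => cpart b (U (lift_point z i))).
  apply/cauchy_cvgP/cauchyP => e' e'0.
  have e'2 : 0 < e' / 2 by rewrite divr_gt0.
  have [N hN] := tail _ e'2.
  exists (cpart b (U (lift_point z N))); exists N => // l /= Nl.
  rewrite /ball /= distrC; have := hN N l (leqnn N) Nl.
  have := cpart_le b (U (lift_point z l) - U (lift_point z N)); rewrite cpartD cpartN.
  lra.
have close b : `|limn (fun i => cpart b (U (lift_point z i))) - cpart b (U (lift_point z j))| <= e.
  have : (fun i => `|cpart b (U (lift_point z i)) - cpart b (U (lift_point z j))|) @ \oo
      --> `|limn (fun i => cpart b (U (lift_point z i))) - cpart b (U (lift_point z j))|.
    by apply: cvg_norm; apply: cvgB; [exact: cv|exact: cvg_cst].
  move=> hc; rewrite -(cvg_lim (@norm_hausdorff _ _) hc); apply: limr_le.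
    by apply/cvg_ex; eexists; exact: hc.
  exists j => // i /= ji; rewrite -cpartN -cpartD; apply: (le_trans (cpart_le _ _)).
  by apply: hn => //; apply: le_trans jn; exact: dist.
apply: (le_trans (cabs_le_ReIm _)); rewrite cReD cImD cReN cImN.
by have := close true; have := close false; rewrite /cpart /boundary_limit /=; lra.
Qed.

Lemma boundary_limit_interior U z : box_unif_continuous U -> 0 < complex.Im z ->
  boundary_limit U z = U z.
Proof.
move=> hU z0; apply/eqP; rewrite -subr_eq0; apply: contraT => ne.
have c0 := cabs_gt0 ne; set c := cabs _ in c0.
pose M := `|complex.Re z| + complex.Im z + 2.
have M1 : 1 <= M by rewrite /M; have := normr_ge0 (complex.Re z); lra.
have c4 : 0 < c / 4 by rewrite divr_gt0.
have [n n0 hn] := hU M M1 _ c4; have [N hN] := half_pow_small n0.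
have zx : `|complex.Re z| <= M by rewrite /M; lra.
have zy : 0 <= complex.Im z <= M - 1.
  by rewrite /M (ltW z0) /=; have := normr_ge0 (complex.Re z); lra.
have h1 := boundary_limit_close hn hU M1 zx zy (hN N (leqnn N)).
have [e1 e2] := lift_pointE z N; have p := half_pow_gt0 N; have q := half_pow_le1 N.
have h2 : cabs (U (lift_point z N) - U z) <= c / 4.
  apply: hn.
  - by split; rewrite ?e1 // e2; move: zy => /andP[? ?]; apply/andP; split; lra.
  - by split => //; move: zy => /andP[? ?]; apply/andP; split; lra.
  - apply: (le_trans (cabs_le_ReIm _)).
    rewrite cReD cImD cReN cImN e1 e2 subrr normr0 add0r (addrC (complex.Im z)) addrK.
    by rewrite (gtr0_norm p) hN.
have : c <= cabs (boundary_limit U z - U (lift_point z N)) + cabs (U (lift_point z N) - U z).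
  rewrite /c (_ : boundary_limit U z - U z = (boundary_limit U z - U (lift_point z N))
    + (U (lift_point z N) - U z)); [exact: cabsD|by ring].
move=> h3; suff : c < c by rewrite ltxx.
lra.
Qed.

Lemma boundary_limit_unif U M e : box_unif_continuous U -> 1 <= M -> 0 < e ->
  exists2 n, 0 < n & forall z w, `|complex.Re z| <= M -> `|complex.Re w| <= M ->
    0 <= complex.Im z <= M - 1 -> 0 <= complex.Im w <= M - 1 -> cabs (z - w) <= n ->
    cabs (boundary_limit U z - boundary_limit U w) <= e.
Proof.
move=> hU M1 e0; have e5 : 0 < e / 5 by rewrite divr_gt0.
have [n n0 hn] := hU M M1 _ e5; have [N hN] := half_pow_small n0.
exists n => // z w zx wx zy wy zw.
have h1 := boundary_limit_close hn hU M1 zx zy (hN N (leqnn N)).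
have h2 := boundary_limit_close hn hU M1 wx wy (hN N (leqnn N)).
have p := half_pow_gt0 N; have q := half_pow_le1 N.
have h3 : cabs (U (lift_point z N) - U (lift_point w N)) <= e / 5.
  apply: hn.
  - have [e1 e2] := lift_pointE z N; split; rewrite ?e1 // e2.
    by move: zy => /andP[? ?]; apply/andP; split; lra.
  - have [e1 e2] := lift_pointE w N; split; rewrite ?e1 // e2.
    by move: wy => /andP[? ?]; apply/andP; split; lra.
  - by rewrite /lift_point opprD addrACA subrr addr0.
rewrite (_ : _ - _ = (boundary_limit U z - U (lift_point z N))
  + (U (lift_point z N) - U (lift_point w N)) - (boundary_limit U w - U (lift_point w N))); last by ring.
apply: (le_trans (cabsB _ _)); apply: (le_trans (lerD (cabsD _ _) (lexx _))); lra.
Qed.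

Lemma complex_norm_cabs z : `|z| = (cabs z)%:C.
Proof. by rewrite normc_def; case: z. Qed.

Lemma box_unif_continuous_extends U : box_unif_continuous U -> extends_continuously U.
Proof.
move=> hU; exists (boundary_limit U : R[i]^o -> R[i]^o); split; last first.
  by move=> z z0; exact: boundary_limit_interior.
apply/subspace_continuousP => z /= Az; apply/cvgrPdist_le => e e0.
(* Radii are positive elements of R[i], and positivity there includes being real. *)
have er : e = (complex.Re e)%:C by move: e0; rewrite ltcE => /andP[/eqP /= e1 _]; apply: complex_ext.
have e0' : 0 < complex.Re e by move: e0; rewrite ltcE => /andP[_].
have z0 : 0 <= complex.Im z by exact: Az.
pose M := `|complex.Re z| + complex.Im z + 3.
have rz := normr_ge0 (complex.Re z).
have M1 : 1 <= M by rewrite /M; lra.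
have [n n0 hn] := boundary_limit_unif hU M1 e0'.
pose d := Num.min n 1; have d0 : 0 < d by rewrite lt_min n0 ltr01.
rewrite /within /=; apply/nbhs_ballP; exists d%:C; first by rewrite /= ltcR.
move=> w /=; rewrite /ball /= complex_norm_cabs ltcR => zw Aw.
have w0 : 0 <= complex.Im w by exact: Aw.
have zw' := ltW zw; move: zw'; rewrite /d le_min => /andP[zwn zw1].
have hx : `|complex.Re w| <= `|complex.Re z| + 1.
  have := le_trans (Re_le_cabs (z - w)) zw1; rewrite cReD cReN => h.
  rewrite (_ : complex.Re w = complex.Re z - (complex.Re z - complex.Re w)); last by ring.
  by apply: (le_trans (ler_normB _ _)); rewrite lerD2l.
have hy : complex.Im w <= complex.Im z + 1.
  have := le_trans (Im_le_cabs (z - w)) zw1; rewrite cImD cImN ler_norml => /andP[? ?]; lra.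
rewrite er complex_norm_cabs lecR; apply: hn => //; rewrite /M; try lra.
all: by apply/andP; split; lra.
Qed.

End Extension.

(** * Stieltjes inversion and the density *)

Section Density.
Variable R : realType.
Implicit Types (a b x y h e : R) (p : R -> R).

(** The half-open intervals form a generating family stable under intersection and exhaust the line
    with finite mass, so two measures that agree on them coincide. *)
Lemma density_of_intervals (mu : probability (measurableTypeR R) R) p :
  continuous p -> (forall x, 0 <= p x) ->
  (forall a b, a < b -> mu `]a, b]%classic = (\int[lebesgue_measure]_(x in `]a, b]) (p x)%:E)%E) ->
  forall A : set (measurableTypeR R), measurable A ->
    mu A = (\int[lebesgue_measure]_(x in A) (p x)%:E)%E.
Proof.
move=> cp p0 h.
pose nu (A : set (measurableTypeR R)) : \bar R := (\int[lebesgue_measure]_(x in A) (p x)%:E)%E.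
have mp (A : set (measurableTypeR R)) : measurable_fun A (EFin \o p).
  by apply/measurable_EFinP; apply: measurable_funTS; exact: continuous_measurable_fun.
have nu0 : nu set0 = 0%E by rewrite /nu integral_set0.
have nu_ge0 A : (0 <= nu A)%E by apply: integral_ge0 => x _; rewrite lee_fin.
have nu_sa : semi_sigma_additive nu.
  move=> F mF tF mUF; rewrite /nu ge0_integral_bigcup //; last by move=> x _; rewrite lee_fin.
  by apply: is_cvg_ereal_nneg_natsum_cond => n _ _; exact: nu_ge0.
pose nuM : {measure set (measurableTypeR R) -> \bar R} :=
  HB.pack nu (isMeasure.Build _ _ _ nu nu0 nu_ge0 nu_sa).
move=> A mA; rewrite -[RHS]/(nuM A).
pose g (k : nat) : set (measurableTypeR R) := `](- k%:R : R), (k%:R : R)]%classic.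
have cover : \bigcup_k g k = setT by rewrite /g bigcup_itvT.
have fin_mu k : (mu (g k) < +oo)%E.
  by apply: (le_lt_trans (@probability_le1 _ _ _ mu (g k) (measurable_itv _))) => //; rewrite ltry.
apply: (@measure_unique _ R (measurableTypeR R) (@ocitv R) g erefl (@ocitvI R)
  (fun k => is_ocitv _ _) cover mu nuM _ fin_mu A mA).
by move=> X /ocitvP[->|[[a b] /= ab ->]]; [rewrite !measure0|exact: h].
Qed.

(** Integration starts at a - 1 so that the derivative at the endpoint a is two-sided. *)
Lemma continuous_primitive p a b : continuous p -> a <= b ->
  exists P : R -> R, forall x, a <= x <= b -> is_derive x 1 P (p x).
Proof.
move=> cp ab; exists (fun x => \int[lebesgue_measure]_(t in `[a - 1, x]) p t) => x /andP[ax xb].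
have xb1 : x < b + 1 by lra.
have ip : (@lebesgue_measure R).-integrable `[a - 1, b + 1] (EFin \o p).
  by apply: continuous_compact_integrable; [exact: segment_compact|exact: continuous_subspaceT].
have ax1 : a - 1 < x by lra.
have [dP eP] := continuous_FTC1_closed xb1 ip ax1 (cp x).
by apply: DeriveDef; [exact: dP|rewrite -derive1E eP].
Qed.

Lemma primitive_integral p P a b : continuous p -> a < b ->
  (forall x, a <= x <= b -> is_derive x 1 P (p x)) ->
  (\int[lebesgue_measure]_(x in `]a, b]) (p x)%:E)%E = (P b - P a)%:E.
Proof.
move=> cp ab dP.
have cP x : a <= x <= b -> {for x, continuous P}.
  by move=> /dP [d _]; apply/differentiable_continuous/derivable1_diffP.
rewrite integral_itv_obnd_cbnd; last first.
  by apply/measurable_EFinP; apply: measurable_funTS; exact: continuous_measurable_fun.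
rewrite (@continuous_FTC2 _ p P) //.
- exact: continuous_subspaceT.
- split.
  + by move=> x; rewrite in_itv /= => /andP[/ltW ax /ltW xb]; have [] := dP x; rewrite ?ax.
  + by apply: cvg_at_right_filter; apply: cP; rewrite lexx ltW.
  + by apply: cvg_at_left_filter; apply: cP; rewrite lexx ltW.
- move=> x; rewrite in_itv /= => /andP[/ltW ax /ltW xb].
  rewrite derive1E; have axb : a <= x <= b by rewrite ax xb.
  by have [_] := dP x axb.
Qed.

End Density.

Section Inversion.
Variables (R : realType) (mu : probability (measurableTypeR R) R).
Hypothesis mom : has_moments mu.
Implicit Types (a b x y h e k d xi : R) (z w : R[i]).

(** A primitive in x of y / ((x - xi)^2 + y^2). As y tends to 0 it tends to pi/2 or -pi/2 according
    to the sign of x - xi, so differences of angles approximate pi times the indicator of an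
    interval. *)
Definition angle y x xi : R := atan ((x - xi) / y).

Lemma angle_derive y x xi : 0 < y ->
  is_derive x 1 (fun x => angle y x xi) (complex.Im (cauchy (x +i* y) xi)).
Proof.
move=> y0; have d1 : is_derive x 1 (fun x => (x - xi) / y) (y^-1).
  apply: (is_derive_eq (is_deriveM (is_deriveB (is_derive_id x 1) (is_derive_cst xi x 1))
    (is_derive_cst y^-1 x 1))).
  by rewrite scaler0 subr0 add0r /GRing.scale /= mulr1.
apply: (is_derive_eq (is_derive1_comp (is_derive1_atan _) d1)).
rewrite cauchyE /= /cauchy_im; set X := xi - x; have -> : x - xi = - X by rewrite opprB.
have n0 := lt0r_neq0 (sqr_add_gt0 X (lt0r_neq0 y0)).
by field; rewrite n0 lt0r_neq0.
Qed.

Lemma angle_tame y x : tame (angle y x).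
Proof.
apply: (@tame_bounded _ _ (pi / 2)).
  move=> xi; apply: (@continuous_comp _ _ _ (fun xi => (x - xi) / y) (@atan R)).
    by apply: continuousM; [apply: continuousB; [exact: cvg_cst|exact: cvg_id]|exact: cvg_cst].
  exact: continuous_atan.
by move=> xi; rewrite ler_norml !ltW ?atan_ltpi2 ?atan_gtNpi2.
Qed.

Definition mean_angle y x : R := \int[mu]_xi angle y x xi.

Lemma is_derive_mean_angle y x : 0 < y ->
  is_derive x 1 (mean_angle y) (complex.Im (stieltjes mu (x +i* y))).
Proof.
move=> y0.
have d1 x' xi : derivable (fun x' => angle y x' xi) x' 1 by have [] := angle_derive x' xi y0.
have d1E x' xi : partial1of2 (angle y) x' xi = complex.Im (cauchy (x' +i* y) xi).
  by rewrite partial1of2E; have [_ ->] := angle_derive x' xi y0.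
have Ix : [set` `]x - 1, x + 1[] x by rewrite /= in_itv /=; apply/andP; split; lra.
have int x' : [set` `]x - 1, x + 1[] x' -> mu.-integrable setT (EFin \o angle y x').
  by move=> _; exact: (tame_integrable mom (angle_tame y x')).
have bd x' xi : [set` `]x - 1, x + 1[] x' -> [set: R] xi ->
    `|partial1of2 (angle y) x' xi| <= y^-1.
  move=> _ _; rewrite d1E cauchyE /=.
  by have [_] := cauchy_re_im_bound x' xi (lt0r_neq0 y0); rewrite (gtr0_norm y0).
have y0' : forall xi : R, 0 <= y^-1 by move=> _; rewrite invr_ge0 ltW.
have intG : mu.-integrable setT (EFin \o (fun=> y^-1)) := tame_integrable mom (tame_cst _).
have d := @derivable_under_integral _ _ _ mu (angle y) setT measurableT x _ _ Ix int
  (fun x' xi _ _ => d1 x' xi) _ y0' intG bd.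
have dE := @differentiation_under_integral _ _ _ mu (angle y) setT measurableT x _ _ Ix int
  (fun x' xi _ _ => d1 x' xi) _ y0' intG bd.
apply: DeriveDef; first exact: d.
by rewrite -derive1E dE stieltjesE /=; apply: eq_Rintegral => xi _; exact: d1E.
Qed.

Lemma angle_mono y x x' xi : 0 < y -> x <= x' -> angle y x xi <= angle y x' xi.
Proof. by move=> y0 xx; apply: le_atan; rewrite ler_pM2r ?invr_gt0 // lerD2r. Qed.

Lemma angle_ge y h x xi : 0 < y -> h <= x - xi -> atan (h / y) <= angle y x xi.
Proof. by move=> y0 hx; apply: le_atan; rewrite ler_pM2r ?invr_gt0. Qed.

Lemma angle_le y h x xi : 0 < y -> x - xi <= - h -> angle y x xi <= - atan (h / y).
Proof. by move=> y0 hx; rewrite -atanN -mulNr; apply: le_atan; rewrite ler_pM2r ?invr_gt0. Qed.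

(** For xi in the interval, enlarged by h on both sides, the two angles are at least atan(h / y) and
    at most -atan(h / y); elsewhere monotonicity in x makes the right-hand side nonnegative. *)
Lemma angle_indicator_upper y h a b xi : 0 < y -> 0 < h -> a < b ->
  pi * \1_(`]a, b]%classic : set R) xi
  <= angle y (b + h) xi - angle y (a - h) xi + (pi - 2 * atan (h / y)).
Proof.
move=> y0 h0 ab; have hpi := atan_ltpi2 (h / y).
have m : angle y (a - h) xi <= angle y (b + h) xi by apply: angle_mono => //; lra.
rewrite indicE.
have [|_] := boolP (xi \in `]a, b]%classic); last by rewrite mulr0; lra.
rewrite inE /= in_itv /= => /andP[axi xib].
have := @angle_ge y h (b + h) xi y0; have := @angle_le y h (a - h) xi y0 => h1 h2.
have := h1 ltac:(lra); have := h2 ltac:(lra); rewrite mulr1; lra.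
Qed.

(** Inside the interval a difference of angles is below pi. For xi outside, the point a + h or b - h
    lies at distance at least h beyond xi on the side that makes the difference at most pi/2 -
    atan(h / y). *)
Lemma angle_indicator_lower y h a b xi : 0 < y -> 0 < h -> a < b ->
  angle y (b - h) xi - angle y (a + h) xi - (pi - 2 * atan (h / y))
  <= pi * \1_(`]a, b]%classic : set R) xi.
Proof.
move=> y0 h0 ab; have hpi := atan_ltpi2 (h / y).
have u1 : angle y (b - h) xi < pi / 2 := atan_ltpi2 _.
have u2 : - (pi / 2) < angle y (a + h) xi := atan_gtNpi2 _.
have h1 := @angle_ge y h (a + h) xi y0; have h2 := @angle_le y h (b - h) xi y0.
rewrite indicE; have [|] := boolP (xi \in `]a, b]%classic); first by rewrite mulr1; lra.
rewrite notin_setE /= in_itv /= mulr0 => /negP; rewrite negb_and -!leNgt -ltNge => /orP[xia|bxi].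
  have := h1 ltac:(lra); lra.
have := h2 ltac:(lra); lra.
Qed.

End Inversion.

Section BoundaryDensity.
Variable R : realType.
Implicit Types (a b x y h e d xi : R) (z w : R[i]).

Lemma within_half_plane_close (g : R[i]^o -> R[i]^o) :
  {within (closed_upper_half_plane R : set R[i]^o), continuous g} ->
  forall z, 0 <= complex.Im z -> forall e, 0 < e -> exists2 d, 0 < d &
    forall w, 0 <= complex.Im w -> cabs (z - w) < d -> cabs (g z - g w) <= e.
Proof.
move=> /subspace_continuousP cg z z0 e e0.
have e0' : (0 : R[i]) < e%:C by rewrite ltcR.
have /cvgrPdist_le/(_ _ e0') := cg z z0.
rewrite /within /= => /nbhs_ballP[d /= d0 hd].
have d0' : 0 < complex.Re d by move: d0; rewrite ltcE => /andP[_].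
have dE : d = (complex.Re d)%:C.
  by move: d0; rewrite ltcE => /andP[/eqP /= e1 _]; apply: complex_ext.
exists (complex.Re d) => // w w0 zw.
have := hd w; rewrite /ball /= !complex_norm_cabs {1}dE ltcR => /(_ zw w0).
by rewrite lecR.
Qed.

Section Boundary.
Variable g : R[i]^o -> R[i]^o.
Hypothesis cg : {within (closed_upper_half_plane R : set R[i]^o), continuous g}.

Definition boundary_im x : R := complex.Im (g (x +i* 0)).

Lemma boundary_im_close x e : 0 < e -> exists2 d, 0 < d &
  forall x' y, 0 <= y -> `|x - x'| + y < d ->
    `|boundary_im x - complex.Im (g (x' +i* y))| <= e.
Proof.
move=> e0; have [d d0 hd] := within_half_plane_close cg (lexx 0 : 0 <= complex.Im (x +i* 0)) e0.
exists d => // x' y y0 xd.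
rewrite /boundary_im -cImN -cImD; apply: (le_trans (Im_le_cabs _)); apply: hd => //.
apply: le_lt_trans xd; apply: (le_trans (cabs_le_ReIm _)).
by rewrite cReD cImD cReN cImN /= sub0r normrN (ger0_norm y0).
Qed.

Lemma boundary_im_continuous : continuous boundary_im.
Proof.
move=> x; apply/cvgrPdist_le => e e0; have [d d0 hd] := boundary_im_close x e0.
apply/nbhs_ballP; exists d => // x' /=; rewrite /ball /= => xx'.
by apply: hd => //; rewrite addr0.
Qed.

(** Continuity of g at each boundary point controls a whole neighbourhood in x and y; compactness of
    [a, b] yields a common height. *)
Lemma boundary_im_uniform a b e : 0 < e -> exists2 y0, 0 < y0 &
  forall y, 0 < y < y0 -> forall x, a <= x <= b ->
    `|complex.Im (g (x +i* y)) - boundary_im x| <= e.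
Proof.
move=> e0; have /compact_near_coveringP hc := @segment_compact R a b.
have e2 : 0 < e / 2 by rewrite divr_gt0.
have : \forall y \near 0^'+, `[a, b] `<=`
    (fun x => `|complex.Im (g (x +i* y)) - boundary_im x| <= e).
  apply: hc => x _; have [d d0 hd] := boundary_im_close x e2.
  have d2 : 0 < d / 2 by rewrite divr_gt0.
  exists (ball x (d / 2), [set y | 0 < y < d / 2]); first split => /=.
  - exact: nbhsx_ballx.
  - near=> y; apply/andP; split; near: y; [exact: nbhs_right_gt|exact: nbhs_right_lt].
  move=> [x' y] /= [xx' /andP[y0 yd]]; rewrite /ball /= in xx'.
  have h1 : `|boundary_im x - complex.Im (g (x' +i* y))| <= e / 2.
    by apply: hd; [exact: ltW|lra].
  have h2 : `|boundary_im x - boundary_im x'| <= e / 2.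
    by apply: hd => //; lra.
  rewrite distrC in h1.
  rewrite (_ : _ - _ = (complex.Im (g (x' +i* y)) - boundary_im x)
    + (boundary_im x - boundary_im x')); last by ring.
  by apply: (le_trans (ler_normD _ _)); lra.
move=> [y0 /= y00 hy]; exists y0 => // y /andP[y1 y2] x xab.
by apply: (hy y) => //=; rewrite sub0r normrN gtr0_norm.
Unshelve. all: by end_near. Qed.

End Boundary.

Section Inversion.
Variable mu : probability (measurableTypeR R) R.
Hypothesis mom : has_moments mu.
Variable g : R[i]^o -> R[i]^o.
Hypothesis cg : {within (closed_upper_half_plane R : set R[i]^o), continuous g}.
Hypothesis gU : forall z, upper_half_plane R z -> g z = stieltjes mu z.

Lemma boundary_im_ge0 x : 0 <= boundary_im g x.
Proof.
rewrite leNgt; apply/negP => x0.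
have e0 : 0 < - boundary_im g x / 2 by rewrite divr_gt0 // oppr_gt0.
have [d d0 hd] := boundary_im_close cg x e0.
have d2 : 0 < d / 2 by rewrite divr_gt0.
have := hd x (d / 2) (ltW d2); rewrite subrr normr0 add0r gU //.
have := Im_stieltjes_ge0 mom (_ : 0 < complex.Im (x +i* (d / 2))) => /(_ d2) h1 h2.
have := h2 ltac:(lra); rewrite ler_norml => /andP[]; lra.
Qed.

(* The derivative of [mean_angle mu y] is the imaginary part of the transform at
   height [y], which is uniformly close to its boundary values. *)
Lemma mean_angle_limit a b P e : a <= b -> 0 < e ->
  (forall x, a <= x <= b -> is_derive x 1 P (boundary_im g x)) ->
  exists2 y0, 0 < y0 & forall y, 0 < y < y0 -> forall c d, a <= c -> c <= d -> d <= b ->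
    `|mean_angle mu y d - mean_angle mu y c - (P d - P c)| <= e * (d - c).
Proof.
move=> ab e0 dP; have [y0 y00 hy] := boundary_im_uniform cg a b e0.
exists y0 => // y yy0 c d ac cd db; have /andP[y1 _] := yy0.
have ab' x : c <= x <= d -> a <= x <= b by move=> /andP[? ?]; apply/andP; split; lra.
have := @is_derive_norm_le _ (fun x => mean_angle mu y x - P x)
  (fun x => complex.Im (stieltjes mu (x +i* y)) - boundary_im g x) c d e cd.
rewrite (_ : mean_angle mu y d - P d - (mean_angle mu y c - P c) =
  mean_angle mu y d - mean_angle mu y c - (P d - P c)); last by ring.
apply.
  by move=> x xcd; exact: is_deriveB (is_derive_mean_angle mom x y1) (dP x (ab' x xcd)).
by move=> x xcd; rewrite -gU //; exact: hy (ab' x xcd).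
Qed.

Lemma indicator_bounds y h a b : 0 < y -> 0 < h -> a < b ->
  let m := fine (mu `]a, b]%classic) in
  mean_angle mu y (b - h) - mean_angle mu y (a + h) - (pi - 2 * atan (h / y)) <= pi * m /\
  pi * m <= mean_angle mu y (b + h) - mean_angle mu y (a - h) + (pi - 2 * atan (h / y)).
Proof.
move=> y0 h0 ab m.
have mI : measurable (`]a, b]%classic : set (measurableTypeR R)) by exact: measurable_itv.
have i1 : mu.-integrable setT (EFin \o (\1_(`]a, b]%classic : set (measurableTypeR R)) : R -> R)).
  by apply: integrable_indic.
have i2 : mu.-integrable setT (EFin \o (fun xi => pi * \1_(`]a, b]%classic : set R) xi)).
  by have := @integrableZl _ _ _ mu setT measurableT pi _ i1.
have mE : \int[mu]_xi (pi * \1_(`]a, b]%classic : set R) xi) = pi * m.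
  rewrite RintegralZl //; congr (_ * _).
  by rewrite /Rintegral integral_indic // setIT.
have tB x x' : tame (fun xi => angle y x xi - angle y x' xi) by apply: tameB; exact: angle_tame.
have tc (c : R) : tame (fun=> c) := tame_cst c.
rewrite -mE; split.
  rewrite -(tame_intB mom (angle_tame _ _) (angle_tame _ _)) -{1}(tame_int_cst mu (pi - 2 * atan (h / y))).
  rewrite -(tame_intB mom (tB _ _) (tc _)).
  apply: le_Rintegral => //; first by apply: (tame_integrable mom); exact: tameB.
  by move=> xi _; exact: angle_indicator_lower.
rewrite -(tame_intB mom (angle_tame _ _) (angle_tame _ _)) -{1}(tame_int_cst mu (pi - 2 * atan (h / y))).
rewrite -(tame_intD mom (tB _ _) (tc _)).
apply: le_Rintegral => //; first by apply: (tame_integrable mom); exact: tameD.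
by move=> xi _; exact: angle_indicator_upper.
Qed.

End Inversion.
End BoundaryDensity.

Section ContinuousDensity.
Variables (R : realType) (mu : probability (measurableTypeR R) R).
Hypothesis mom : has_moments mu.
Variable g : R[i]^o -> R[i]^o.
Hypothesis cg : {within (closed_upper_half_plane R : set R[i]^o), continuous g}.
Hypothesis gU : forall z, upper_half_plane R z -> g z = stieltjes mu z.
Implicit Types (a b x y h e : R).

Lemma interval_points a b h : a < b -> 0 < h -> h <= 1 -> h <= (b - a) / 2 ->
  [/\ a - 1 <= a - h, a - h <= a, a <= a + h, a + h <= b - h & b - h <= b] /\
  [/\ b <= b + h, b + h <= b + 1, a - h <= b + h, a - 1 <= a + h & b - h <= b + 1] /\
  [/\ a + h <= b + 1, a - 1 <= b - h, a - 1 <= a & b <= b + 1] /\ a <= b + 1 /\ a - 1 <= b.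
Proof. by move=> *; do !split; lra. Qed.

(** Three errors, each at most e / 4: the two edge pieces of length h, the defect pi - 2 atan(h /
    y), and the distance of Im U at height y from its boundary values. So h is fixed first, by the
    bound L on the boundary values, and y afterwards, small compared with h. *)
Lemma interval_mass a b e P : a < b -> 0 < e ->
  (forall x, a - 1 <= x <= b + 1 -> is_derive x 1 P (boundary_im g x)) ->
  `|pi * fine (mu `]a, b]%classic) - (P b - P a)| <= e.
Proof.
move=> ab e0 dP; set m := fine _.
have ab1 : a - 1 <= b + 1 by lra.
have [K K0 hK] := segment_bounded ab1 (continuous_subspaceT (boundary_im_continuous cg)).
pose L := K + 1; have L0 : 0 < L by rewrite /L ltr_wpDl.
have hL x : a - 1 <= x <= b + 1 -> `|boundary_im g x| <= L.
  by move=> /hK h; apply: (le_trans h); rewrite /L; lra.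
pose h := Num.min (Num.min 1 ((b - a) / 2)) (e / (8 * L)).
have ba0 : 0 < (b - a) / 2 by rewrite divr_gt0 // subr_gt0.
have h0 : 0 < h by rewrite !lt_min ltr01 ba0 divr_gt0 // mulr_gt0.
have h1 : h <= 1 by rewrite /h !ge_min lexx.
have h2 : h <= (b - a) / 2 by rewrite /h !ge_min lexx orbT.
have [[c4 a1 a2 c2 b1] [[b2 c6 c5 c1 c3] [[a5 b4 a4 b3] [a3 b5]]]] :=
   interval_points ab h0 h1 h2.
have h3 : L * h <= e / 8.
  have : h <= e / (8 * L) by rewrite /h !ge_min lexx !orbT.
  by rewrite ler_pdivlMr ?mulr_gt0 //; lra.
have Pinc x x' : a - 1 <= x -> x <= x' -> x' <= b + 1 -> `|P x' - P x| <= L * (x' - x).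
  move=> ax xx' xb.
  apply: (is_derive_norm_le xx') => t /andP[? ?]; [apply: dP|apply: hL];
    by rewrite (le_trans ax) // (le_trans _ xb).
pose e1 := e / (4 * (b - a + 2)).
have w0 : 0 < 4 * (b - a + 2) by rewrite mulr_gt0 // addr_gt0 // subr_gt0.
have e10 : 0 < e1 by rewrite divr_gt0.
have e1w : e1 * (b - a + 2) = e / 4 by rewrite /e1; field; rewrite lt0r_neq0 // addr_gt0 // subr_gt0.
have [y0 y00 hy] := mean_angle_limit mom cg gU ab1 e10 dP.
have e8 : 0 < e / 8 by rewrite divr_gt0.
have [M hM] : exists M : R, forall x, M < x -> pi / 2 - atan x <= e / 8.
  have /cvgrPdist_le/(_ _ e8) [M [_ hM]] := @cvgy_atan R.
  by exists M => x Mx; apply: le_trans (hM x Mx); exact: ler_norm.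
pose y := Num.min (y0 / 2) (h / (`|M| + 1)).
have M0 : 0 < `|M| + 1 by rewrite ltr_wpDl.
have y_gt0 : 0 < y by rewrite lt_min !divr_gt0.
have yy0 : 0 < y < y0.
  by rewrite y_gt0 /=; apply: (@le_lt_trans _ _ (y0 / 2)); [rewrite /y ge_min lexx|lra].
have hyM : M < h / y.
  have : y <= h / (`|M| + 1) by rewrite /y ge_min lexx orbT.
  rewrite ler_pdivlMr // => yM; rewrite ltr_pdivlMr //.
  have := ler_wpM2r (ltW y_gt0) (ler_norm M); lra.
have hd := hM _ hyM.
have [lo up] := indicator_bounds mom y_gt0 h0 ab; rewrite -/m in lo up.
have := hy y yy0 _ _ c1 c2 c3; have := hy y yy0 _ _ c4 c5 c6.
have : e1 * (b + h - (a - h)) <= e1 * (b - a + 2) by rewrite ler_pM2l //; clear - mom cg gU h1; lra.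
have : e1 * (b - h - (a + h)) <= e1 * (b - a + 2) by rewrite ler_pM2l //; clear - mom cg gU h0; lra.
have := Pinc _ _ b4 b1 b3; have := Pinc _ _ b5 b2 c6; have := Pinc _ _ c4 a1 a3.
have := Pinc _ _ a4 a2 a5.
rewrite e1w !ler_norml => /andP[p1 p2] /andP[p3 p4] /andP[p5 p6] /andP[p7 p8] k1 k2.
move=> /andP[q1 q2] /andP[q3 q4]; clear - lo up hd h3 p1 p2 p3 p4 p5 p6 p7 p8 k1 k2 q1 q2 q3 q4 e0.
by apply/andP; split; lra.
Qed.

End ContinuousDensity.

Lemma extends_continuous_density (R : realType) (mu : probability (measurableTypeR R) R) :
  has_moments mu -> extends_continuously (stieltjes mu) -> has_continuous_density mu.
Proof.
move=> mom [g [cg gU]]; have pi0 := pi_gt0 R.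
exists (fun x => boundary_im g x / pi).
have cp : continuous (fun x => boundary_im g x / pi).
  by move=> x; apply: continuousM; [exact: boundary_im_continuous|exact: cvg_cst].
split => //; first by move=> x; rewrite divr_ge0 ?(ltW pi0) // (boundary_im_ge0 mom cg gU).
apply: density_of_intervals => //.
  by move=> x; rewrite divr_ge0 ?(ltW pi0) // (boundary_im_ge0 mom cg gU).
move=> a b ab.
have ab1 : a - 1 <= b + 1 by lra.
have [P dP] := continuous_primitive (boundary_im_continuous cg) ab1.
have dPpi x : a <= x <= b -> is_derive x 1 (fun x => P x * pi^-1) (boundary_im g x / pi).
  move=> /andP[ax xb]; have d := dP x ltac:(apply/andP; split; lra).
  apply: (is_derive_eq (is_deriveM d (is_derive_cst pi^-1 x 1))).
  by rewrite scaler0 add0r /GRing.scale /= mulrC.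
rewrite (primitive_integral cp ab dPpi).
have mI : measurable (`]a, b]%classic : set (measurableTypeR R)) by exact: measurable_itv.
have finm : mu `]a, b]%classic \is a fin_num by exact: fin_num_measure.
rewrite -[LHS](fineK finm); congr EFin; rewrite -mulrBl.
apply: (@mulfI _ pi); first exact: lt0r_neq0.
rewrite mulrCA mulfV ?mulr1 ?lt0r_neq0 //.
apply/eqP; rewrite -subr_eq0 -normr_le0; apply/ler_addgt0Pl => e e0; rewrite addr0.
exact: (interval_mass mom cg gU ab e0 dP).
Qed.

Theorem theorem2p1 (R : realType) (beta : R) (n : nat) (V : {poly R})
    (alpha : R) (rho0 : probability (measurableTypeR R) R)
    (rho : R -> probability (measurableTypeR R) R)
    (beta_ge1 : 1 <= beta)
    (degV : size V = (2 * n).+1)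
    (alpha_gt0 : 0 < alpha)
    (V_convex : (alpha%:E <=
       ereal_inf (range (fun x : R => ((deriv (deriv V)).[x])%:E)))%E)
    (rho0_compact : compactly_supported rho0)
    (U0_extends : extends_continuously (stieltjes rho0))
    (rho_solution : mckean_vlasov_solution beta V rho0 rho) :
  (forall t : R, 0 <= t -> extends_continuously (stieltjes (rho t))) /\
  (forall t : R, 0 <= t -> has_continuous_density (rho t)).
Proof.
have beta_gt0 : 0 < beta := lt_le_trans ltr01 beta_ge1.
have beta_ge0 := ltW beta_gt0.
have convex x : alpha <= V^`()^`().[x].
  by rewrite -lee_fin; apply: (le_trans V_convex); apply: ereal_inf_lbound; exists x.
have ext t : 0 <= t -> extends_continuously (stieltjes (rho t)).
  (* At time 0 the measures [rho 0] and [rho0] agree on measurable sets, so their transforms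
     coincide and the hypothesis on [rho0] applies; positive times are covered by uniform continuity
     on boxes. *)
  rewrite le_eqVlt => /predU1P[<-|t0].
    have [_ rho00 _] := rho_solution.
    suff -> : stieltjes (rho 0) = stieltjes rho0 by [].
    by apply/funext => z; rewrite /stieltjes !(eq_prob_integral _ rho00).
  apply: box_unif_continuous_extends => M M1 e e0.
  by have [d d0 h] := stieltjes_unif_continuous beta_gt0 alpha_gt0 convex rho0_compact
    rho_solution t0 M1 e0; exists d.
split => // t t0; apply: extends_continuous_density (ext t t0).
exact: (rho_moments beta_ge0 alpha_gt0 convex rho0_compact rho_solution t0).
Qed.
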